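(* Let $\mathcal{M}$ be a family of axisymmetric metrics with nonnegative scalar curvature which is uniformly asymptotically flat outside of radius $R_0$. Let $\rho_0>0$, suppose that $\mathcal{M}$ is radially monotone at $\rho_0$, and suppose that for each metric in $\mathcal{M}$ one has $A=B=0$ in its cylindrical coordinate expression. Then for every $\rho_1>\max\{\rho_0,R_0\}$, $\epsilon>0$, $\sigma>0$, and $1\le p<2$ there exists a $\delta>0$ such that if $g\in\mathcal{M}$ has ADM mass $m(g)<\delta$, then $$\|g-\delta_{\mathbb{R}^3}\|_{W^{1,p}(\tilde{\Omega}^{\rho_1}_{\rho_0}(\sigma))}<\epsilon\qquad\text{and}\qquad \|q-\delta_{\mathbb{R}^2}\|_{W^{1,p}(\Omega^{\rho_1}_{\rho_0}(\sigma))}<\epsilon,$$ where $\delta_{\mathbb{R}^3}$ is the Euclidean metric in the cylindrical coordinates $(\rho,z,\phi)$, $\delta_{\mathbb{R}^2}=d\rho^2+dz^2$ is the Euclidean metric in the $(\rho,z)$ plane, and $q$ is the orbit metric of $g$ in the $(\rho,z)$ plane.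
   Context: Axisymmetric metrics: smooth, asymptotically flat Riemannian metrics $g$ given in global cylindrical coordinates $(\rho,z,\phi)$ on $\mathbb{R}^3$ by $g=e^{2\alpha-2u}(d\rho^2+dz^2)+\rho^2e^{-2u}(d\phi+B\,d\rho+A\,dz)^2$, where $\alpha,u,A,B$ depend only on $(\rho,z)$. The Killing field is $\eta=\partial/\partial\phi$. The ADM mass is $m(g)=\lim_{R\to\infty}\frac{1}{16\pi}\int_{S_R}(g_{ij,j}-g_{jj,i})\nu^i$; as a standing fact, $m(g)=\frac1{16\pi}\int_{\mathbb{R}^3}\Big[e^{-2(u-\alpha)}\big(R_g+\tfrac{\rho^2e^{-4\alpha+2u}}{2}(\partial_zB-\partial_\rho A)^2\big)+2|\nabla u|^2\Big]\rho\,d\rho\,dz\,d\phi$, with $R_g$ the scalar curvature and $|\nabla u|$ Euclidean. Uniformly asymptotically flat outside of radius $R_0$: there is a constant $C$ such that for every $g\in\mathcal{M}$ and all $r=\sqrt{\rho^2+z^2}\ge R_0$, $|\partial^I u|,|\partial^I\alpha|,|\partial^I A|,|\partial^I B|\le C/r^{1+|I|}$ for multi-indices $|I|\le 2$. Radially monotone at $\rho_0$: for each $g\in\mathcal{M}$, $\frac{\partial}{\partial\rho}\Big(\frac1\rho\frac{|\eta|_g}{|\nabla\rho|_g}\Big)\le0$ on $\{\rho=\rho_0\}$; equivalently $\partial_\rho(\alpha-2u)(\rho_0,z)\le 0$ for all $z$. Regions: $\Omega^{\rho_1}_{\rho_0}(\sigma)=\{(\rho,z):\rho_0+\sigma\le\rho\le\rho_1,\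 |z|\le\rho_1/2\}$ and $\tilde\Omega^{\rho_1}_{\rho_0}(\sigma)=\Omega^{\rho_1}_{\rho_0}(\sigma)\times[0,2\pi)$. Orbit metric: $q(X,Y)=g(\bar X,\bar Y)-g(\bar X,\eta)g(\bar Y,\eta)/|\eta|_g^2$, where $\bar X,\bar Y$ project to $X,Y$; in coordinates $q=e^{2\alpha-2u}(d\rho^2+dz^2)$. Sobolev norms of metrics are norms of the components in the coordinates $(\rho,z,\phi)$ (resp. $(\rho,z)$), with respect to Euclidean measure. *)

(* Defs.v *)
From mathcomp Require Import all_boot all_order all_algebra.
From mathcomp Require Import all_classical all_reals all_analysis.
Import Order.TTheory GRing.Theory Num.Theory.
Import numFieldNormedType.Exports.

Set Implicit Arguments.
Unset Strict Implicit.
Unset Printing Implicit Defensive.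

Local Open Scope classical_set_scope.
Local Open Scope ring_scope.

(* Points of R^n are row vectors. Cartesian coordinates of R^3 are ordered
   (x, y, z), cylindrical ones (rho, z, phi), and those of the orbit half-plane
   (rho, z). *)

Section Coordinates.
Context {R : realType}.

Definition vec2 (a b : R) : 'rV[R]_2 := \row_i [:: a; b]`_i.
Definition vec3 (a b c : R) : 'rV[R]_3 := \row_i [:: a; b; c]`_i.

Definition crho : 'I_3 := @Ordinal 3 0 isT.
Definition cz : 'I_3 := @Ordinal 3 1 isT.
Definition cphi : 'I_3 := @Ordinal 3 2 isT.
Definition hrho : 'I_2 := @Ordinal 2 0 isT.
Definition hz : 'I_2 := @Ordinal 2 1 isT.

(* The library norm `|x| on row vectors is the sup norm. *)
Definition enorm n (x : 'rV[R]_n) : R := Num.sqrt (\sum_i x 0 i ^+ 2).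

Definition cart_of_cyl (x : 'rV[R]_3) : 'rV[R]_3 :=
  vec3 (x 0 crho * cos (x 0 cphi)) (x 0 crho * sin (x 0 cphi)) (x 0 cz).

Definition cart_of_sph (r theta phi : R) : 'rV[R]_3 :=
  vec3 (r * sin theta * cos phi) (r * sin theta * sin phi) (r * cos theta).

Definition meridian (x : 'rV[R]_3) : 'rV[R]_2 := vec2 (x 0 crho) (x 0 cz).

Definition half_plane : set 'rV[R]_2 := [set x | 0 < x 0 hrho].
Definition off_axis : set 'rV[R]_3 := [set x | 0 < x 0 crho].

End Coordinates.

Section Calculus.
Context {R : realType} {n : nat}.

Definition pd (i : 'I_n.+1) (f : 'rV[R]_n.+1 -> R) : 'rV[R]_n.+1 -> R :=
  'D_(delta_mx 0 i) f.

(* A multi-index I, in the notation d^I, is encoded as the list of the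
   indices of differentiation, so that |I| = size s. *)
Definition pds (s : seq 'I_n.+1) (f : 'rV[R]_n.+1 -> R) : 'rV[R]_n.+1 -> R :=
  foldr pd f s.

Definition smooth_on (U : set 'rV[R]_n.+1) (f : 'rV[R]_n.+1 -> R) : Prop :=
  forall (s : seq 'I_n.+1) x, U x -> differentiable (pds s f) x.

End Calculus.

Section Riemannian.
Context {R : realType} {n : nat}.
Implicit Types (g : 'rV[R]_n.+1 -> 'M[R]_n.+1) (x v w : 'rV[R]_n.+1).

Definition inner g x v w : R := (v *m g x *m w^T) 0 0.

Definition gnorm g x v : R := Num.sqrt (inner g x v v).

Definition riemannian g : Prop :=
  [/\ forall i j, smooth_on setT (fun x => g x i j),
      forall x, (g x)^T = g x
    & forall x v, v != 0 -> 0 < inner g x v v].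

Definition pullback (f : 'rV[R]_n.+1 -> 'rV[R]_n.+1) g x : 'M[R]_n.+1 :=
  'J f x *m g (f x) *m ('J f x)^T.

Definition grad g (f : 'rV[R]_n.+1 -> R) x : 'rV[R]_n.+1 :=
  (\row_i pd i f x) *m invmx (g x).

(* christoffel g k i j x is Gamma^k_ij at x. *)
Definition christoffel g (k i j : 'I_n.+1) x : R :=
  2^-1 * \sum_l invmx (g x) k l *
    (pd i (fun y => g y j l) x + pd j (fun y => g y i l) x
     - pd l (fun y => g y i j) x).

Definition ricci g (i j : 'I_n.+1) x : R :=
  \sum_k (pd k (christoffel g k i j) x - pd j (christoffel g k i k) x)
  + \sum_k \sum_l (christoffel g k k l x * christoffel g l i j x
                   - christoffel g k j l x * christoffel g l i k x).

Definition scalar_curvature g x : R :=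
  \sum_i \sum_j invmx (g x) i j * ricci g i j x.

End Riemannian.

Section Asymptotics.
Context {R : realType}.
Implicit Type g : 'rV[R]_3 -> 'M[R]_3.

(* Decay of the Cartesian components. Integrability of the scalar curvature is
   not required here: it amounts, for nonnegative scalar curvature, to the
   existence of a finite mass in the sense of [adm_mass_is]. *)
Definition asymptotically_flat g : Prop :=
  exists tau C r0 : R, 2^-1 < tau /\
    forall (i j : 'I_3) (s : seq 'I_3) x, (size s <= 2)%N -> r0 <= enorm x ->
      0 < enorm x ->
      `|pds s (fun y => g y i j - (i == j)%:R) x|
        <= C * enorm x `^ (- (tau + (size s)%:R)).

(* 1/(16 pi) times the integral over the Euclidean sphere S_r of
   (g_ij,j - g_jj,i) nu^i, in spherical coordinates: nu = x / r and
   dS = r^2 sin theta dtheta dphi. *)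
Definition adm_flux g (r : R) : R :=
  (16 * pi)^-1 *
  \int[lebesgue_measure]_(phi in `[0, 2 * pi])
    \int[lebesgue_measure]_(theta in `[0, pi])
      let x := cart_of_sph r theta phi in
      (\sum_i \sum_j
         (pd j (fun y => g y i j) x - pd i (fun y => g y j j) x)
         * (x 0 i / r)) * (r ^+ 2 * sin theta).

Definition adm_mass_is g (m : R) : Prop := adm_flux g r @[r --> +oo] --> m.

End Asymptotics.

Section Axisymmetric.
Context {R : realType}.

(* e^(2 alpha - 2 u) (drho^2 + dz^2) + rho^2 e^(- 2 u) w^2, where
   w = dphi + B drho + A dz, as a matrix in the coordinates (rho, z, phi). *)
Definition cyl_form (al u A B : 'rV[R]_2 -> R) (x : 'rV[R]_3) : 'M[R]_3 :=
  let h := meridian x in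
  let w := vec3 (B h) (A h) 1 in
  expR (2 * al h - 2 * u h) *: diag_mx (vec3 1 1 0)
  + (x 0 crho ^+ 2 * expR (- 2 * u h)) *: (w^T *m w).

(* [metric] gives the Cartesian components on all of R^3, so that its smoothness
   includes smoothness across the axis. The values of alpha, u, A, B matter only
   on the open half-plane rho > 0, where the cylindrical coordinates are
   defined. *)
Record axisym_metric := AxisymMetric {
  metric : 'rV[R]_3 -> 'M[R]_3;
  coef_alpha : 'rV[R]_2 -> R;
  coef_u : 'rV[R]_2 -> R;
  coef_A : 'rV[R]_2 -> R;
  coef_B : 'rV[R]_2 -> R;
  metric_riemannian : riemannian metric;
  metric_flat : asymptotically_flat metric;
  alpha_smooth : smooth_on half_plane coef_alpha;
  u_smooth : smooth_on half_plane coef_u;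
  A_smooth : smooth_on half_plane coef_A;
  B_smooth : smooth_on half_plane coef_B;
  metric_cyl : forall x, off_axis x ->
    pullback cart_of_cyl metric x = cyl_form coef_alpha coef_u coef_A coef_B x
}.

Implicit Type g : axisym_metric.

Definition cyl_metric g : 'rV[R]_3 -> 'M[R]_3 :=
  cyl_form (coef_alpha g) (coef_u g) (coef_A g) (coef_B g).

(* Scalar curvature is computed in the cylindrical chart; on the axis its sign
   follows by continuity, the metric being smooth there. *)
Definition nonneg_scalar_curvature g : Prop :=
  forall x, off_axis x -> 0 <= scalar_curvature (cyl_metric g) x.

Definition killing : 'rV[R]_3 := delta_mx 0 cphi.

Definition uniformly_flat (M : set axisym_metric) (R0 : R) : Prop :=
  exists C : R, forall g, M g -> forall (s : seq 'I_2) x, (size s <= 2)%N ->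
    half_plane x -> R0 <= enorm x ->
    [/\ `|pds s (coef_u g) x| <= C / enorm x ^+ (1 + size s),
        `|pds s (coef_alpha g) x| <= C / enorm x ^+ (1 + size s),
        `|pds s (coef_A g) x| <= C / enorm x ^+ (1 + size s)
      & `|pds s (coef_B g) x| <= C / enorm x ^+ (1 + size s)].

Definition radially_monotone (M : set axisym_metric) (rho0 : R) : Prop :=
  forall g, M g -> forall x : 'rV[R]_3, x 0 crho = rho0 ->
    pd crho (fun y => (y 0 crho)^-1 *
      (gnorm (cyl_metric g) y killing
       / gnorm (cyl_metric g) y
           (grad (cyl_metric g) (fun y' => y' 0 crho) y))) x <= 0.

(* The tangent vector delta_mx 0 i of the half-plane is lifted to the vector
   with the same rho and z components and no phi component; the form does not
   depend on the lift, nor, by axisymmetry, on the value 0 of phi. *)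
Definition orbit_metric g (y : 'rV[R]_2) : 'M[R]_2 :=
  let x := vec3 (y 0 hrho) (y 0 hz) 0 in
  let G := inner (cyl_metric g) x in
  let lift (i : 'I_2) : 'rV[R]_3 := delta_mx 0 (widen_ord (leqnSn 2) i) in
  \matrix_(i, j) (G (lift i) (lift j)
    - G (lift i) killing * G (lift j) killing
      / gnorm (cyl_metric g) x killing ^+ 2).

Definition euclid_cyl (x : 'rV[R]_3) : 'M[R]_3 :=
  diag_mx (vec3 1 1 (x 0 crho ^+ 2)).

End Axisymmetric.
Arguments axisym_metric R : clear implicits.

Section Sobolev.
Context {R : realType}.

(* |h|^p + |dh|^p summed over components; the tensors considered are smooth
   near the regions below, so classical derivatives are weak derivatives. *)
Definition sobolev_density n (p : R) (h : 'rV[R]_n.+1 -> 'M[R]_n.+1)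
    (x : 'rV[R]_n.+1) : R :=
  \sum_i \sum_j (`|h x i j| `^ p
    + \sum_k `|pd k (fun y => h y i j) x| `^ p).

Definition region2 (rho0 rho1 sigma : R) : set (R * R) :=
  [set x | rho0 + sigma <= x.1 <= rho1 /\ `|x.2| <= rho1 / 2].

Definition region3 (rho0 rho1 sigma : R) : set (R * R * R) :=
  region2 rho0 rho1 sigma `*` `[0, 2 * pi[.

Definition leb2 := (@lebesgue_measure R \x @lebesgue_measure R)%E.
Definition leb3 := (leb2 \x @lebesgue_measure R)%E.

Definition W1p_norm2 (p : R) (D : set (R * R)) (h : 'rV[R]_2 -> 'M[R]_2)
    : \bar R :=
  ((\int[leb2]_(x in D) (sobolev_density p h (vec2 x.1 x.2))%:E) `^ p^-1)%E.

(* The factor x.1.1 is the density rho of the Euclidean volume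
   rho drho dz dphi. *)
Definition W1p_norm3 (p : R) (D : set (R * R * R)) (h : 'rV[R]_3 -> 'M[R]_3)
    : \bar R :=
  ((\int[leb3]_(x in D)
     (sobolev_density p h (vec3 x.1.1 x.1.2 x.2) * x.1.1)%:E) `^ p^-1)%E.

End Sobolev.

(* Main.v *)
(* When A = B = 0, the nonnegativity of the scalar curvature says that
   2 rho |grad u|^2 is at most the divergence of a vector field whose flux at
   infinity is that of the ADM integrand, up to a multiple, because the two differ
   by terms quadratic in u, alpha. Hence a small mass makes the energy of u small
   on large rectangles [rho_0, L] x [- L, L].

   The function v = alpha - 2 u satisfies
     Delta v = 2 (d u / d rho) / rho - |grad u|^2 - S / 2,
   where S = e^(2 alpha - 2 u) R_g >= 0 has small integral, so Delta v is
   small in L^1, and v is small with its gradient on the three outer sides of the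
   rectangle. Radial monotonicity gives d v / d rho <= 0 on the inner side. Testing with psi (v) - 1, where
   psi = e^v / (1 + e^v), the inner boundary term has the good sign, and
   psi' (v) |grad v|^2 is small in L^1. The same argument with psi a smooth
   truncation bounds the energy of v on level strips, and then the Sobolev
   inequality W^(1,1) -> L^2 makes the truncations (v - n)_+ decay geometrically:
   e^v, e^u and e^(- u) are integrable to any given power. The defects
   e^(2 alpha - 2 u) - 1 and e^(- 2 u) - 1 and their gradients have squares bounded
   by a product of such exponentials and of the small energy densities, and Young's
   inequality gives smallness in L^p for p < 2, which is where p < 2 enters. *)

(* The argument bounds [v] from above only. This suffices because the conformal factor is
   [expR (2 v + 2 u)]: it decays, with the weights in its derivatives, where [v] is very negative,
   while [u], whose full gradient energy is small, is controlled from both sides. The derivative of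
   psi behaves like [expR (- |v|)]; the loss is covered for negative [v] by the powers of [expR v]
   in the conformal factor, and for positive [v] by exponential integrability. The mass threshold
   has to be chosen last. The outer sides of the rectangle cost terms of order [1 / L], and bounding
   the L^1 norm of [d u / d rho] by its energy costs another one, together with a factor [L ^+ 3] on
   the mass; so [L] is fixed before the mass. The components themselves, as opposed to their
   gradients, are small because they are small at the far side and can be integrated inward from
   there. The potentials are given on the open half-plane, whereas the divergence theorem reaches
   the axis. They are therefore extended to the whole plane as logarithms of Cartesian components of
   the metric; that alpha vanishes on the axis removes the boundary term there. *)
From HB Require Import structures.
Require Import Defs.
From mathcomp Require Import all_boot all_order all_algebra.
From mathcomp Require Import all_classical all_reals all_analysis.
From mathcomp Require Import measurable_realfun ring lra.
Import Order.TTheory GRing.Theory Num.Theory.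
Import numFieldNormedType.Exports.

Local Open Scope classical_set_scope.
Local Open Scope ring_scope.

(** * Integrals of continuous functions over rectangles *)

Section ContinuousIntegrals.
Context {R : realType}.
Implicit Types (a b c d x y : R) (f g F : R -> R) (h k : R -> R -> R).

Local Notation mu := (@lebesgue_measure R).

Definition I1 a b f : R := \int[mu]_(x in `[a, b]) f x.
Definition I2 a b c d h : R := I1 a b (fun x => I1 c d (h x)).
(* A plain proposition, so that class resolution does not run on it. *)
Definition der f x (l : R) : Prop := is_derive x (1 : R) f l.
Definition cont2 h : Prop := continuous (fun z : R * R => h z.1 z.2).

Lemma integrable_itv a b f : continuous f -> mu.-integrable `[a, b] (EFin \o f).
Proof.
move=> cf; apply: continuous_compact_integrable; first exact: segment_compact.
exact: continuous_subspaceT.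
Qed.

Lemma eq_I1 a b f g : (forall x, a <= x <= b -> f x = g x) -> I1 a b f = I1 a b g.
Proof.
by move=> e; apply: eq_Rintegral => x; rewrite inE /= in_itv /= => /e.
Qed.

Lemma I1_ge0 a b f : (forall x, a <= x <= b -> 0 <= f x) -> 0 <= I1 a b f.
Proof. by move=> f0; apply: Rintegral_ge0 => x /=; rewrite in_itv /=; exact: f0. Qed.

Lemma le_I1 a b f g : continuous f -> continuous g ->
  (forall x, a <= x <= b -> f x <= g x) -> I1 a b f <= I1 a b g.
Proof.
move=> cf cg fg; apply: le_Rintegral => //.
- exact: integrable_itv.
- exact: integrable_itv.
Qed.

Lemma I1D a b f g : continuous f -> continuous g ->
  I1 a b (fun x => f x + g x) = I1 a b f + I1 a b g.
Proof. by move=> cf cg; apply: RintegralD => //; exact: integrable_itv. Qed.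

Lemma I1Z a b r f : continuous f -> I1 a b (fun x => r * f x) = r * I1 a b f.
Proof. by move=> cf; apply: RintegralZl => //; exact: integrable_itv. Qed.

Lemma I1_cst a b r : a <= b -> I1 a b (fun=> r) = r * (b - a).
Proof.
move=> ab; rewrite /I1 Rintegral_cst //= lebesgue_measure_itv /= lte_fin.
by case: ltgtP ab => //= -> _; rewrite subrr.
Qed.

Lemma I1_norm a b f : continuous f -> `|I1 a b f| <= I1 a b (fun x => `|f x|).
Proof. by move=> cf; apply: le_normr_Rintegral => //; exact: integrable_itv. Qed.

Lemma le_I1_sub a b a' b' f : continuous f ->
  (forall x, a' <= x <= b' -> 0 <= f x) -> a' <= a -> b <= b' ->
  I1 a b f <= I1 a' b' f.
Proof.
move=> cf f0 a'a bb'; apply: fine_le.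
- by apply: integrable_fin_num => //; exact: integrable_itv.
- by apply: integrable_fin_num => //; exact: integrable_itv.
- apply: ge0_subset_integral => //.
  + by apply: (measurable_int mu); exact: integrable_itv.
  + by apply: subset_itv; rewrite bnd_simp.
Qed.

Lemma der_continuous f x (l : R) : der f x l -> {for x, continuous f}.
Proof. by case=> df _; apply/differentiable_continuous/derivable1_diffP. Qed.

Lemma I1_FTC a b f F : a <= b -> continuous f ->
  (forall x, a <= x <= b -> der F x (f x)) -> I1 a b f = F b - F a.
Proof.
rewrite le_eqVlt => /predU1P[<- _ _|ab cf dF].
  by rewrite subrr /I1 set_itv1 Rintegral_set1.
have cF x : a <= x <= b -> {for x, continuous F}.
  by move=> /dF /der_continuous.
rewrite /I1 /Rintegral (@continuous_FTC2 _ _ F) //.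
- exact: continuous_subspaceT.
- split.
  + move=> x; rewrite in_itv /= => /andP[ax xb].
    by have [] : der F x (f x) by apply: dF; rewrite !ltW.
  + by apply: cvg_at_right_filter; apply: cF; rewrite lexx ltW.
  + by apply: cvg_at_left_filter; apply: cF; rewrite lexx ltW.
- move=> x; rewrite in_itv /= => /andP[ax xb].
  by rewrite derive1E; apply: (@derive_val _ _ _ _ _ _ _ (dF _ _)); rewrite !ltW.
Qed.

Lemma antiderivative a f : continuous f ->
  exists F, forall x, a < x -> der F x (f x).
Proof.
move=> cf; exists (fun x => I1 a x f) => x ax.
have xx1 : x < x + 1 by rewrite ltrDl.
have [||d1 d2] := @continuous_FTC1_closed R f a x (x + 1) xx1 _ ax _.
- exact: integrable_itv.
- exact: cf.
- by apply: DeriveDef; [exact: d1|rewrite -derive1E; exact: d2].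
Qed.

(** One antiderivative of [f], composed with [G], evaluates both sides, so [G] only has to stay to
    the right of [G s]. *)
Lemma I1_subst (s t : R) (G G' : R -> R) f : s <= t -> continuous f -> continuous G' ->
  (forall x, s <= x <= t -> der G x (G' x)) -> continuous G ->
  (forall x, s <= x <= t -> G s <= G x) ->
  I1 s t (fun x => f (G x) * G' x) = I1 (G s) (G t) f.
Proof.
move=> st cf cG' dG cG Gs.
(* [antiderivative] gives derivatives strictly to the right of its base point only; the base point
   is moved left so that [G s] itself is covered. *)
have [F dF] := @antiderivative (G s - 1) f cf.
have lt1 z : G s <= z -> G s - 1 < z by apply: lt_le_trans; rewrite gtrBl.
rewrite (@I1_FTC _ _ _ (F \o G)) //=.
- rewrite (@I1_FTC _ _ _ F) //; first by apply: Gs; rewrite lexx st.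
  by move=> x /andP[sx _]; apply: dF; exact: lt1.
- move=> x; apply: continuousM; last exact: cG'.
  by apply: continuous_comp; [exact: cG|exact: cf].
- move=> x sxt; apply: is_derive1_comp; last exact: dG.
  by apply: dF; apply: lt1; exact: Gs.
Qed.

Lemma cont2_l h y : cont2 h -> continuous (fun x => h x y).
Proof.
move=> ch x; apply: (@continuous_comp _ _ _ (fun x => (x, y)) (fun z => h z.1 z.2)).
  by apply: (@cvg_pair _ _ _ (nbhs x) (nbhs x) (nbhs y)); [exact: cvg_id|exact: cvg_cst].
exact: ch.
Qed.

Lemma cont2_r h x : cont2 h -> continuous (h x).
Proof.
move=> ch y; apply: (@continuous_comp _ _ _ (fun y => (x, y)) (fun z => h z.1 z.2)).
  by apply: (@cvg_pair _ _ _ (nbhs y) (nbhs x) (nbhs y)); [exact: cvg_cst|exact: cvg_id].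
exact: ch.
Qed.

Lemma cont2_swap h : cont2 h -> cont2 (fun x y => h y x).
Proof.
move=> ch z; apply: (@continuous_comp _ _ _ (fun z : R * R => (z.2, z.1)) (fun z => h z.1 z.2)).
  by apply: (@cvg_pair _ _ _ (nbhs z) (nbhs z.2) (nbhs z.1)); [exact: cvg_snd|exact: cvg_fst].
exact: ch.
Qed.

Lemma cont2_bounded h a b c d : cont2 h ->
  exists M, forall x y, a <= x <= b -> c <= y <= d -> `|h x y| <= M.
Proof.
move=> ch; have cpt : compact (`[a, b]%classic `*` `[c, d]%classic).
  by apply: compact_setX; exact: segment_compact.
have /compact_bounded[M [_ HM]] := continuous_compact (continuous_subspaceT ch) cpt.
exists (M + 1) => x y xab ycd; apply: (HM (M + 1)); first by rewrite ltrDl.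
by exists (x, y) => //=; rewrite !in_itv.
Qed.

Lemma continuous_I1 h c d : cont2 h -> continuous (fun x => I1 c d (h x)).
Proof.
move=> ch x0.
have [M HM] := @cont2_bounded h (x0 - 1) (x0 + 1) c d ch.
have := @continuity_under_integral R _ _ mu h `[c, d]%classic (measurable_itv _)
  (x0 - 1) (x0 + 1) _ _ (fun=> M) _ _ x0; apply.
- by move=> x _; apply: integrable_itv; exact: cont2_r.
- by apply/aeW => y _ x _; exact: cont2_l.
- by apply: integrable_itv => ?; exact: cvg_cst.
- move=> x /=; rewrite in_itv /= => /andP[x1 x2]; apply/aeW => y /=.
  by rewrite in_itv /=; apply: HM; rewrite !ltW.
- by rewrite inE /= in_itv /= gtrBl ltrDl ltr01.
Qed.

(** An open set is the union of the countably many rational open squares that it contains. This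
    links continuity for the product topology with measurability for the product sigma-algebra. *)
Lemma open_measurable2 (U : set (R * R)) : open U -> measurable U.
Proof.
move=> oU.
pose box (q : rat * rat * rat) : set (R * R) :=
  `]ratr q.1.1 - ratr q.2, ratr q.1.1 + ratr q.2[%classic `*`
  `]ratr q.1.2 - ratr q.2, ratr q.1.2 + ratr q.2[%classic.
pose B q := if `[< box q `<=` U >] then box q else set0.
rewrite (_ : U = \bigcup_q B q).
  apply: countable_bigcupT_measurable => //.
  by move=> q; rewrite /B; case: ifP => // _; apply: measurableX.
apply/seteqP; split=> [[x y] Uxy|z [q _]]; last first.
  by rewrite /B; case: ifPn => // /asboolP; apply.
have [e /= e0 eU] : nbhs_ball (x, y) U by apply/nbhs_ballP; exact: open_nbhs_nbhs.
have [q2] : exists q : rat, ratr q \in `]0 : R, e / 2[ by apply: rat_in_itvoo; rewrite divr_gt0.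
rewrite in_itv /= => /andP[q20 q2e].
have [q1] : exists q : rat, ratr q \in `]x - ratr q2, x + ratr q2[.
  by apply: rat_in_itvoo; lra.
rewrite in_itv /= => /andP[q11 q12].
have [q3] : exists q : rat, ratr q \in `]y - ratr q2, y + ratr q2[.
  by apply: rat_in_itvoo; lra.
rewrite in_itv /= => /andP[q31 q32].
exists (q1, q3, q2) => //; rewrite /B ifT.
  by split; rewrite /= in_itv /=; lra.
apply/asboolP => -[x' y'] [/=]; rewrite !in_itv /= => /andP[h1 h2] /andP[h3 h4].
by apply: eU; split; rewrite /ball /= ltr_norml; lra.
Qed.

Lemma cont2_measurable h : cont2 h ->
  measurable_fun setT (fun z : R * R => h z.1 z.2).
Proof.
move=> /continuousP ch; apply: (measurability _ (measurable_realfun.RGenOpens.measurableE R)).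
move=> _ [_ [a [b ->] <-]]; rewrite setTI; apply: open_measurable2.
by apply: ch; exact: interval_open.
Qed.

Lemma integrable_box a b c d h : cont2 h ->
  (@leb2 R).-integrable (`[a, b]%classic `*` `[c, d]%classic)
    (fun z => (h z.1 z.2)%:E).
Proof.
move=> ch; have mh := cont2_measurable _ ch.
have [M HM] := @cont2_bounded h a b c d ch.
apply: (@measurable_bounded_integrable _ _ _ (@leb2 R) (fun z : R * R => h z.1 z.2)).
- exact: measurableX.
- rewrite [X in (X < _)%E](_ : _ = (mu `[a, b]) * (mu `[c, d]))%E; last first.
    by apply: product_measure1E; exact: measurable_itv.
  rewrite /= !lebesgue_measure_itv /=.
  by case: ifP => _; case: ifP => _; rewrite ?mule0 ?mul0e ?ltry // -!EFinB -EFinM ltry.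
- exact: measurable_funTS.
- exists M; split; first exact: num_real.
  move=> M' MM' [x y] [/=]; rewrite !in_itv /= => xab ycd.
  by apply: le_trans (ltW MM'); exact: HM.
Qed.

Lemma integral_box a b c d h : cont2 h ->
  (\int[@leb2 R]_(z in `[a, b]%classic `*` `[c, d]%classic) (h z.1 z.2)%:E)%E =
  (I2 a b c d h)%:E.
Proof.
move=> ch; have ih := integrable_box a b c d h ch.
rewrite integral_mkcond /leb2 -integral12_prod_meas1; last first.
  by apply/(integrable_mkcond _ _).1 => //; exact: measurableX.
transitivity (\int[mu]_(x in `[a, b]) (I1 c d (h x))%:E)%E; last first.
  rewrite /I2 /I1 /Rintegral fineK //.
  by apply: integrable_fin_num => //; apply: integrable_itv; exact: continuous_I1.
rewrite [RHS]integral_mkcond; apply: eq_integral => x _.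
rewrite /fubini_F /= patchE; case: ifPn => xab.
- transitivity (\int[mu]_(y in `[c, d]) (h x y)%:E)%E; last first.
    rewrite /I1 /Rintegral fineK //.
    by apply: integrable_fin_num => //; apply: integrable_itv; exact: cont2_r.
  rewrite [RHS]integral_mkcond; apply: eq_integral => y _.
  by rewrite !patchE in_setX xab.
- by apply: integral0_eq => y _; rewrite patchE in_setX (negbTE xab).
Qed.

Lemma I2_swap a b c d h : cont2 h -> I2 a b c d h = I2 c d a b (fun y x => h x y).
Proof.
move=> ch; have ih := integrable_box a b c d h ch.
apply: EFin_inj; rewrite -integral_box // integral_mkcond /leb2 -integral21_prod_meas1; last first.
  by apply/(integrable_mkcond _ _).1 => //; exact: measurableX.
transitivity (\int[mu]_(y in `[c, d]) (I1 a b (h^~ y))%:E)%E; last first.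
  rewrite /I2 /I1 /Rintegral fineK //.
  apply: integrable_fin_num => //; apply: integrable_itv.
  exact: (continuous_I1 (fun y x => h x y) a b (cont2_swap _ ch)).
rewrite [RHS]integral_mkcond; apply: eq_integral => y _.
rewrite /fubini_G /= patchE; case: ifPn => ycd.
- transitivity (\int[mu]_(x in `[a, b]) (h x y)%:E)%E; last first.
    rewrite /I1 /Rintegral fineK //.
    by apply: integrable_fin_num => //; apply: integrable_itv; exact: cont2_l.
  rewrite [RHS]integral_mkcond; apply: eq_integral => x _.
  by rewrite !patchE in_setX ycd andbT.
- by apply: integral0_eq => x _; rewrite patchE in_setX (negbTE ycd) andbF.
Qed.

Lemma I2E a b c d h : I2 a b c d h = I1 a b (fun x => I1 c d (h x)).
Proof. by []. Qed.

Lemma eq_I2 a b c d h k :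
  (forall x y, a <= x <= b -> c <= y <= d -> h x y = k x y) ->
  I2 a b c d h = I2 a b c d k.
Proof. by move=> e; apply: eq_I1 => x xab; apply: eq_I1 => y; exact: e. Qed.

Lemma I2_ge0 a b c d h :
  (forall x y, a <= x <= b -> c <= y <= d -> 0 <= h x y) -> 0 <= I2 a b c d h.
Proof. by move=> e; apply: I1_ge0 => x xab; apply: I1_ge0 => y; exact: e. Qed.

Lemma le_I2 a b c d h k : cont2 h -> cont2 k ->
  (forall x y, a <= x <= b -> c <= y <= d -> h x y <= k x y) ->
  I2 a b c d h <= I2 a b c d k.
Proof.
move=> ch ck e; apply: le_I1; [exact: continuous_I1|exact: continuous_I1|].
move=> x xab; apply: le_I1; [exact: cont2_r|exact: cont2_r|].
by move=> y; exact: e.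
Qed.

Lemma I2D a b c d h k : cont2 h -> cont2 k ->
  I2 a b c d (fun x y => h x y + k x y) = I2 a b c d h + I2 a b c d k.
Proof.
move=> ch ck; rewrite /I2 -I1D; [|exact: continuous_I1|exact: continuous_I1].
by apply: eq_I1 => x _; rewrite I1D //; exact: cont2_r.
Qed.

Lemma I2Z a b c d r h : cont2 h ->
  I2 a b c d (fun x y => r * h x y) = r * I2 a b c d h.
Proof.
move=> ch; rewrite /I2 -I1Z; last exact: continuous_I1.
by apply: eq_I1 => x _; rewrite I1Z //; exact: cont2_r.
Qed.

Lemma I2_cst a b c d r : a <= b -> c <= d ->
  I2 a b c d (fun _ _ => r) = r * (d - c) * (b - a).
Proof. by move=> ab cd; rewrite /I2 (I1_cst c d) // I1_cst. Qed.

Lemma le_I2_sub a b c d a' b' c' d' h : cont2 h ->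
  (forall x y, a' <= x <= b' -> c' <= y <= d' -> 0 <= h x y) ->
  a' <= a -> b <= b' -> c' <= c -> d <= d' -> I2 a b c d h <= I2 a' b' c' d' h.
Proof.
move=> ch h0 aa bb cc dd; apply: (@le_trans _ _ (I2 a b c' d' h)).
  apply: le_I1; [exact: continuous_I1|exact: continuous_I1|].
  move=> x /andP[ax xb]; apply: le_I1_sub => //; first exact: cont2_r.
  by move=> y; apply: h0; rewrite (le_trans aa) ?(le_trans xb).
apply: le_I1_sub => //; first exact: continuous_I1.
by move=> x xab; apply: I1_ge0 => y; exact: h0.
Qed.

Lemma green_rectangle a b c d (F F1 H H2 : R -> R -> R) : a <= b -> c <= d ->
  cont2 F -> cont2 H -> cont2 F1 -> cont2 H2 ->
  (forall x y, a <= x <= b -> c <= y <= d -> der (F^~ y) x (F1 x y)) ->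
  (forall x y, a <= x <= b -> c <= y <= d -> der (H x) y (H2 x y)) ->
  I2 a b c d (fun x y => F1 x y + H2 x y) =
  I1 c d (fun y => F b y - F a y) + I1 a b (fun x => H x d - H x c).
Proof.
move=> ab cd cF cH cF1 cH2 dF dH; rewrite I2D //; congr (_ + _).
  rewrite I2_swap //; apply: eq_I1 => y ycd.
  rewrite (I1_FTC a b _ (F^~ y)) //; first exact: cont2_l.
  by move=> x xab; exact: dF.
apply: eq_I1 => x xab; rewrite (I1_FTC c d _ (H x)) //; first exact: cont2_r.
by move=> y ycd; exact: dH.
Qed.

End ContinuousIntegrals.

(** * Differentiation along curves *)

Section Calculus.
Context {R : realType}.
Implicit Types (f g : R -> R) (h k : R -> R -> R) (x y t l : R).

Lemma der_eq f t l l' : der f t l -> l = l' -> der f t l'.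
Proof. by move=> ? <-. Qed.

Lemma der_near f g t l : (\near t, f t = g t) -> der f t l -> der g t l.
Proof. exact: near_eq_is_derive. Qed.

Lemma der_ext f g t l : f =1 g -> der f t l -> der g t l.
Proof. by move=> /funext ->. Qed.

Lemma der_cst c t : der (fun=> c) t 0.
Proof. exact: is_derive_cst. Qed.

Lemma der_id t : der (fun s => s) t 1.
Proof. exact: is_derive_id. Qed.

Lemma derD f g t a b : der f t a -> der g t b -> der (fun s => f s + g s) t (a + b).
Proof. exact: is_deriveD. Qed.

Lemma derB f g t a b : der f t a -> der g t b -> der (fun s => f s - g s) t (a - b).
Proof. exact: is_deriveB. Qed.

Lemma derM f g t a b : der f t a -> der g t b ->
  der (fun s => f s * g s) t (a * g t + f t * b).
Proof.
move=> da db; apply: der_eq (is_deriveM da db) _.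
by rewrite /GRing.scale /= addrC [g t * a]mulrC.
Qed.

Lemma der_comp f g t a b : der g (f t) b -> der f t a -> der (fun s => g (f s)) t (b * a).
Proof. exact: is_derive1_comp. Qed.

Lemma der_expR f t a : der f t a -> der (fun s => expR (f s)) t (expR (f t) * a).
Proof. by apply: der_comp; exact: is_derive_expR. Qed.

Lemma der_sin t : der sin t (cos t).
Proof. exact: is_derive_sin. Qed.

Lemma der_cos t : der cos t (- sin t).
Proof. exact: is_derive_cos. Qed.

Lemma der_sqrt f t a : 0 < f t -> der f t a ->
  der (fun s => Num.sqrt (f s)) t ((2 * Num.sqrt (f t))^-1 * a).
Proof. by move=> f0; apply: der_comp; exact: is_derive1_sqrt. Qed.

Lemma der_inv f t a : f t != 0 -> der f t a ->
  der (fun s => (f s)^-1) t (- (f t ^- 2 * a)).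
Proof.
by move=> f0 df; apply: der_eq (is_deriveV f0 df) _; rewrite /GRing.scale /= mulNr.
Qed.

Lemma eq_ler x y : x = y -> x <= y.
Proof. by move=> ->. Qed.

Lemma contB f g : continuous f -> continuous g -> continuous (fun x => f x - g x).
Proof. by move=> cf cg x; apply: continuousB; [exact: cf|exact: cg]. Qed.

Lemma contM f g : continuous f -> continuous g -> continuous (fun x => f x * g x).
Proof. by move=> cf cg x; apply: continuousM; [exact: cf|exact: cg]. Qed.

Lemma cont_cst (c : R) : continuous (fun _ : R => c).
Proof. by move=> x; exact: cvg_cst. Qed.

Lemma cont2_comp g h : continuous g -> cont2 h -> cont2 (fun x y => g (h x y)).
Proof.
move=> cg ch z.
apply: (@continuous_comp _ _ _ (fun z : R * R => h z.1 z.2) g); [exact: ch|exact: cg].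
Qed.

Lemma cont2_pair (H : R -> R -> R) h k : cont2 H -> cont2 h -> cont2 k ->
  cont2 (fun x y => H (h x y) (k x y)).
Proof.
move=> cH ch ck z.
apply: (@continuous_comp _ _ _ (fun z : R * R => (h z.1 z.2, k z.1 z.2)) (fun z => H z.1 z.2)).
  by apply: (@cvg_pair _ _ _ (nbhs z) (nbhs (h z.1 z.2)) (nbhs (k z.1 z.2))); [exact: ch|exact: ck].
exact: cH.
Qed.

Lemma cont2_cst c : cont2 (fun _ _ : R => c).
Proof. by move=> z; exact: cvg_cst. Qed.

Lemma cont2_fst : cont2 (fun x _ : R => x).
Proof. by move=> z; exact: cvg_fst. Qed.

Lemma cont2_snd : cont2 (fun _ y : R => y).
Proof. by move=> z; exact: cvg_snd. Qed.

Lemma cont2D h k : cont2 h -> cont2 k -> cont2 (fun x y => h x y + k x y).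
Proof. by move=> ch ck z; apply: continuousD; [exact: ch|exact: ck]. Qed.

Lemma cont2N h : cont2 h -> cont2 (fun x y => - h x y).
Proof. by move=> ch z; apply: continuousN; exact: ch. Qed.

Lemma cont2M h k : cont2 h -> cont2 k -> cont2 (fun x y => h x y * k x y).
Proof. by move=> ch ck z; apply: continuousM; [exact: ch|exact: ck]. Qed.

Lemma cont2X n h : cont2 h -> cont2 (fun x y => h x y ^+ n).
Proof.
move=> ch; elim: n => [|n IH].
  by rewrite (_ : (fun x y => _) = (fun _ _ => 1)); [exact: cont2_cst|].
rewrite (_ : (fun x y => _) = (fun x y => h x y * h x y ^+ n)); first exact: cont2M.
by apply/funext => x; apply/funext => y; rewrite exprS.
Qed.

Lemma cont2_exp h : cont2 h -> cont2 (fun x y => expR (h x y)).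
Proof. by apply: cont2_comp; exact: continuous_expR. Qed.

Lemma cont2_norm h : cont2 h -> cont2 (fun x y => `|h x y|).
Proof. by apply: cont2_comp => x; exact: norm_continuous. Qed.

Lemma cont2_dom (f : R -> R) : continuous f -> cont2 (fun x _ : R => f x).
Proof. by move=> cf; apply: cont2_comp => //; exact: cont2_fst. Qed.

Lemma cont2_cod (f : R -> R) : continuous f -> cont2 (fun _ y : R => f y).
Proof. by move=> cf; apply: cont2_comp => //; exact: cont2_snd. Qed.

Lemma continuous_diag h : cont2 h -> forall f g, continuous f -> continuous g ->
  continuous (fun t => h (f t) (g t)).
Proof.
move=> ch f g cf cg t.
have := cont2_pair h (fun x _ => f x) (fun x _ => g x) ch (cont2_dom _ cf) (cont2_dom _ cg).
by move=> /(cont2_l _ 0); exact.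
Qed.

(* Differentiability is recorded as the chain rule along arbitrary differentiable
   curves: in this form it is stable under all the operations used here. *)
Definition C1 h (h1 h2 : R -> R -> R) : Prop :=
  [/\ cont2 h, cont2 h1, cont2 h2 & forall (c d : R -> R) t c' d',
    der c t c' -> der d t d' ->
    der (fun s => h (c s) (d s)) t (h1 (c t) (d t) * c' + h2 (c t) (d t) * d')].

Lemma C1_der1 h h1 h2 x y : C1 h h1 h2 -> der (h^~ y) x (h1 x y).
Proof.
move=> [_ _ _ /(_ id (fun=> y) x 1 0 (der_id _) (der_cst _ _))].
by move=> /der_eq; apply; rewrite mulr1 mulr0 addr0.
Qed.

Lemma C1_der2 h h1 h2 x y : C1 h h1 h2 -> der (h x) y (h2 x y).
Proof.
move=> [_ _ _ /(_ (fun=> x) id y 0 1 (der_cst _ _) (der_id _))].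
by move=> /der_eq; apply; rewrite mulr1 mulr0 add0r.
Qed.

Lemma C1_cst c : C1 (fun _ _ => c) (fun _ _ => 0) (fun _ _ => 0).
Proof.
split; try exact: cont2_cst.
by move=> c1 d t c' d' _ _; apply: der_eq (der_cst _ _) _; rewrite !mul0r addr0.
Qed.

Lemma C1_fst : C1 (fun x _ => x) (fun _ _ => 1) (fun _ _ => 0).
Proof.
split; [exact: cont2_fst|exact: cont2_cst|exact: cont2_cst|].
by move=> c d t c' d' dc _; apply: der_eq dc _; rewrite mul0r addr0 mul1r.
Qed.

Lemma C1D h h1 h2 k k1 k2 : C1 h h1 h2 -> C1 k k1 k2 ->
  C1 (fun x y => h x y + k x y) (fun x y => h1 x y + k1 x y) (fun x y => h2 x y + k2 x y).
Proof.
move=> [c c1 c2 dh] [d d1 d2 dk]; split; try exact: cont2D.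
move=> e f t e' f' de df.
by apply: der_eq (derD _ _ _ _ _ (dh _ _ _ _ _ de df) (dk _ _ _ _ _ de df)) _; ring.
Qed.

Lemma C1M h h1 h2 k k1 k2 : C1 h h1 h2 -> C1 k k1 k2 ->
  C1 (fun x y => h x y * k x y) (fun x y => h1 x y * k x y + h x y * k1 x y)
     (fun x y => h2 x y * k x y + h x y * k2 x y).
Proof.
move=> [c c1 c2 dh] [d d1 d2 dk]; split; try by do ?[apply: cont2D|apply: cont2M].
move=> e f t e' f' de df.
by apply: der_eq (derM _ _ _ _ _ (dh _ _ _ _ _ de df) (dk _ _ _ _ _ de df)) _; ring.
Qed.

Lemma C1_comp g g' h h1 h2 : C1 h h1 h2 ->
  cont2 (fun x y => g (h x y)) -> cont2 (fun x y => g' (h x y)) ->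
  (forall x y, der g (h x y) (g' (h x y))) ->
  C1 (fun x y => g (h x y)) (fun x y => g' (h x y) * h1 x y)
     (fun x y => g' (h x y) * h2 x y).
Proof.
move=> [c c1 c2 dh] cg cg' dg; split => //; try exact: cont2M.
move=> e f t e' f' de df.
apply: der_eq (der_comp (fun s => h (e s) (f s)) g _ _ _ (dg _ _) (dh _ _ _ _ _ de df)) _.
by ring.
Qed.

Lemma C1_ext h h1 h2 k k1 k2 : C1 h h1 h2 ->
  (forall x y, h x y = k x y) -> (forall x y, h1 x y = k1 x y) ->
  (forall x y, h2 x y = k2 x y) -> C1 k k1 k2.
Proof.
move=> H e e1 e2.
have -> : k = h by apply/funext => x; apply/funext => y.
have -> : k1 = h1 by apply/funext => x; apply/funext => y.
by have -> : k2 = h2 by apply/funext => x; apply/funext => y.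
Qed.

Lemma C1Z a h h1 h2 : C1 h h1 h2 ->
  C1 (fun x y => a * h x y) (fun x y => a * h1 x y) (fun x y => a * h2 x y).
Proof. by move=> H; apply: C1_ext (C1M _ _ _ _ _ _ (C1_cst a) H) _ _ _ => x y //; ring. Qed.

Lemma C1_exp h h1 h2 : C1 h h1 h2 ->
  C1 (fun x y => expR (h x y)) (fun x y => expR (h x y) * h1 x y)
     (fun x y => expR (h x y) * h2 x y).
Proof.
move=> H; have [c _ _ _] := H.
apply: (C1_comp expR expR) => //; try exact: cont2_exp.
by move=> x y; exact: is_derive_expR.
Qed.

Lemma cont2_inv h : cont2 h -> (forall x y, h x y != 0) -> cont2 (fun x y => (h x y)^-1).
Proof.
move=> ch h0 z; apply: (@continuous_comp _ _ _ (fun z : R * R => h z.1 z.2) (fun x => x^-1)); first exact: ch.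
exact: inv_continuous.
Qed.

Lemma C1_ln h h1 h2 : C1 h h1 h2 -> (forall x y, 0 < h x y) ->
  C1 (fun x y => ln (h x y)) (fun x y => (h x y)^-1 * h1 x y)
     (fun x y => (h x y)^-1 * h2 x y).
Proof.
move=> H h0; have [c _ _ _] := H.
apply: (C1_comp (@ln R) (fun x => x^-1)) => //.
- move=> z; apply: (@continuous_comp _ _ _ (fun z : R * R => h z.1 z.2) (@ln R)); first exact: c.
  exact: continuous_ln.
- by apply: cont2_inv => // x y; rewrite gt_eqF.
- by move=> x y; exact: is_derive1_ln.
Qed.

End Calculus.

Ltac solve_cont2 := repeat match goal with
  | H : cont2 ?h |- cont2 ?h => exact H
  | |- cont2 (fun x y => @?h x y + @?k x y) => apply (@cont2D _ h k)
  | |- cont2 (fun x y => @?h x y * @?k x y) => apply (@cont2M _ h k)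
  | |- cont2 (fun x y => - @?h x y) => apply (@cont2N _ h)
  | |- cont2 (fun x y => @?h x y ^+ ?n) => apply (@cont2X _ n h)
  | |- cont2 (fun x y => expR (@?h x y)) => apply (@cont2_exp _ h)
  | |- cont2 (fun x y => `|@?h x y|) => apply (@cont2_norm _ h)
  | |- cont2 (fun _ _ => ?c) => exact (@cont2_cst _ c)
  | |- cont2 (fun x _ => x) => exact (@cont2_fst _)
  | |- cont2 (fun _ y => y) => exact (@cont2_snd _)
  | |- cont2 _ => assumption
  end.

(** * Sobolev, exponential integrability and Caccioppoli estimates *)

Section Step.
Context {R : realType}.
Implicit Types (t : R).

Lemma der_pos_sqr t : der (fun s => Num.max s 0 ^+ 2) t (2 * Num.max t 0).
Proof.
have [t0|t0|->] := ltgtP t 0.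
- rewrite mulr0; apply: der_near (der_cst 0 t).
  near=> s; rewrite max_r ?expr0n //; apply/ltW; near: s.
  exact: lt_nbhsl.
- apply: (der_near (fun s => s * s)); last by apply: der_eq (derM _ _ _ _ _ (der_id t) (der_id t)) _; ring.
  near=> s; rewrite max_l ?expr2 //; apply/ltW; near: s.
  exact: lt_nbhsr.
- rewrite mulr0.
  have cv : h^-1 *: (Num.max (h *: 1 + 0 : R) 0 ^+ 2 - Num.max 0 0 ^+ 2) @[h --> (0:R)^'] --> (0 : R).
    apply/cvgr0Pnorm_lt => e e0; near=> h.
    have h0 : h != 0 by near: h; exact: nbhs_dnbhs_neq.
    rewrite maxxx expr0n subr0 addr0 /GRing.scale /= mulr1.
    have he : `|h| < e.
      by near: h; apply: dnbhs0_lt.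
    apply: le_lt_trans he; rewrite normrM normfV ler_pdivrMl ?normr_gt0 //.
    have [h1|h1] := leP h 0; first by rewrite expr0n normr0 mulr_ge0.
    by rewrite normrX.
  by apply: DeriveDef; [apply/cvg_ex; exists 0; exact: cv|apply/cvg_lim => //; exact: cv].
Unshelve. all: by end_near. Qed.

(** A quadratic spline with knots 0, 1/2 and 1 that rises from 0 to 1; its derivative is the tent of
    height 2 over [[0, 1]]. It is chosen continuously differentiable, so that the chain rule in the
    form [C1] applies to truncations. *)
Definition step t : R :=
  2 * Num.max t 0 ^+ 2 - 4 * Num.max (t - 2^-1) 0 ^+ 2 + 2 * Num.max (t - 1) 0 ^+ 2.
Definition dstep t : R :=
  4 * (Num.max t 0 - 2 * Num.max (t - 2^-1) 0 + Num.max (t - 1) 0).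

Lemma der_step t : der step t (dstep t).
Proof.
have d a : der (fun s => Num.max (s - a) 0 ^+ 2) t (2 * Num.max (t - a) 0 * 1).
  apply: (der_comp (fun s => s - a) (fun s => Num.max s 0 ^+ 2)); first exact: der_pos_sqr.
  by apply: der_eq (derB _ _ _ _ _ (der_id t) (der_cst a t)) _; rewrite subr0.
have dz (c : R) f l : der f t l -> der (fun s => c * f s) t (c * l).
  by move=> df; apply: der_eq (derM _ _ _ _ _ (der_cst c t) df) _; rewrite mul0r add0r.
apply: der_eq (derD _ _ _ _ _ (derB _ _ _ _ _ (dz 2 _ _ (der_pos_sqr t)) (dz 4 _ _ (d 2^-1))) (dz 2 _ _ (d 1))) _.
by rewrite /dstep; ring.
Qed.

Lemma continuous_dstep : continuous dstep.
Proof.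
have c a : continuous (fun s : R => Num.max (s - a) 0).
  move=> x; apply: (@continuous_max _ _ (fun s => s - a) (cst 0)); last exact: cvg_cst.
  by apply: continuousB; [exact: cvg_id|exact: cvg_cst].
have c0 : continuous (fun s : R => Num.max s 0).
  by move=> x; apply: (@continuous_max _ _ id (cst 0)); [exact: cvg_id|exact: cvg_cst].
rewrite /dstep => x.
apply: (@contM _ (fun=> 4) (fun t => Num.max t 0 - 2 * Num.max (t - 2^-1) 0 + Num.max (t - 1) 0)); first exact: cont_cst.
move=> {}x; apply: (@continuousD _ _ _ (fun t : R => Num.max t 0 - 2 * Num.max (t - 2^-1) 0)); last exact: c.
apply: contB; first exact: c0.
by apply: contM; [exact: cont_cst|exact: c].
Qed.

Lemma continuous_step : continuous step.
Proof. by move=> x; exact: der_continuous (der_step x). Qed.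

Let maxE t a : Num.max (t - a) 0 = if t <= a then 0 else t - a.
Proof. by rewrite maxEle subr_le0. Qed.

Let max0E t : Num.max t 0 = if t <= 0 then 0 else t.
Proof. by rewrite maxEle. Qed.

Ltac step_cases t := rewrite ?/step ?/dstep !maxE max0E;
  have [? | ?] := lerP t 0; have [? | ?] := lerP t 2^-1; have [? | ?] := lerP t 1;
  rewrite ?expr0n /=.

Lemma step_ge0 t : 0 <= step t.
Proof. by step_cases t; try lra; nra. Qed.

Lemma step_le1 t : step t <= 1.
Proof. by step_cases t; try lra; nra. Qed.

Lemma dstep_ge0 t : 0 <= dstep t.
Proof. by step_cases t; lra. Qed.

Lemma dstep_le2 t : dstep t <= 2.
Proof. by step_cases t; lra. Qed.

Lemma step_eq0 t : t <= 0 -> step t = 0.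
Proof. by move=> ?; step_cases t; lra. Qed.

Lemma dstep_eq0 t : t <= 0 -> dstep t = 0.
Proof. by move=> ?; step_cases t; lra. Qed.

Lemma step_eq1 t : 1 <= t -> step t = 1.
Proof. by move=> ?; step_cases t; try lra; nra. Qed.

End Step.

(** * Cauchy-Schwarz, the planar Sobolev inequality and energy estimates *)

Section Inequalities.
Context {R : realType}.
Implicit Types (a b c d x y t : R) (f g h k : R -> R -> R).

Lemma discriminant_le (A B C : R) : 0 <= A -> 0 <= C ->
  (forall t : R, 2 * t * B <= t ^+ 2 * A + C) -> B ^+ 2 <= A * C.
Proof.
move=> A0 C0 Q; have [A_gt0|A_le0] := ltP 0 A.
  have := Q (B / A); rewrite -(ler_pM2r A_gt0).
  have -> : 2 * (B / A) * B * A = 2 * B ^+ 2 by field; rewrite gt_eqF.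
  have -> : ((B / A) ^+ 2 * A + C) * A = B ^+ 2 + C * A by field; rewrite gt_eqF.
  by lra.
have {A0 A_le0}A0 : A = 0 by lra.
have [->|B0] := eqVneq B 0; first by rewrite A0 expr0n mul0r.
(* For [A = 0] the left side is linear in [t] and unbounded unless [B = 0]; at this [t] it equals
   [C + 1]. *)
have := Q ((C + 1) / (2 * B)).
have -> : 2 * ((C + 1) / (2 * B)) * B = C + 1 by field.
by rewrite A0; lra.
Qed.

(** The arithmetic-geometric mean inequality for [t ^+ 2 * p] and [q], from
    [(t ^+ 2 * p - q) ^+ 2 >= 0]. The free parameter [t] serves both the discriminant argument and
    the later weighted splittings. *)
Lemma quadratic_cross (t f p q : R) : 0 <= p -> 0 <= q -> f ^+ 2 <= p * q ->
  2 * t * f <= t ^+ 2 * p + q.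
Proof.
move=> p0 q0 e; rewrite leNgt; apply/negP => lt.
have s0 : 0 <= t ^+ 2 * p + q by rewrite addr_ge0 // mulr_ge0 // sqr_ge0.
have : (t ^+ 2 * p + q) ^+ 2 < (2 * t * f) ^+ 2.
  by rewrite ltr_pXn2r ?nnegrE //; exact: le_trans (ltW lt).
have := ler_wpM2l (sqr_ge0 (2 * t)) e; have := sqr_ge0 (t ^+ 2 * p - q).
rewrite !exprMn !sqrrD !sqrrN !exprMn; lra.
Qed.

Lemma mul_le_sqr (X Y Z : R) : X ^+ 2 <= Z -> Y ^+ 2 <= Z -> X * Y <= Z.
Proof. by move=> ? ?; have := sqr_ge0 (X - Y); rewrite sqrrB; lra. Qed.

Lemma add_le_trans (X Y Z t : R) : - Y <= Z -> X + Y <= t -> X <= Z + t.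
Proof. by lra. Qed.

(** Integrate [quadratic_cross] for every [t] and take the discriminant. The hypothesis
    [f ^+ 2 <= g * h] keeps square roots out of the integrands. *)
Lemma I2_CS a b c d f g h : cont2 f -> cont2 g -> cont2 h ->
  (forall x y, a <= x <= b -> c <= y <= d ->
     [/\ 0 <= g x y, 0 <= h x y & f x y ^+ 2 <= g x y * h x y]) ->
  I2 a b c d f ^+ 2 <= I2 a b c d g * I2 a b c d h.
Proof.
move=> cf cg ch H.
have g0 : 0 <= I2 a b c d g by apply: I2_ge0 => x y xab ycd; case: (H x y).
have h0 : 0 <= I2 a b c d h by apply: I2_ge0 => x y xab ycd; case: (H x y).
have Q t : 2 * t * I2 a b c d f <= t ^+ 2 * I2 a b c d g + I2 a b c d h.
  rewrite -(I2Z _ _ _ _ (2 * t) f cf) -(I2Z _ _ _ _ (t ^+ 2) g cg) -I2D; [|by solve_cont2|exact: ch].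
  apply: le_I2; [by solve_cont2..|].
  move=> x y xab ycd; have [p0 q0 e] := H x y xab ycd.
  exact: quadratic_cross.
exact: discriminant_le.
Qed.

(** Gagliardo's argument: integrating from the side [x = b], [|S|] is at most a function of [y]
    alone; integrating from the side [y = c], at most a function of [x] alone. The product of the
    two bounds integrates to the product of their integrals. *)
Lemma sobolev_rectangle a b c d S S1 S2 : a <= b -> c <= d -> C1 S S1 S2 ->
  (forall y, c <= y <= d -> S b y = 0) -> (forall x, a <= x <= b -> S x c = 0) ->
  I2 a b c d (fun x y => S x y ^+ 2) <=
  I2 a b c d (fun x y => `|S1 x y|) * I2 a b c d (fun x y => `|S2 x y|).
Proof.
move=> ab cd CS Sb Sc; have [cS cS1 cS2 _] := CS.
have nS1 := cont2_norm _ cS1; have nS2 := cont2_norm _ cS2.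
pose phi y := I1 a b (fun x => `|S1 x y|).
pose chi x := I1 c d (fun y => `|S2 x y|).
have cphi : continuous phi by apply: (continuous_I1 (fun y x => `|S1 x y|)); exact: (cont2_swap _ nS1).
have cchi : continuous chi by exact: (continuous_I1 (fun x y => `|S2 x y|)).
have bphi x y : a <= x <= b -> c <= y <= d -> `|S x y| <= phi y.
  move=> /andP[ax xb] ycd.
  have -> : S x y = - I1 x b (fun x => S1 x y).
    rewrite (I1_FTC x b _ (S^~ y)) // ?Sb ?sub0r ?opprK //; first exact: (cont2_l S1).
    by move=> z _; exact: C1_der1 CS.
  rewrite normrN; apply: le_trans (I1_norm _ _ _ _) _; first exact: (cont2_l S1).
  by apply: le_I1_sub => //; exact: (cont2_l (fun x y => `|S1 x y|)).
have bchi x y : a <= x <= b -> c <= y <= d -> `|S x y| <= chi x.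
  move=> xab /andP[cy yd].
  have -> : S x y = I1 c y (S2 x).
    rewrite (I1_FTC c y _ (S x)) // ?Sc ?subr0 //; first exact: (cont2_r S2).
    by move=> z _; exact: C1_der2 CS.
  apply: le_trans (I1_norm _ _ _ _) _; first exact: (cont2_r S2).
  by apply: le_I1_sub => //; exact: (cont2_r (fun x y => `|S2 x y|)).
have cphi2 : cont2 (fun _ y : R => phi y) by exact: cont2_cod.
have cchi2 : cont2 (fun x _ : R => chi x) by exact: cont2_dom.
apply: (@le_trans _ _ (I2 a b c d (fun x y => chi x * phi y))).
  apply: le_I2; [exact: cont2X|exact: cont2M|].
  move=> x y xab ycd; rewrite -(real_normK (num_real (S x y))) expr2.
  by apply: ler_pM => //; [exact: bchi|exact: bphi].
rewrite [X in _ <= X * _](_ : _ = I1 c d phi); last first.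
  by rewrite /phi (I2_swap _ _ _ _ (fun x y => `|S1 x y|)).
rewrite [X in _ <= _ * X](_ : _ = I1 a b chi) // -I1Z //.
by apply: eq_ler; apply: eq_I1 => x _; rewrite I1Z // mulrC.
Qed.

Lemma cont2_step n w : cont2 w -> cont2 (fun x y => step (w x y - n)).
Proof.
move=> cw; apply: cont2_comp; first exact: continuous_step.
by apply: cont2D => //; exact: cont2_cst.
Qed.

Lemma cont2_dstep n w : cont2 w -> cont2 (fun x y => dstep (w x y - n)).
Proof.
move=> cw; apply: cont2_comp; first exact: continuous_dstep.
by apply: cont2D => //; exact: cont2_cst.
Qed.

(* Exponential integrability from a uniform bound for the energy on the level
   strips of [w]: the squares of the truncations [step (w - n)] decay
   geometrically in the mean, by the Sobolev inequality. *)
Section ExponentialIntegrability.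
Variables (a b c d E : R) (w w1 w2 : R -> R -> R).
Hypotheses (ab : a <= b) (cd : c <= d) (Cw : C1 w w1 w2).
Hypothesis wb : forall y, c <= y <= d -> w b y <= 1.
Hypothesis wc : forall x, a <= x <= b -> w x c <= 1.
Hypothesis energy : forall n : nat,
  I2 a b c d (fun x y => dstep (w x y - n%:R) * (w1 x y ^+ 2 + w2 x y ^+ 2)) <= E.

Let A n := I2 a b c d (fun x y => step (w x y - n.+1%:R) ^+ 2).

Let cw : cont2 w. Proof. by case: Cw. Qed.
Let cw1 : cont2 w1. Proof. by case: Cw. Qed.
Let cw2 : cont2 w2. Proof. by case: Cw. Qed.

(** Where the derivative [z] of the truncation at level [n + 2] is nonzero, the truncation at level
    [n + 1] already equals 1, so the integral of [z] is at most [2 * A n]. Cauchy-Schwarz with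
    weight [z] bounds the squares of both factors in the Sobolev inequality by [E * (2 * A n)]. *)
Let A_rec n : A n.+1 <= 2 * E * A n.
Proof.
pose z x y := dstep (w x y - n.+2%:R).
have cz : cont2 z by exact: cont2_dstep.
have z0 x y : 0 <= z x y by exact: dstep_ge0.
have CS : C1 (fun x y => step (w x y - n.+2%:R)) (fun x y => z x y * w1 x y)
    (fun x y => z x y * w2 x y).
  apply: (C1_comp (fun s => step (s - n.+2%:R)) (fun s => dstep (s - n.+2%:R)) w _ _ Cw _ cz).
    exact: cont2_step.
  move=> x y.
  apply: der_eq (der_comp (fun s => s - n.+2%:R) step _ 1 _ (der_step _) _) _.
    by apply: der_eq (derB _ _ _ _ _ (der_id _) (der_cst _ _)) _; rewrite subr0.
  by rewrite mulr1.
have one_le : (1 : R) <= n.+2%:R by rewrite ler1n.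
apply: le_trans (sobolev_rectangle a b c d _ _ _ ab cd CS _ _) _.
- by move=> y ycd; apply: step_eq0; have := wb _ ycd; lra.
- by move=> x xab; apply: step_eq0; have := wc _ xab; lra.
have zA : I2 a b c d z <= 2 * A n.
  rewrite -I2Z; last by apply: cont2X; exact: cont2_step.
  apply: le_I2 => //; first by apply: cont2M; [exact: cont2_cst|apply: cont2X; exact: cont2_step].
  move=> x y _ _; rewrite /z; have [wn|wn] := leP (w x y) n.+2%:R.
    rewrite dstep_eq0; first by rewrite mulr_ge0 // sqr_ge0.
    by rewrite subr_le0.
  by rewrite step_eq1 ?expr1n ?mulr1 ?dstep_le2 //; move: wn; rewrite -(natr1 n.+1); lra.
have bnd wi : cont2 wi -> (forall x y, wi x y ^+ 2 <= w1 x y ^+ 2 + w2 x y ^+ 2) ->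
    I2 a b c d (fun x y => `|z x y * wi x y|) ^+ 2 <= E * (2 * A n).
  move=> ci le; apply: (@le_trans _ _ (I2 a b c d (fun x y => z x y * wi x y ^+ 2) * I2 a b c d z)).
    apply: I2_CS; [by solve_cont2..|].
    move=> x y _ _; split => //; first by rewrite mulr_ge0 // sqr_ge0.
    by rewrite -normrX ger0_norm ?sqr_ge0 //; apply: eq_ler; ring.
  apply: ler_pM => //; [by apply: I2_ge0 => *; rewrite mulr_ge0 // sqr_ge0|exact: I2_ge0|].
  apply: le_trans (energy n.+2); apply: le_I2; [by solve_cont2..|].
  by move=> x y _ _; apply: ler_wpM2l.
have b1 := bnd w1 cw1; have b2 := bnd w2 cw2.
rewrite (_ : 2 * E * A n = E * (2 * A n)); last by ring.
set X := I2 _ _ _ _ _; set Y := I2 _ _ _ _ _; set Z := E * _.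
have X0 : 0 <= X by apply: I2_ge0.
have Y0 : 0 <= Y by apply: I2_ge0.
have X2 : X ^+ 2 <= Z by apply: b1 => x y; rewrite lerDl sqr_ge0.
have Y2 : Y ^+ 2 <= Z by apply: b2 => x y; rewrite lerDr sqr_ge0.
exact: mul_le_sqr.
Qed.

Let V := (d - c) * (b - a).
Let V0 : 0 <= V. Proof. by rewrite mulr_ge0 // subr_ge0. Qed.

Let E0 : 0 <= E.
Proof.
apply: le_trans (energy 0); apply: I2_ge0 => *.
by rewrite mulr_ge0 ?dstep_ge0 // addr_ge0 // sqr_ge0.
Qed.

Let A_le n : A n <= (2 * E) ^+ n * V.
Proof.
elim: n => [|n IH].
  rewrite expr0 mul1r /V -[d - c]mul1r -(I2_cst _ _ _ _ _ ab cd).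
  apply: le_I2; [by apply: cont2X; exact: cont2_step|exact: cont2_cst|].
  by move=> x y _ _; rewrite expr_le1 // ?step_ge0 ?step_le1.
apply: le_trans (A_rec n) _; rewrite exprS -[_ * _ * V]mulrA.
by apply: ler_wpM2l => //; rewrite mulr_ge0.
Qed.

(** On the strip where [w] lies between [i + 2] and [i + 3], the truncation at level [i + 1] equals
    1, so [expR (k * w)] is at most the corresponding term of [H]. The condition on [k] and [E]
    gives these terms integrals decaying with ratio 1/2, with sum at most twice the first bound. *)
Lemma exp_integrable (k : R) : 0 <= k -> 4 * E * expR k <= 1 ->
  I2 a b c d (fun x y => expR (k * w x y)) <= V * (expR (2 * k) + 2 * expR (3 * k)).
Proof.
move=> k0 kE.
pose H N x y := expR (2 * k) + \sum_(i < N) expR (k * (i + 3)%:R) * step (w x y - i.+1%:R) ^+ 2.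
have HS N x y : H N.+1 x y = H N x y + expR (k * (N + 3)%:R) * step (w x y - N.+1%:R) ^+ 2.
  by rewrite /H big_ord_recr /= addrA.
have cH N : cont2 (H N).
  elim: N => [|N IH].
    rewrite (_ : H 0%N = fun _ _ => expR (2 * k)); first exact: cont2_cst.
    by apply/funext => x; apply/funext => y; rewrite /H big_ord0 addr0.
  rewrite (_ : H N.+1 = fun x y => H N x y + expR (k * (N + 3)%:R) * step (w x y - N.+1%:R) ^+ 2).
    by apply: cont2D => //; apply: cont2M; [exact: cont2_cst|apply: cont2X; exact: cont2_step].
  by apply/funext => x; apply/funext => y; exact: HS.
have wH N x y : w x y <= N%:R + 2 -> expR (k * w x y) <= H N x y.
  elim: N => [|N IH].
    rewrite add0r => w2'; rewrite /H big_ord0 addr0 ler_expR mulrC.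
    exact: ler_wpM2r.
  move=> wN; rewrite HS; have [|wN'] := leP (w x y) (N%:R + 2).
    move=> /IH h; rewrite (le_trans h) // lerDl mulr_ge0 ?sqr_ge0 // expR_ge0.
  rewrite step_eq1; last by rewrite -natr1; lra.
  rewrite expr1n mulr1; apply: ler_wpDl.
    rewrite /H addr_ge0 ?expR_ge0 // sumr_ge0 // => i _.
    by rewrite mulr_ge0 ?sqr_ge0 // expR_ge0.
  rewrite ler_expR; apply: ler_wpM2l => //.
  by move: wN; rewrite natrD -natr1; lra.
have IH N : I2 a b c d (H N) <= V * (expR (2 * k) + expR (3 * k) * (2 - 2 * 2^-1 ^+ N)).
  elim: N => [|N IH].
    rewrite expr0 mulr1 subrr mulr0 addr0 (_ : H 0%N = fun _ _ => expR (2 * k)).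
      by rewrite I2_cst // /V; apply: eq_ler; ring.
    by apply/funext => x; apply/funext => y; rewrite /H big_ord0 addr0.
  have -> : H N.+1 = fun x y => H N x y + expR (k * (N + 3)%:R) * step (w x y - N.+1%:R) ^+ 2.
    by apply/funext => x; apply/funext => y; exact: HS.
  have cs : cont2 (fun x y => step (w x y - N.+1%:R) ^+ 2).
    by apply: cont2X; exact: cont2_step.
  rewrite I2D //; last by apply: cont2M => //; exact: cont2_cst.
  rewrite I2Z //.
  have : expR (k * (N + 3)%:R) * A N <= V * (expR (3 * k) * 2^-1 ^+ N).
    rewrite natrD mulrDr expRD -[k * 3]mulrC expRM_natr.
    apply: (@le_trans _ _ (expR k ^+ N * expR (3 * k) * ((2 * E) ^+ N * V))).
      by apply: ler_wpM2l; rewrite ?mulr_ge0 ?exprn_ge0 ?expR_ge0.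
    rewrite (_ : _ * _ * _ = V * (expR (3 * k) * (2 * E * expR k) ^+ N)); last first.
      by rewrite [(2 * E * _) ^+ _]exprMn; ring.
    rewrite ler_wpM2l // ler_wpM2l ?expR_ge0 // lerXn2r ?nnegrE //.
    - by rewrite !mulr_ge0 ?expR_ge0.
    - lra.
  by move: IH; rewrite exprS -/(A N); lra.
(* The continuous function [w] is bounded on the rectangle, so finitely many levels reach it; the
   bound for the sum is uniform in their number. *)
have [M HM] := @cont2_bounded _ w a b c d cw.
have [N NM] : exists N : nat, M <= N%:R.
  by exists (Num.bound `|M|); apply: le_trans (ler_norm _) _; apply/ltW/archi_boundP.
apply: (@le_trans _ _ (I2 a b c d (H N))).
  apply: le_I2 => //; first by apply: cont2_exp; apply: cont2M => //; exact: cont2_cst.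
  move=> x y xab ycd; apply: wH; have := HM x y xab ycd.
  by have := ler_norm (w x y); lra.
apply: le_trans (IH N) _; apply: ler_wpM2l => //; rewrite lerD2l mulrC.
apply: ler_wpM2r; first exact: expR_ge0.
by rewrite gerBl mulr_ge0 // exprn_ge0.
Qed.

End ExponentialIntegrability.

(* Testing [Delta v] against [psi v - 1 <= 0] makes the boundary term on the side
   where the inner normal derivative is nonpositive harmless. *)
Lemma caccioppoli (a L e : R) (psi psi' : R -> R) v v1 v2 v11 v12 v21 v22 :
  a <= L -> 0 <= a -> 0 <= e ->
  C1 v v1 v2 -> C1 v1 v11 v12 -> C1 v2 v21 v22 ->
  (forall t, der psi t (psi' t)) -> continuous psi' ->
  (forall t, 0 <= psi t <= 1) ->
  (forall y, v1 a y <= 0) ->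
  (forall y, - L <= y <= L -> `|v1 L y| <= e) ->
  (forall x y, a <= x <= L -> `|y| = L -> `|v2 x y| <= e) ->
  I2 a L (- L) L (fun x y => psi' (v x y) * (v1 x y ^+ 2 + v2 x y ^+ 2)) <=
  I2 a L (- L) L (fun x y => `|v11 x y + v22 x y|) + 4 * L * e.
Proof.
move=> aL a0 e0 Cv Cv1 Cv2 dpsi cpsi' psi01 va vL vy.
have LL : - L <= L by lra.
have [cv cv1 cv2 _] := Cv; have [_ cv11 cv12 _] := Cv1; have [_ cv21 cv22 _] := Cv2.
have cpsi : continuous psi by move=> t; exact: der_continuous (dpsi t).
have cpv : cont2 (fun x y => psi (v x y)) by exact: cont2_comp.
have cpv' : cont2 (fun x y => psi' (v x y)) by exact: cont2_comp.
have CP : C1 (fun x y => psi (v x y) + -1) (fun x y => psi' (v x y) * v1 x y + 0)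
    (fun x y => psi' (v x y) * v2 x y + 0).
  by apply: C1D; [apply: (C1_comp psi psi')|exact: C1_cst].
have CF := C1M _ _ _ _ _ _ CP Cv1; have CH := C1M _ _ _ _ _ _ CP Cv2.
have [cF cF1 _ _] := CF; have [cH _ cH2 _] := CH.
have := green_rectangle a L (- L) L _ _ _ _ aL LL cF cH cF1 cH2
  (fun x y _ _ => C1_der1 _ _ _ x y CF) (fun x y _ _ => C1_der2 _ _ _ x y CH).
set lhs := I2 _ _ _ _ _ => G.
have {G} : lhs <= 4 * L * e.
  rewrite G.
  (* At [x = a] both factors are nonpositive, so their product, which is subtracted, only helps. The
     side [x = L] has length [2 * L] and each horizontal side length [L - a]: together they cost at
     most [4 * L * e]. *)
  have : I1 (- L) L (fun y => (psi (v L y) + -1) * v1 L y - (psi (v a y) + -1) * v1 a y) <= e * (L - - L).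
    rewrite -(I1_cst (- L) L e LL); apply: le_I1; [|exact: cont_cst|].
      apply: contB.
        by apply: (cont2_r (fun x y => (psi (v x y) + -1) * v1 x y)).
      by apply: (cont2_r (fun x y => (psi (v x y) + -1) * v1 x y)).
    move=> y yL; have := vL y yL; rewrite ler_norml => /andP[h1 h2].
    have := psi01 (v L y); have := psi01 (v a y) => /andP[? ?] /andP[? ?].
    have := va y => ?; nra.
  have : I1 a L (fun x => (psi (v x L) + -1) * v2 x L - (psi (v x (- L)) + -1) * v2 x (- L)) <= 2 * e * (L - a).
    rewrite -(I1_cst a L (2 * e) aL); apply: le_I1; [|exact: cont_cst|].
      apply: contB.
        by apply: (cont2_l (fun x y => (psi (v x y) + -1) * v2 x y)).
      by apply: (cont2_l (fun x y => (psi (v x y) + -1) * v2 x y)).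
    move=> x xL.
    have := vy x L xL (ger0_norm (le_trans a0 aL)); rewrite ler_norml => /andP[h1 h2].
    have := vy x (- L) xL; rewrite normrN => /(_ (ger0_norm (le_trans a0 aL))).
    rewrite ler_norml => /andP[h3 h4].
    have := psi01 (v x L); have := psi01 (v x (- L)) => /andP[? ?] /andP[? ?].
    nra.
  have : 0 <= e * a by exact: mulr_ge0.
  lra.
have -> : lhs = I2 a L (- L) L (fun x y => psi' (v x y) * (v1 x y ^+ 2 + v2 x y ^+ 2)
    + (psi (v x y) - 1) * (v11 x y + v22 x y)).
  by apply: eq_I2 => x y _ _; ring.
have cm : cont2 (fun x y => (psi (v x y) - 1) * (v11 x y + v22 x y)).
  by apply: cont2M; [apply: cont2D => //; exact: cont2_cst|exact: cont2D].
rewrite I2D; [|by solve_cont2|exact: cm].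
have : - I2 a L (- L) L (fun x y => (psi (v x y) - 1) * (v11 x y + v22 x y)) <=
    I2 a L (- L) L (fun x y => `|v11 x y + v22 x y|); last exact: add_le_trans.
  rewrite -[X in X <= _]mulN1r -(I2Z _ _ _ _ _ _ cm); apply: le_I2; [by solve_cont2..|].
  move=> x y _ _; have /andP[p0 p1] := psi01 (v x y).
  rewrite mulN1r -mulNr opprB; apply: le_trans (ler_norm _) _.
  by rewrite normrM ler_piMl // ler_norml; lra.
Qed.

End Inequalities.

(** * Potentials and the smallness of their energy *)

#[global] Opaque I1 I2 cont2.

Section Core.
Context {R : realType}.
Implicit Types (x y t : R).

(** Both bounds come from [1 + s <= expR s] at [s = t] and [s = - t]: the second gives
    [expR t * (1 - t) <= 1], hence [(expR t - 1 - t) * (1 - t) <= t ^+ 2]. *)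
Lemma expR_quad (t : R) : `|t| <= 2^-1 -> 0 <= expR t - 1 - t <= 2 * t ^+ 2.
Proof.
move=> t2; have /andP[t1 t3] : - 2^-1 <= t <= 2^-1 by rewrite -ler_norml.
have h1 := expR_ge1Dx t; have h2 := expR_ge1Dx (- t).
have h3 : expR t * expR (- t) = 1 by rewrite expRN divff // gt_eqF // expR_gt0.
have h4 : expR t * (1 - t) <= 1 by rewrite -[X in _ <= X]h3 ler_wpM2l ?expR_ge0.
apply/andP; split; first lra.
have h5 : (expR t - 1 - t) * (1 - t) <= t ^+ 2 by rewrite expr2; lra.
have h6 : (expR t - 1 - t) * 2^-1 <= (expR t - 1 - t) * (1 - t).
  by apply: ler_wpM2l; lra.
lra.
Qed.

Lemma expR_lip (t : R) : `|t| <= 2^-1 -> `|expR t - 1| <= 2 * `|t|.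
Proof.
move=> t2; have /andP[h1 h2] := expR_quad t t2.
have h3 : t ^+ 2 <= 2^-1 * `|t|.
  by rewrite -(real_normK (num_real t)) expr2; apply: ler_wpM2r.
have := ler_norm t; have := ler_norm (- t); rewrite normrN => ? ?.
by rewrite ler_norml; lra.
Qed.

(* Either [y ^ (2 - p)] is at least [e T], and [y ^ p] is then controlled by
   [y ^ 2], or [y] itself is small. *)
Lemma powR_young (y p e T Q : R) (N : nat) : 0 <= y -> 1 <= p -> p < 2 ->
  0 < e -> e <= 1 -> 1 <= T -> 0 <= Q -> y ^+ 2 <= T * Q -> p / (2 - p) <= N%:R ->
  y `^ p <= e * T ^+ N + Q / e.
Proof.
move=> y0 p1 p2 e0 e1 T1 Q0 yTQ pN.
have p0 : 0 < 2 - p by lra.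
have T0 : 0 < T by lra.
have rhs0 : 0 <= e * T ^+ N by rewrite mulr_ge0 ?exprn_ge0 // ltW.
have Qe0 : 0 <= Q / e by rewrite divr_ge0 // ltW.
move: y0; rewrite le_eqVlt => /predU1P[<-|y0].
  by rewrite powR0 ?addr_ge0 //; apply/eqP; lra.
have y2 : y `^ p * y `^ (2 - p) = y ^+ 2.
  rewrite -powRD; last by rewrite (gt_eqF y0) implybT.
  by rewrite addrC subrK powR_mulrn // ltW.
have [le|lt] := leP (e * T) (y `^ (2 - p)).
  apply: ler_wpDl => //; rewrite ler_pdivlMr //.
  rewrite -(ler_pM2r T0) -mulrA [Q * T]mulrC; apply: le_trans yTQ.
  by rewrite -y2; apply: ler_wpM2l => //; exact: powR_ge0.
apply: ler_wpDr => //.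
have -> : y `^ p = (y `^ (2 - p)) `^ (p / (2 - p)).
  by rewrite -powRrM mulrC divfK // gt_eqF.
(* The exponent is at least 1 because [1 <= p]; since [e <= 1 <= T], raising [e] to it is bounded by
   [e], and raising [T] to it by [T ^+ N]. *)
have q1 : 1 <= p / (2 - p) by rewrite ler_pdivlMr // mul1r; lra.
have q0 : 0 <= p / (2 - p) by lra.
apply: (@le_trans _ _ ((e * T) `^ (p / (2 - p)))).
  by apply: ge0_ler_powR => //; rewrite ?nnegrE ?powR_ge0 ?mulr_ge0 // ltW.
rewrite powRM ?(ltW e0) ?(ltW T0) //; apply: ler_pM; rewrite ?powR_ge0 //.
  by rewrite -[X in _ <= X]powRr1 ?(ltW e0) //; apply: ger_powR => //; rewrite e0.
by rewrite -powR_mulrn ?(ltW T0) //; apply: ler_powR.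
Qed.

Lemma exprD_le (s t : R) (n : nat) : 0 <= s -> 0 <= t ->
  (s + t) ^+ n <= 2 ^+ n * (s ^+ n + t ^+ n).
Proof.
move=> s0 t0; wlog st : s t s0 t0 / s <= t.
  move=> W; have [st|ts] := leP s t; first exact: W.
  by rewrite addrC [s ^+ n + _]addrC; apply: W => //; exact: ltW.
apply: (@le_trans _ _ ((2 * t) ^+ n)).
  by apply: lerXn2r; rewrite ?nnegrE ?addr_ge0 ?mulr_ge0 //; lra.
by rewrite exprMn ler_wpM2l ?exprn_ge0 // lerDr exprn_ge0.
Qed.

(** A function with its first and second derivatives on all of the plane, although the geometry
    fixes it only for [x > 0]: the integrands are then globally continuous and the rectangle lemmas
    apply without domain conditions. *)
Record C2fun := MkC2fun {
  val0 : R -> R -> R; val1 : R -> R -> R; val2 : R -> R -> R;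
  val11 : R -> R -> R; val12 : R -> R -> R; val21 : R -> R -> R; val22 : R -> R -> R;
  val0_C1 : C1 val0 val1 val2;
  val1_C1 : C1 val1 val11 val12;
  val2_C1 : C1 val2 val21 val22
}.

(* [x] times the sum of the scalar curvature (in the conformal normalisation)
   and [2 |grad u|^2]: the density of the mass. *)
Definition mass_density (u al : C2fun) x y : R :=
  4 * (x * (val11 u x y + val22 u x y) + val1 u x y)
  - 2 * x * (val11 al x y + val22 al x y).

(** What the analysis retains of a metric. The factor 8 is [16 pi / (2 pi)]: the normalisation of
    the mass against the integral over the angle. *)
Record axi_data (rho0 R0 C m : R) (u al : C2fun) : Prop := AxiData {
  density_ge : forall x y, 0 < x ->
    2 * x * (val1 u x y ^+ 2 + val2 u x y ^+ 2) <= mass_density u al x y;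
  mono_inner : forall y, val1 al rho0 y - 2 * val1 u rho0 y <= 0;
  decay : forall x y r, 0 < x -> 0 < r -> R0 <= r -> r ^+ 2 = x ^+ 2 + y ^+ 2 ->
    [/\ `|val0 u x y| <= C / r, `|val0 al x y| <= C / r,
        `|val1 u x y| <= C / r ^+ 2 /\ `|val2 u x y| <= C / r ^+ 2
      & `|val1 al x y| <= C / r ^+ 2 /\ `|val2 al x y| <= C / r ^+ 2];
  mass_le : forall L, rho0 <= L -> I2 rho0 L (- L) L (mass_density u al) <= 8 * m
}.

Definition vv (u al : C2fun) x y := val0 al x y + -2 * val0 u x y.
Definition vv1 (u al : C2fun) x y := val1 al x y + -2 * val1 u x y.
Definition vv2 (u al : C2fun) x y := val2 al x y + -2 * val2 u x y.

Section Data.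
Variables (rho0 R0 C m : R) (u al : C2fun).
Hypotheses (rho0_gt0 : 0 < rho0) (D : axi_data rho0 R0 C m u al).

Let v := vv u al.
Let v1 := vv1 u al.
Let v2 := vv2 u al.
Let v11 x y := val11 al x y + -2 * val11 u x y.
Let v12 x y := val12 al x y + -2 * val12 u x y.
Let v21 x y := val21 al x y + -2 * val21 u x y.
Let v22 x y := val22 al x y + -2 * val22 u x y.

Lemma vv_C1 : C1 v v1 v2.
Proof. by apply: C1D; [exact: val0_C1|apply: C1Z; exact: val0_C1]. Qed.

Lemma vv1_C1 : C1 v1 v11 v12.
Proof. by apply: C1D; [exact: val1_C1|apply: C1Z; exact: val1_C1]. Qed.

Lemma vv2_C1 : C1 v2 v21 v22.
Proof. by apply: C1D; [exact: val2_C1|apply: C1Z; exact: val2_C1]. Qed.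

Lemma C2_cont (f : C2fun) : [/\ cont2 (val0 f), cont2 (val1 f), cont2 (val2 f),
  cont2 (val11 f) & cont2 (val22 f)].
Proof. by case: (val0_C1 f); case: (val1_C1 f); case: (val2_C1 f). Qed.

Lemma cont2_density : cont2 (mass_density u al).
Proof.
have [_ u1 _ u11 u22] := C2_cont u; have [_ _ _ a11 a22] := C2_cont al.
by rewrite /mass_density; solve_cont2.
Qed.

Lemma decay_outer (x y L : R) : 0 < L -> R0 <= L -> 0 < x -> L <= x \/ L <= `|y| ->
  [/\ `|val0 u x y| <= C / L, `|val0 al x y| <= C / L,
      `|v x y| <= 3 * C / L, `|v1 x y| <= 3 * C / L ^+ 2 & `|v2 x y| <= 3 * C / L ^+ 2].
Proof.
move=> L0 RL x0 xyL; pose r : R := Num.sqrt (x ^+ 2 + y ^+ 2).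
have s0 : 0 <= x ^+ 2 + y ^+ 2 by rewrite addr_ge0 ?sqr_ge0.
have r2 : r ^+ 2 = x ^+ 2 + y ^+ 2 by rewrite sqr_sqrtr.
have Lr : L <= r.
  rewrite -(@ler_pXn2r _ 2) ?nnegrE ?sqrtr_ge0 // ?(ltW L0) // r2.
  case: xyL => h.
    by rewrite ler_wpDr ?sqr_ge0 // lerXn2r ?nnegrE // ltW.
  by rewrite ler_wpDl ?sqr_ge0 // -(real_normK (num_real y)) lerXn2r ?nnegrE // ltW.
have r0 : 0 < r := lt_le_trans L0 Lr.
have [a1 a2 [a3 a4] [a5 a6]] := decay _ _ _ _ _ _ D x y r x0 r0 (le_trans RL Lr) r2.
have C0 : 0 <= C by have := le_trans (normr_ge0 _) a1; rewrite ler_pdivlMr // mul0r.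
have b1 : C / r <= C / L by rewrite ler_wpM2l // lef_pV2.
have b2 : C / r ^+ 2 <= C / L ^+ 2.
  by rewrite ler_wpM2l // lef_pV2 ?posrE ?exprn_gt0 // lerXn2r ?nnegrE // ltW.
have tri (p q s : R) : `|p| <= s -> `|q| <= s -> `|p + -2 * q| <= 3 * s.
  move=> hp hq; apply: le_trans (ler_normD _ _) _; rewrite normrM normrN.
  by rewrite (ger0_norm (ler0n R 2)); lra.
by split; [exact: le_trans b1|exact: le_trans b1|rewrite -mulrA; apply: tri; exact: le_trans b1|
  rewrite -mulrA; apply: tri; exact: le_trans b2|rewrite -mulrA; apply: tri; exact: le_trans b2].
Qed.

Lemma grad_u_energy L : rho0 <= L ->
  I2 rho0 L (- L) L (fun x y => val1 u x y ^+ 2 + val2 u x y ^+ 2) <= 4 * m / rho0.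
Proof.
move=> rL; have [_ cu1 cu2 _ _] := C2_cont u; have cf := cont2_density.
have cg : cont2 (fun x y => val1 u x y ^+ 2 + val2 u x y ^+ 2) by solve_cont2.
rewrite ler_pdivlMr // mulrC -I2Z //.
have := mass_le _ _ _ _ _ _ D _ rL.
suff : 2 * I2 rho0 L (- L) L (fun x y => rho0 * (val1 u x y ^+ 2 + val2 u x y ^+ 2)) <=
  I2 rho0 L (- L) L (mass_density u al).
  by move: (I2 _ _ _ _ _) (I2 _ _ _ _ _) => X Y; lra.
rewrite -I2Z; last by solve_cont2.
apply: le_I2 => //; first by solve_cont2.
move=> x y /andP[rx _] _; apply: le_trans (density_ge _ _ _ _ _ _ D x y (lt_le_trans rho0_gt0 rx)).
by rewrite mulrA ler_wpM2r ?addr_ge0 ?sqr_ge0 // ler_wpM2l.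
Qed.

(** By definition of the density, [2 x Delta v = 4 d u / d rho - mass_density]; the density is
    nonnegative, so it enters the bound without absolute value. *)
Lemma lap_v_le x y : rho0 <= x ->
  rho0 * `|v11 x y + v22 x y| <= 2 * `|val1 u x y| + 2^-1 * mass_density u al x y.
Proof.
move=> rx; have x0 : 0 < x := lt_le_trans rho0_gt0 rx.
have f0 : 0 <= mass_density u al x y.
  apply: le_trans (density_ge _ _ _ _ _ _ D x y x0).
  by rewrite !mulr_ge0 ?addr_ge0 ?sqr_ge0 // ltW.
have e : 2 * x * (v11 x y + v22 x y) = 4 * val1 u x y - mass_density u al x y.
  by rewrite /mass_density /v11 /v22; ring.
have h : 2 * x * `|v11 x y + v22 x y| <= 4 * `|val1 u x y| + mass_density u al x y.
  rewrite -[X in X * `|_|](@ger0_norm _ (2 * x)) ?mulr_ge0 ?(ltW x0) // -normrM e.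
  apply: le_trans (ler_normB _ _) _.
  by rewrite normrM (ger0_norm (ler0n R 4)) (ger0_norm f0).
have : rho0 * `|v11 x y + v22 x y| <= x * `|v11 x y + v22 x y| by exact: ler_wpM2r.
lra.
Qed.

(** The term [|val1 u|] is controlled in L^2 only, over an area of order [L ^+ 2]. It is split as
    [L ^- 3 + L ^+ 3 * |grad u| ^+ 2]: the constant then integrates to at most [2 / L], at the price
    of a factor [L ^+ 3] on the mass. *)
Lemma lap_v_integral L : rho0 <= L ->
  I2 rho0 L (- L) L (fun x y => `|v11 x y + v22 x y|) <=
  (4 / L + 8 * m * L ^+ 3 / rho0 + 4 * m) / rho0.
Proof.
move=> rL; have L0 : 0 < L := lt_le_trans rho0_gt0 rL.
have [_ cu1 cu2 cu11 cu22] := C2_cont u; have cf := cont2_density.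
have [_ _ _ ca11 ca22] := C2_cont al.
have cl : cont2 (fun x y => `|v11 x y + v22 x y|) by rewrite /v11 /v22; solve_cont2.
have L3 : 0 < L ^+ 3 by rewrite exprn_gt0.
pose g x y := L^-1 ^+ 3 + L ^+ 3 * (val1 u x y ^+ 2 + val2 u x y ^+ 2).
have cgu : cont2 (fun x y => val1 u x y ^+ 2 + val2 u x y ^+ 2) by solve_cont2.
have cg : cont2 g by rewrite /g; solve_cont2.
rewrite ler_pdivlMr // mulrC -I2Z //.
apply: (@le_trans _ _ (I2 rho0 L (- L) L (fun x y => 2 * g x y + 2^-1 * mass_density u al x y))).
  apply: le_I2; [exact: cont2M (cont2_cst _) cl|by solve_cont2|].
  move=> x y /andP[rx _] _; apply: le_trans (lap_v_le x y rx) _.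
  rewrite lerD2r ler_wpM2l // /g.
  have h : `|val1 u x y| ^+ 2 <= val1 u x y ^+ 2 + val2 u x y ^+ 2.
    by rewrite real_normK ?num_real // lerDl sqr_ge0.
  have hL := ler_wpM2l (ltW L3) h; apply: le_trans (lerD (lexx _) hL).
  have q := quadratic_cross 1 `|val1 u x y| (L ^+ 3 * `|val1 u x y| ^+ 2) (L^-1 ^+ 3).
  have : 2 * 1 * `|val1 u x y| <= 1 ^+ 2 * (L ^+ 3 * `|val1 u x y| ^+ 2) + L^-1 ^+ 3.
    apply: q; rewrite ?mulr_ge0 ?exprn_ge0 ?invr_ge0 ?(ltW L0) //.
    by apply: eq_ler; rewrite exprVn mulrAC divff ?mul1r // gt_eqF.
  by have := normr_ge0 (val1 u x y); lra.
rewrite I2D; [|by solve_cont2|by solve_cont2].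
rewrite I2Z // I2Z // {1}/g I2D; [|by solve_cont2|by solve_cont2].
rewrite (I2Z _ _ _ _ (L ^+ 3) _ cgu) (I2_cst _ _ _ _ _ rL); last by lra.
have h1 := grad_u_energy L rL; have h2 := mass_le _ _ _ _ _ _ D _ rL.
have h3 := ler_wpM2l (ltW L3) h1.
have h4 : L^-1 ^+ 3 * (L - - L) * (L - rho0) <= 2 / L.
  have -> : L^-1 ^+ 3 * (L - - L) * (L - rho0) = 2 / L * ((L - rho0) / L).
    by rewrite exprVn; field; rewrite gt_eqF.
  apply: ler_piMr; first by rewrite divr_ge0 // ltW.
  by rewrite ler_pdivrMr // mul1r lerBlDr lerDl ltW.
have -> : 4 / L + 8 * m * L ^+ 3 / rho0 + 4 * m =
   2 * (2 / L + L ^+ 3 * (4 * m / rho0)) + 2^-1 * (8 * m) by field; rewrite !gt_eqF.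
apply: lerD; last by rewrite ler_wpM2l.
by rewrite ler_wpM2l //; apply: lerD.
Qed.

Lemma energy_v L psi psi' : rho0 <= L -> R0 <= L ->
  (forall t, der psi t (psi' t)) -> continuous psi' -> (forall t, 0 <= psi t <= 1) ->
  I2 rho0 L (- L) L (fun x y => psi' (v x y) * (v1 x y ^+ 2 + v2 x y ^+ 2)) <=
  (4 / L + 8 * m * L ^+ 3 / rho0 + 4 * m) / rho0 + 12 * C / L.
Proof.
move=> rL RL dpsi cpsi psi01; have L0 : 0 < L := lt_le_trans rho0_gt0 rL.
have [_ _ _ o1 _] := decay_outer L 0 L L0 RL L0 (or_introl (lexx _)).
have C0 : 0 <= 3 * C / L ^+ 2 := le_trans (normr_ge0 _) o1.
apply: le_trans (caccioppoli rho0 L (3 * C / L ^+ 2) psi psi' v v1 v2 v11 v12 v21 v22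
  rL (ltW rho0_gt0) C0 vv_C1 vv1_C1 vv2_C1 dpsi cpsi psi01 _ _ _) _.
- by move=> y; have := mono_inner _ _ _ _ _ _ D y; rewrite /v1 /vv1 mulNr.
- by move=> y _; have [] := decay_outer L y L L0 RL L0 (or_introl (lexx _)).
- move=> x y /andP[rx _] yL.
  have [] // := decay_outer x y L L0 RL (lt_le_trans rho0_gt0 rx).
  by right; rewrite yL.
apply: lerD; first exact: lap_v_integral.
by apply: eq_ler; field; rewrite gt_eqF.
Qed.

End Data.

(** [L] is chosen to absorb the terms in [1 / L], then the threshold [d] to absorb the powers of [L]
    that multiply the mass. [Lm] lets the rectangle contain those fixed earlier. *)
Lemma energy_small (C R0 rho0 e0 Lm : R) : 0 < rho0 -> 0 < e0 ->
  exists L d : R, [/\ Lm <= L, rho0 <= L, R0 <= L, 0 < d &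
    forall m u al, axi_data rho0 R0 C m u al -> m < d ->
      (forall psi psi', (forall t, der psi t (psi' t)) -> continuous psi' ->
         (forall t, 0 <= psi t <= 1) ->
         I2 rho0 L (- L) L (fun x y => psi' (vv u al x y) *
            (vv1 u al x y ^+ 2 + vv2 u al x y ^+ 2)) <= e0) /\
      I2 rho0 L (- L) L (fun x y => val1 u x y ^+ 2 + val2 u x y ^+ 2) <= e0].
Proof.
move=> r0 e00.
(* [A] is the coefficient of [1 / L] and [K] below that of [m] in the bound of [energy_v]; each of
   the two terms receives half of [e0]. *)
pose A : R := 4 / rho0 + 12 * `|C|.
have A0 : 0 <= A by rewrite addr_ge0 ?mulr_ge0 ?invr_ge0 ?normr_ge0 // ltW.
pose L : R := `|Lm| + `|R0| + rho0 + 2 * A / e0.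
have Ae0 : 0 <= 2 * A / e0 by rewrite divr_ge0 ?mulr_ge0 // ltW.
have nL := normr_ge0 Lm; have nR := normr_ge0 R0.
have L0 : 0 < L by rewrite /L; lra.
have L3 : 0 < L ^+ 3 by rewrite exprn_gt0.
pose K : R := (8 * L ^+ 3 / rho0 + 4) / rho0.
have K0 : 0 < K by rewrite divr_gt0 // addr_gt0 // !mulr_gt0 // invr_gt0.
exists L, (e0 / (2 * K)).
have lLm := ler_norm Lm; have lR0 := ler_norm R0.
split; [by rewrite /L; lra|by rewrite /L; lra|by rewrite /L; lra|by rewrite divr_gt0 // mulr_gt0|].
have rL : rho0 <= L by rewrite /L; lra.
have RL : R0 <= L by rewrite /L; lra.
move=> m u al D md.
have mK : m * K <= e0 / 2.
  have : m * (2 * K) < e0 by rewrite -ltr_pdivlMr // mulr_gt0.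
  by lra.
have m0 : 0 <= m.
  have := grad_u_energy _ _ _ _ _ _ r0 D L rL; rewrite ler_pdivlMr //.
  have : 0 <= I2 rho0 L (- L) L (fun x y => val1 u x y ^+ 2 + val2 u x y ^+ 2) * rho0.
    by rewrite mulr_ge0 ?(ltW r0) //; apply: I2_ge0 => *; rewrite addr_ge0 ?sqr_ge0.
  by lra.
split.
  move=> psi psi' h1 h2 h3.
  apply: le_trans (energy_v _ _ _ _ _ _ r0 D L psi psi' rL RL h1 h2 h3) _.
  have AL : A / L <= e0 / 2.
    rewrite ler_pdivrMr //.
    have : 2 * A / e0 <= L by rewrite /L; lra.
    by rewrite ler_pdivrMr //; lra.
  have CL : 12 * C / L <= 12 * `|C| / L.
    by rewrite ler_pM2r ?invr_gt0 // ler_pM2l // ler_norm.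
  have : (4 / L + 8 * m * L ^+ 3 / rho0 + 4 * m) / rho0 + 12 * `|C| / L = A / L + m * K.
    by rewrite /A /K; field; rewrite !gt_eqF.
  by lra.
apply: le_trans (grad_u_energy _ _ _ _ _ _ r0 D L rL) _.
have : 4 * m / rho0 <= m * K.
  have -> : 4 * m / rho0 = m * (4 / rho0) by ring.
  rewrite ler_wpM2l // /K ler_pM2r ?invr_gt0 // ler_wpDl //.
  by rewrite !mulr_ge0 ?invr_ge0 // ltW.
lra.
Qed.

End Core.

(** * Pointwise and integral bounds for the defect of the metric *)

Section CoreBound.
Context {R : realType}.

(** As a test function it is strictly increasing, so that its derivative weighs the gradient of [v]
    at every level at once, whereas the derivative of a truncation [step] sees one strip. *)
Definition logistic (t : R) : R := expR t / (1 + expR t).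
Definition dlogistic (t : R) : R := expR t / (1 + expR t) ^+ 2.

Let pos1D (t : R) : 0 < 1 + expR t. Proof. by rewrite addr_gt0 ?expR_gt0. Qed.

Lemma der_logistic t : der logistic t (dlogistic t).
Proof.
have h0 : 1 + expR t != 0 by rewrite gt_eqF.
have d1 : der (fun s : R => 1 + expR s) t (0 + expR t).
  by apply: derD; [exact: der_cst|exact: is_derive_expR].
have de : der expR t (expR t) by exact: is_derive_expR.
apply: (der_ext (fun s : R => expR s * (1 + expR s)^-1)) => //.
have d := derM _ _ _ _ _ de (der_inv (fun s : R => 1 + expR s) _ _ h0 d1).
apply: der_eq d _.
by rewrite /dlogistic; field.
Qed.

Lemma logistic01 t : 0 <= logistic t <= 1.
Proof.
rewrite /logistic divr_ge0 ?expR_ge0 ?(ltW (pos1D t)) //=.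
by rewrite ler_pdivrMr // mul1r lerDr.
Qed.

Lemma dlogistic_ge0 t : 0 <= dlogistic t.
Proof. by rewrite /dlogistic divr_ge0 ?expR_ge0 ?exprn_ge0 ?(ltW (pos1D t)). Qed.

Lemma continuous_dlogistic : continuous dlogistic.
Proof.
apply: (@contM _ expR (fun t => ((1 + expR t) ^+ 2)^-1)); first exact: continuous_expR.
have c : cont2 (fun x _ : R => ((1 + expR x) ^+ 2)^-1).
  apply: (@cont2_inv _ (fun x _ => (1 + expR x) ^+ 2)).
    by solve_cont2; apply: cont2_dom; exact: continuous_expR.
  by move=> x _; rewrite expf_eq0 /= gt_eqF.
exact: cont2_l 0 c.
Qed.

(** * Pointwise bounds, with [a], [a'] and [w] standing for the exponentials of [u], [- u] and
    [v] *)

Section Pointwise.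
Variables (a a' w : R).
Hypotheses (a0 : 0 < a) (a'0 : 0 < a') (aa' : a * a' = 1) (w0 : 0 < w).

Let E := a + a'.
Let V := 1 + w.

Let E1 : 1 <= E.
Proof.
have h : 1 <= E ^+ 2 by have e := aa'; have := sqr_ge0 (a - a'); rewrite /E sqrrB sqrrD e; lra.
by rewrite -(@ler_pXn2r _ 2) ?nnegrE ?addr_ge0 ?expr1n // ltW.
Qed.

Let V1 : 1 <= V. Proof. by rewrite lerDl ltW. Qed.
Let E0 : 0 <= E. Proof. exact: le_trans ler01 E1. Qed.
Let V0 : 0 <= V. Proof. exact: le_trans ler01 V1. Qed.

Lemma weight_ge1 : 1 <= (E * V) ^+ 5.
Proof. by rewrite exprn_ege1 // mulr_ege1. Qed.

Let sqr_bound (s : R) : 0 <= s -> s <= (E * V) ^+ 2 -> (s - 1) ^+ 2 <= (E * V) ^+ 5.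
Proof.
move=> s0 sEV; have EV1 : 1 <= E * V by rewrite mulr_ege1.
have EV2 : 1 <= (E * V) ^+ 2 by rewrite exprn_ege1.
apply: (@le_trans _ _ (((E * V) ^+ 2) ^+ 2)).
  rewrite -[(s - 1) ^+ 2]real_normK ?num_real // lerXn2r ?nnegrE ?exprn_ge0 ?mulr_ge0 //.
  by rewrite ler_norml; lra.
by rewrite -exprM ler_weXn2l.
Qed.

Lemma conf_sqr_le : (w ^+ 2 * a ^+ 2 - 1) ^+ 2 <= (E * V) ^+ 5.
Proof.
apply: sqr_bound; first by rewrite mulr_ge0 ?sqr_ge0.
rewrite -exprMn lerXn2r ?nnegrE ?mulr_ge0 ?(ltW w0) ?(ltW a0) //.
by rewrite mulrC ler_pM ?(ltW w0) ?(ltW a0) // ?/E ?/V ?lerDl ?lerDr // ltW.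
Qed.

Lemma angular_sqr_le : (a' ^+ 2 - 1) ^+ 2 <= (E * V) ^+ 5.
Proof.
apply: sqr_bound; first exact: sqr_ge0.
rewrite lerXn2r ?nnegrE ?mulr_ge0 ?(ltW a'0) //.
by rewrite -[a']mulr1 ler_pM ?(ltW a'0) ?mulr1 // /E lerDr ltW.
Qed.

Let b4E (b : R) : 0 <= b -> b <= E -> b ^+ 4 <= E ^+ 5.
Proof.
move=> b0 bE; apply: (@le_trans _ _ (E ^+ 4)); first by rewrite lerXn2r ?nnegrE.
by rewrite ler_weXn2l.
Qed.

(** Here [w / V ^+ 2] is [dlogistic] at [v], the only weight with which the gradient of [v] is
    controlled. It can be divided out because the conformal factor brings [w ^+ 4] and
    [w ^+ 3 <= V ^+ 3]; this is where the fifth power of [V] comes from. *)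
Lemma dconf_sqr_le (s t : R) :
  (w ^+ 2 * a ^+ 2 * (2 * s + 2 * t)) ^+ 2 <=
  8 * (E * V) ^+ 5 * (w / V ^+ 2 * s ^+ 2 + t ^+ 2).
Proof.
have Vgt0 : 0 < V := lt_le_trans ltr01 V1.
have aE : a ^+ 4 <= E ^+ 5 by apply: b4E; rewrite ?(ltW a0) // /E lerDl ltW.
have a40 : 0 <= a ^+ 4 by rewrite exprn_ge0 // ltW.
have w40 : 0 <= w ^+ 4 by rewrite exprn_ge0 // ltW.
have wV : w <= V by rewrite /V lerDr.
have wV3 : w ^+ 3 <= V ^+ 3 by rewrite lerXn2r ?nnegrE // ltW.
have h1 : w ^+ 4 <= V ^+ 5 * (w / V ^+ 2).
  have -> : V ^+ 5 * (w / V ^+ 2) = V ^+ 3 * w by field; rewrite gt_eqF.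
  by rewrite exprSr ler_wpM2r // ltW.
have h2 : w ^+ 4 <= V ^+ 5.
  apply: (@le_trans _ _ (V ^+ 4)); first by rewrite lerXn2r ?nnegrE // ltW.
  by rewrite ler_weXn2l.
have k1 := ler_pM w40 a40 h1 aE; have k2 := ler_pM w40 a40 h2 aE.
have q1 := ler_wpM2r (sqr_ge0 s) k1; have q2 := ler_wpM2r (sqr_ge0 t) k2.
apply: (@le_trans _ _ (8 * (w ^+ 4 * a ^+ 4 * s ^+ 2 + w ^+ 4 * a ^+ 4 * t ^+ 2))).
  have := mulr_ge0 (mulr_ge0 w40 a40) (sqr_ge0 (s - t)).
  rewrite (_ : (_ * (_ + _)) ^+ 2 = 4 * (w ^+ 4 * a ^+ 4 * (s + t) ^+ 2)); last by ring.
  rewrite sqrrB sqrrD; lra.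
rewrite (_ : 8 * (E * V) ^+ 5 * _ = 8 * (V ^+ 5 * (w / V ^+ 2) * E ^+ 5 * s ^+ 2 + V ^+ 5 * E ^+ 5 * t ^+ 2)).
  by rewrite ler_wpM2l // lerD.
by rewrite exprMn; ring.
Qed.

Lemma dangular_sqr_le (t : R) :
  (a' ^+ 2 * (-2 * t)) ^+ 2 <= 4 * (E * V) ^+ 5 * t ^+ 2.
Proof.
rewrite (_ : _ ^+ 2 = 4 * a' ^+ 4 * t ^+ 2); last by ring.
rewrite ler_wpM2r ?sqr_ge0 // ler_wpM2l // exprMn.
have aE : a' ^+ 4 <= E ^+ 5 by apply: b4E; rewrite ?(ltW a'0) // /E lerDr ltW.
by apply: le_trans aE _; rewrite ler_peMr ?exprn_ge0 // exprn_ege1.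
Qed.

(** By [b * c <= b ^+ 2 + c ^+ 2] the product of the weights in [u] and in [v] becomes a sum, so
    that the exponentials of [u], [- u] and [v] can be integrated separately; this doubles the
    exponent to [10 * N]. *)
Lemma weight_pow_le N : ((E * V) ^+ 5) ^+ N <=
  2 ^+ (10 * N) * (a ^+ (10 * N) + a' ^+ (10 * N) + (1 + w ^+ (10 * N))).
Proof.
have h (b c : R) : 0 <= b -> 0 <= c -> b * c <= b ^+ 2 + c ^+ 2.
  by move=> b0 c0; have := sqr_ge0 (b - c); have := mulr_ge0 b0 c0; rewrite sqrrB; lra.
rewrite -exprM exprMn; apply: le_trans (h _ _ _ _) _; rewrite ?exprn_ge0 //.
rewrite -!exprM (_ : 5 * N * 2 = 10 * N)%N; last by rewrite mulnAC.
rewrite [X in _ <= X]mulrDr; apply: lerD.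
  by apply: exprD_le; exact: ltW.
by rewrite -[X in 2 ^+ _ * (X + _)](expr1n _ (10 * N)); apply: exprD_le => //; exact: ltW.
Qed.

End Pointwise.

(** * Integral bounds for the weight, the energy and the values of the defect *)

Section Bound.
Variables (rho0 R0 C m e0 : R) (u al : @C2fun R) (L2 : R) (M : R).
Hypotheses (rho0_gt0 : 0 < rho0) (D : axi_data rho0 R0 C m u al).
Hypothesis M8 : 8 <= M.
Hypothesis EV : forall psi psi' : R -> R, (forall t, der psi t (psi' t)) -> continuous psi' ->
  (forall t, 0 <= psi t <= 1) ->
  I2 rho0 L2 (- L2) L2 (fun x y => psi' (vv u al x y) *
     (vv1 u al x y ^+ 2 + vv2 u al x y ^+ 2)) <= e0.
Hypothesis EU : I2 rho0 L2 (- L2) L2 (fun x y => val1 u x y ^+ 2 + val2 u x y ^+ 2) <= e0.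

Let v := vv u al.

(* The defect of the metric has components [conf] and [x ^+ 2 * ang]; the
   trailing zeros are the derivatives of the constant terms, as given by [C1D]. *)
Definition conf x y : R := expR (2 * val0 al x y + -2 * val0 u x y) + -1.
Definition conf1 x y : R :=
  expR (2 * val0 al x y + -2 * val0 u x y) * (2 * val1 al x y + -2 * val1 u x y) + 0.
Definition conf2 x y : R :=
  expR (2 * val0 al x y + -2 * val0 u x y) * (2 * val2 al x y + -2 * val2 u x y) + 0.
Definition ang x y : R := expR (-2 * val0 u x y) + -1.
Definition ang1 x y : R := expR (-2 * val0 u x y) * (-2 * val1 u x y) + 0.
Definition ang2 x y : R := expR (-2 * val0 u x y) * (-2 * val2 u x y) + 0.

(** [M] absorbs the numerical factor 8 of the derivative bounds and the powers of [x] carried by the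
    angular component. *)
Definition weight x y : R :=
  M * ((expR (val0 u x y) + expR (- val0 u x y)) * (1 + expR (v x y))) ^+ 5.
Definition energy x y : R :=
  dlogistic (v x y) * (vv1 u al x y ^+ 2 + vv2 u al x y ^+ 2)
  + (val1 u x y ^+ 2 + val2 u x y ^+ 2).

Lemma conf_C1 : C1 conf conf1 conf2.
Proof.
apply: C1D; last exact: C1_cst.
by apply: C1_exp; apply: C1D; apply: C1Z; exact: val0_C1.
Qed.

Lemma ang_C1 : C1 ang ang1 ang2.
Proof.
apply: C1D; last exact: C1_cst.
by apply: C1_exp; apply: C1Z; exact: val0_C1.
Qed.

Let cu : cont2 (val0 u). Proof. by case: (C2_cont u). Qed.
Let cu1 : cont2 (val1 u). Proof. by case: (C2_cont u). Qed.
Let cu2 : cont2 (val2 u). Proof. by case: (C2_cont u). Qed.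
Let cv : cont2 v. Proof. by case: (vv_C1 u al). Qed.
Let cv1 : cont2 (vv1 u al). Proof. by case: (vv_C1 u al). Qed.
Let cv2 : cont2 (vv2 u al). Proof. by case: (vv_C1 u al). Qed.

Let cgu : cont2 (fun x y => val1 u x y ^+ 2 + val2 u x y ^+ 2).
Proof. by solve_cont2. Qed.
Let cgv : cont2 (fun x y => vv1 u al x y ^+ 2 + vv2 u al x y ^+ 2).
Proof. by solve_cont2. Qed.

Lemma cont2_weight : cont2 weight.
Proof. by rewrite /weight; solve_cont2. Qed.

Lemma cont2_energy : cont2 energy.
Proof.
apply: cont2D => //; apply: cont2M => //.
by apply: (cont2_comp dlogistic v) => //; exact: continuous_dlogistic.
Qed.

Lemma energy_ge0 x y : 0 <= energy x y.
Proof.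
by rewrite /energy addr_ge0 ?mulr_ge0 ?dlogistic_ge0 // addr_ge0 // sqr_ge0.
Qed.

Let uu x y : expR (val0 u x y) * expR (- val0 u x y) = 1.
Proof. by rewrite -expRD subrr expR0. Qed.

Let EV5 x y := ((expR (val0 u x y) + expR (- val0 u x y)) * (1 + expR (v x y))) ^+ 5.

Let EV51 x y : 1 <= EV5 x y.
Proof. by apply: weight_ge1; rewrite ?expR_gt0. Qed.

Let M0 : 0 < M. Proof. by have h := M8; lra. Qed.

Lemma weight_ge_M x y : M <= weight x y.
Proof. by rewrite /weight -/(EV5 x y) ler_peMr ?(ltW M0). Qed.

Lemma weight1 x y : 1 <= weight x y.
Proof. by apply: le_trans (weight_ge_M x y); have h := M8; lra. Qed.

Let EV5_le x y : EV5 x y <= weight x y.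
Proof. by rewrite /weight ler_peMl ?(le_trans ler01 (EV51 x y)) //; have h := M8; lra. Qed.

(** The exponent [2 al - 2 u] is [2 v + 2 u]: alpha is eliminated in favour of [v], the quantity
    that is controlled. *)
Let confE x y : expR (2 * val0 al x y + -2 * val0 u x y) =
  expR (v x y) ^+ 2 * expR (val0 u x y) ^+ 2.
Proof. by rewrite -!expRM_natl -expRD; congr expR; rewrite /v /vv; ring. Qed.

Let angE x y : expR (-2 * val0 u x y) = expR (- val0 u x y) ^+ 2.
Proof. by rewrite -!expRM_natl; congr expR; ring. Qed.

Lemma conf_sqr x y : conf x y ^+ 2 <= weight x y.
Proof.
apply: le_trans (EV5_le x y); rewrite /conf confE.
by apply: conf_sqr_le; rewrite ?expR_gt0 ?uu.
Qed.

Lemma ang_sqr x y : ang x y ^+ 2 <= weight x y.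
Proof.
apply: le_trans (EV5_le x y); rewrite /ang angE.
by apply: angular_sqr_le; rewrite ?expR_gt0 ?uu.
Qed.

Let energy_part (s t s' t' : R) (l : R) : 0 <= l ->
  l * s ^+ 2 + t ^+ 2 <= l * (s ^+ 2 + s' ^+ 2) + (t ^+ 2 + t' ^+ 2).
Proof.
move=> l0; have := mulr_ge0 l0 (sqr_ge0 s'); have := sqr_ge0 t'.
by rewrite mulrDr; lra.
Qed.

Let dconf_aux (x y s t : R) (c : R) : c = 2 * s + 2 * t ->
  dlogistic (v x y) * s ^+ 2 + t ^+ 2 <= energy x y ->
  (expR (2 * val0 al x y + -2 * val0 u x y) * c + 0) ^+ 2 <= weight x y * energy x y.
Proof.
move=> -> le; rewrite confE addr0.
apply: le_trans (dconf_sqr_le (expR (val0 u x y)) (expR (- val0 u x y)) (expR (v x y)) _ _ _ _ s t) _;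
  [exact: expR_gt0|exact: expR_gt0|exact: uu|exact: expR_gt0|].
apply: ler_pM => //; rewrite ?mulr_ge0 ?(le_trans ler01 (EV51 x y)) //.
  apply: addr_ge0; last exact: sqr_ge0.
  by apply: mulr_ge0; [exact: dlogistic_ge0|exact: sqr_ge0].
by rewrite /weight -/(EV5 x y) ler_wpM2r // (le_trans ler01 (EV51 x y)).
Qed.

Lemma conf1_sqr x y : conf1 x y ^+ 2 <= weight x y * energy x y.
Proof.
apply: (dconf_aux x y (vv1 u al x y) (val1 u x y)); first by rewrite /vv1; ring.
by apply: energy_part; exact: dlogistic_ge0.
Qed.

Lemma conf2_sqr x y : conf2 x y ^+ 2 <= weight x y * energy x y.
Proof.
apply: (dconf_aux x y (vv2 u al x y) (val2 u x y)); first by rewrite /vv2; ring.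
rewrite /energy [vv1 _ _ _ _ ^+ 2 + _]addrC [val1 _ _ _ ^+ 2 + _]addrC.
by apply: energy_part; exact: dlogistic_ge0.
Qed.

Let dang_aux (x y t : R) : t ^+ 2 <= energy x y ->
  2 * (expR (-2 * val0 u x y) * (-2 * t) + 0) ^+ 2 <= 8 * EV5 x y * energy x y.
Proof.
move=> le; rewrite angE addr0.
have := dangular_sqr_le (expR (val0 u x y)) (expR (- val0 u x y)) (expR (v x y)).
rewrite !expR_gt0 uu => /(_ isT isT erefl isT t) h.
have : EV5 x y * t ^+ 2 <= EV5 x y * energy x y.
  by rewrite ler_wpM2l // (le_trans ler01 (EV51 x y)).
by rewrite -/(EV5 x y) in h; lra.
Qed.

(** The factor 2 leaves room for the cross term that appears when [x ^+ 2 * ang] is differentiated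
    in [x]. *)
Lemma ang1_sqr x y : 2 * ang1 x y ^+ 2 <= 8 * EV5 x y * energy x y.
Proof.
apply: dang_aux; rewrite /energy; have := sqr_ge0 (val2 u x y).
have : 0 <= dlogistic (v x y) * (vv1 u al x y ^+ 2 + vv2 u al x y ^+ 2).
  by rewrite mulr_ge0 ?dlogistic_ge0 // addr_ge0 // sqr_ge0.
lra.
Qed.

Lemma ang2_sqr x y : 2 * ang2 x y ^+ 2 <= 8 * EV5 x y * energy x y.
Proof.
apply: dang_aux; rewrite /energy; have := sqr_ge0 (val1 u x y).
have : 0 <= dlogistic (v x y) * (vv1 u al x y ^+ 2 + vv2 u al x y ^+ 2).
  by rewrite mulr_ge0 ?dlogistic_ge0 // addr_ge0 // sqr_ge0.
lra.
Qed.

Lemma ang1_sqr' x y : ang1 x y ^+ 2 <= weight x y * energy x y.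
Proof.
have h := ang1_sqr x y; have e := energy_ge0 x y.
have : 8 * EV5 x y * energy x y <= weight x y * energy x y.
  by rewrite ler_wpM2r // ler_wpM2r // (le_trans ler01 (EV51 x y)).
by have := sqr_ge0 (ang1 x y); lra.
Qed.

Let ang_weight (d x y : R) : 2 * d ^+ 2 <= 8 * EV5 x y * energy x y -> 8 * x ^+ 4 <= M ->
  2 * (x ^+ 2 * d) ^+ 2 <= weight x y * energy x y.
Proof.
move=> h xM; have e := energy_ge0 x y.
have x40 : 0 <= x ^+ 4 by rewrite (exprM x 2 2) sqr_ge0.
have E0 : 0 <= EV5 x y := le_trans ler01 (EV51 x y).
have -> : 2 * (x ^+ 2 * d) ^+ 2 = x ^+ 4 * (2 * d ^+ 2) by ring.
apply: (le_trans (ler_wpM2l x40 h)).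
have -> : x ^+ 4 * (8 * EV5 x y * energy x y) = 8 * x ^+ 4 * EV5 x y * energy x y by ring.
by rewrite ler_wpM2r // /weight -/(EV5 x y) ler_wpM2r.
Qed.

Lemma ang1_sqr_weight x y : 8 * x ^+ 4 <= M ->
  2 * (x ^+ 2 * ang1 x y) ^+ 2 <= weight x y * energy x y.
Proof. by apply: ang_weight; exact: ang1_sqr. Qed.

Lemma ang2_sqr_weight x y : 8 * x ^+ 4 <= M ->
  2 * (x ^+ 2 * ang2 x y) ^+ 2 <= weight x y * energy x y.
Proof. by apply: ang_weight; exact: ang2_sqr. Qed.

Lemma energy_integral L : L <= L2 ->
  I2 rho0 L (- L) L energy <= 2 * e0.
Proof.
move=> LL; apply: (@le_trans _ _ (I2 rho0 L2 (- L2) L2 energy)).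
  apply: le_I2_sub; [exact: cont2_energy|by move=> x y _ _; exact: energy_ge0|exact: lexx|
    exact: LL|by rewrite lerN2|exact: LL].
rewrite /energy I2D; [|apply: cont2M => //|exact: cgu]; last first.
  by apply: (cont2_comp dlogistic v) => //; exact: continuous_dlogistic.
rewrite mulrC mulr_natr mulr2n; apply: lerD; last exact: EU.
by apply: EV; [exact: der_logistic|exact: continuous_dlogistic|exact: logistic01].
Qed.

(** It depends neither on the metric nor on the energy level [e0], so the small parameters can be
    chosen after it. *)
Definition weight_cst (L : R) (N : nat) : R :=
  M ^+ N * (2 ^+ (10 * N) * ((L - - L) * (L - rho0) *
    (1 + 3 * (expR (2 * (10 * N)%:R) + 2 * expR (3 * (10 * N)%:R))))).

(** [exp_integrable] is applied to [u], [- u] and [v] with exponent [10 * N]; [3 * C <= L] makes all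
    three at most 1 on the outer sides. The strip energies of [u] and [- u] are bounded by the full
    energy of [u], those of [v] by testing with [step] at level [n]. *)
Lemma weight_integral L N : rho0 <= L -> R0 <= L -> 3 * C <= L -> L <= L2 ->
  8 * e0 * expR (10 * N)%:R <= 1 ->
  I2 rho0 L (- L) L (fun x y => weight x y ^+ N) <= weight_cst L N.
Proof.
move=> rL RL CL LL2 e0N; have L0 : 0 < L := lt_le_trans rho0_gt0 rL.
have LL : - L <= L by lra.
set k : R := (10 * N)%:R; have k0 : 0 <= k by [].
have e0k : 4 * (2 * e0) * expR k <= 1 by rewrite mulrA -[4 * 2]/(4%:R * 2%:R) -natrM.
have out x y : 0 < x -> L <= x \/ L <= `|y| -> [/\ val0 u x y <= 1, - val0 u x y <= 1 & v x y <= 1].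
  move=> x0 xy; have [a1 _ a2 _ _] := decay_outer _ _ _ _ _ _ D x y L L0 RL x0 xy.
  have C1 : 3 * C / L <= 1 by rewrite ler_pdivrMr // mul1r.
  have C0 : 0 <= C / L := le_trans (normr_ge0 _) a1.
  have C1' : C / L <= 1 by rewrite -mulrA in C1; lra.
  have := ler_norm (val0 u x y); have := ler_norm (- val0 u x y); rewrite normrN.
  by have := ler_norm (v x y); split; lra.
have outb y : - L <= y <= L -> _ := fun _ => out L y L0 (or_introl (lexx L)).
have outc x : rho0 <= x <= L -> [/\ val0 u x (- L) <= 1, - val0 u x (- L) <= 1 & v x (- L) <= 1].
  move=> /andP[rx _]; apply: out; first exact: lt_le_trans rx.
  by right; rewrite normrN ger0_norm // ltW.
have eU (w : R -> R -> R) (n : nat) : cont2 w ->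
    I2 rho0 L (- L) L (fun x y => dstep (w x y - n%:R) * (val1 u x y ^+ 2 + val2 u x y ^+ 2)) <= 2 * e0.
  move=> cw; apply: (@le_trans _ _ (2 * I2 rho0 L2 (- L2) L2 (fun x y => val1 u x y ^+ 2 + val2 u x y ^+ 2))); last first.
    by apply: ler_wpM2l; [exact: ler0n|exact: EU].
  apply: (@le_trans _ _ (I2 rho0 L (- L) L (fun x y => 2 * (val1 u x y ^+ 2 + val2 u x y ^+ 2)))).
    apply: le_I2; [by apply: cont2M => //; exact: cont2_dstep|by solve_cont2|].
    by move=> x y _ _; rewrite ler_wpM2r ?dstep_le2 // addr_ge0 // sqr_ge0.
  rewrite (I2Z _ _ _ _ 2 _ cgu); apply: ler_wpM2l; first exact: ler0n.
  apply: le_I2_sub; [exact: cgu| |exact: lexx|exact: LL2|by rewrite lerN2|exact: LL2].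
  by move=> x y _ _; rewrite addr_ge0 ?sqr_ge0.
pose K := (L - - L) * (L - rho0) * (expR (2 * k) + 2 * expR (3 * k)).
have B1 : I2 rho0 L (- L) L (fun x y => expR (k * val0 u x y)) <= K.
  apply: (exp_integrable rho0 L (- L) L (2 * e0) _ _ _ rL LL (val0_C1 u) _ _ _ k k0 e0k);
    [by move=> y /outb[]|by move=> x /outc[]|].
  by move=> n; exact: eU.
have cNu : cont2 (fun x y => - val0 u x y) by solve_cont2.
have B2 : I2 rho0 L (- L) L (fun x y => expR (k * - val0 u x y)) <= K.
  apply: (exp_integrable _ _ _ _ (2 * e0) (fun x y => - val0 u x y)
    (fun x y => -1 * val1 u x y) (fun x y => -1 * val2 u x y) rL LL); [|by move=> y /outb[]|by move=> x /outc[]| |exact: k0|exact: e0k].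
    by apply: C1_ext (C1Z (-1) _ _ _ (val0_C1 u)) _ _ _ => x y //; rewrite mulN1r.
  move=> n; apply: le_trans (eU _ n cNu); apply: eq_ler; apply: eq_I2 => x y _ _.
    by rewrite !mulN1r !sqrrN.
have e00 : 0 <= e0.
  by apply: le_trans EU; apply: I2_ge0 => *; rewrite addr_ge0 // sqr_ge0.
have B3 : I2 rho0 L (- L) L (fun x y => expR (k * v x y)) <= K.
  apply: (exp_integrable rho0 L (- L) L (2 * e0) v (vv1 u al) (vv2 u al) rL LL (vv_C1 u al) _ _ _ k k0 e0k);
    [by move=> y /outb[_ _ h]; exact: h|by move=> x /outc[_ _ h]; exact: h|].
  move=> n; apply: (@le_trans _ _ e0); last by rewrite mulr_natl mulr2n lerDl.
    have cd : continuous (fun t : R => dstep (t - n%:R)).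
      exact: (cont2_l _ 0 (cont2_dstep n%:R _ (@cont2_fst R))).
    apply: le_trans (EV (fun t => step (t - n%:R)) (fun t => dstep (t - n%:R)) _ cd _).
    + apply: le_I2_sub; [|  |exact: lexx|exact: LL2|by rewrite lerN2|exact: LL2].
        by apply: cont2M; [exact: cont2_dstep|exact: cgv].
      by move=> x y _ _; rewrite mulr_ge0 ?dstep_ge0 // addr_ge0 // sqr_ge0.
    + move=> t; apply: der_eq (der_comp (fun s => s - n%:R) step _ 1 _ (der_step _) _) _.
        by apply: der_eq (derB _ _ _ _ _ (der_id _) (der_cst _ _)) _; rewrite subr0.
      by rewrite mulr1.
    + by move=> t; rewrite step_ge0 step_le1.
pose S x y := expR (k * val0 u x y) + expR (k * - val0 u x y) + (1 + expR (k * v x y)).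
have cS : cont2 S by rewrite /S; solve_cont2.
apply: (@le_trans _ _ (I2 rho0 L (- L) L (fun x y => M ^+ N * (2 ^+ (10 * N) * S x y)))).
  apply: le_I2; [by apply: cont2X; exact: cont2_weight|by solve_cont2|].
  move=> x y _ _; rewrite /weight exprMn ler_wpM2l ?exprn_ge0 ?(ltW M0) //.
  rewrite /S !expRM_natl.
  by apply: weight_pow_le; rewrite ?expR_gt0 ?uu.
have M0' := M0; rewrite I2Z; last by solve_cont2.
rewrite (I2Z _ _ _ _ _ _ cS) /weight_cst.
apply: ler_wpM2l; first by rewrite exprn_ge0 // ltW.
apply: ler_wpM2l; first by rewrite exprn_ge0.
rewrite /S I2D; [|by solve_cont2|by solve_cont2].
rewrite I2D; [|by solve_cont2|by solve_cont2].
rewrite I2D; [|by solve_cont2|by solve_cont2].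
rewrite (I2_cst _ _ _ _ _ rL LL).
move: B1 B2 B3; rewrite /K -/k; move: (I2 _ _ _ _ _) (I2 _ _ _ _ _) (I2 _ _ _ _ _) => X Y Z.
lra.
Qed.

(** [F ^+ 2] at a point is its value at [x = L], small by decay, minus an integral of [2 * F * F1].
    The latter is bounded by [kap * weight ^+ N + energy / kap], since the square of [F * F1] is at
    most [weight ^+ 2 * energy] and the weight is at least 1. *)
Lemma value_integral (F F1 F2 : R -> R -> R) (b l L c kap : R) N : C1 F F1 F2 ->
  rho0 <= b -> b <= L -> 0 <= l -> l <= L -> R0 <= L -> 3 * C <= L -> L <= L2 ->
  (2 <= N)%N -> 8 * e0 * expR (10 * N)%:R <= 1 -> 0 < kap ->
  (forall y, F L y ^+ 2 <= c) ->
  (forall x y, F x y ^+ 2 <= weight x y) ->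
  (forall x y, F1 x y ^+ 2 <= weight x y * energy x y) ->
  I2 rho0 b (- l) l (fun x y => F x y ^+ 2) <=
  (b - rho0) * (2 * l * c + (kap * weight_cst L N + 2 * e0 / kap)).
Proof.
move=> CF rb bL l0 lL RL CL LL2 N2 e0N kap0 FL FW F1W.
have [cF cF1 _ _] := CF; have cw := cont2_weight; have ce := cont2_energy.
have ll : - l <= l by lra.
have rL : rho0 <= L := le_trans rb bL.
pose chi y := I1 rho0 L (fun x => `|2 * (F x y * F1 x y)|).
have cG : cont2 (fun x y => `|2 * (F x y * F1 x y)|) by solve_cont2.
have cchi : continuous chi by exact: (continuous_I1 (fun y x => `|2 * (F x y * F1 x y)|) _ _ (cont2_swap _ cG)).
have pt x y : rho0 <= x <= b -> F x y ^+ 2 <= c + chi y.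
  move=> /andP[rx xb]; have cH : continuous (fun x => 2 * (F x y * F1 x y)).
    by apply: (cont2_l (fun x y => 2 * (F x y * F1 x y))); solve_cont2.
  have ftc := I1_FTC x L (fun x => 2 * (F x y * F1 x y)) (fun x => F x y * F x y) (le_trans xb bL) cH.
  have {}ftc : I1 x L (fun x => 2 * (F x y * F1 x y)) = F L y * F L y - F x y * F x y.
    apply: ftc => z _; have d := C1_der1 _ _ _ z y CF.
    by apply: der_eq (derM _ _ _ _ _ d d) _; ring.
  have h1 := I1_norm x L _ cH.
  have h2 : I1 x L (fun x => `|2 * (F x y * F1 x y)|) <= chi y.
    by apply: le_I1_sub => //; exact: (cont2_l (fun x y => `|2 * (F x y * F1 x y)|)).
  have h3 := ler_norm (- I1 x L (fun x => 2 * (F x y * F1 x y))).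
  rewrite normrN in h3; have := FL y; rewrite !expr2; move: h1 h2 h3; rewrite ftc.
  by move: (I1 _ _ _) => X; lra.
have cc : cont2 (fun _ y => c + chi y).
  by apply: cont2D; [exact: cont2_cst|exact: cont2_cod].
apply: (@le_trans _ _ (I2 rho0 b (- l) l (fun _ y => c + chi y))).
  by apply: le_I2 => //; [solve_cont2|move=> x y xb _; exact: pt].
rewrite I2E I1_cst // mulrC ler_wpM2l ?subr_ge0 //.
rewrite I1D; [|exact: cont_cst|exact: cchi].
rewrite I1_cst //; apply: lerD; first by apply: eq_ler; ring.
apply: (@le_trans _ _ (I1 (- L) L chi)).
  by apply: le_I1_sub; [exact: cchi|by move=> *; exact: I1_ge0|lra|lra].
rewrite [I1 _ _ _](_ : _ = I2 rho0 L (- L) L (fun x y => `|2 * (F x y * F1 x y)|)); last first.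
  by rewrite (I2_swap _ _ _ _ _ cG) I2E.
have cwN : cont2 (fun x y => kap * weight x y ^+ N) by solve_cont2.
have cek : cont2 (fun x y => kap^-1 * energy x y) by solve_cont2.
apply: (@le_trans _ _ (I2 rho0 L (- L) L (fun x y => kap * weight x y ^+ N + kap^-1 * energy x y))).
  apply: le_I2 => //; first exact: cont2D.
  move=> x y _ _; rewrite normrM ger0_norm //.
  have w1 := weight1 x y.
  have h : `|F x y * F1 x y| ^+ 2 <= weight x y ^+ 2 * energy x y.
    rewrite real_normK ?num_real // exprMn expr2 [weight x y ^+ 2]expr2 -expr2 -mulrA.
    by apply: ler_pM; rewrite ?sqr_ge0.
  have := quadratic_cross kap _ _ _ (sqr_ge0 (weight x y)) (energy_ge0 x y) h.
  have : weight x y ^+ 2 <= weight x y ^+ N by rewrite ler_weXn2l.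
  move=> /(ler_wpM2l (ltW kap0)) hN q.
  have : kap * (2 * `|F x y * F1 x y|) <= kap * (kap * weight x y ^+ N + kap^-1 * energy x y).
    have -> : kap * (kap * weight x y ^+ N + kap^-1 * energy x y) = kap * (kap * weight x y ^+ N) + energy x y.
      by field; rewrite gt_eqF.
    have := ler_wpM2l (ltW kap0) hN; rewrite expr2 in q; lra.
  by rewrite ler_pM2l.
rewrite I2D // I2Z; last by apply: cont2X.
rewrite I2Z //; apply: lerD.
  by rewrite ler_wpM2l ?(ltW kap0) //; apply: weight_integral.
by rewrite [X in _ <= X]mulrC ler_wpM2l ?invr_ge0 ?(ltW kap0) //; exact: energy_integral.
Qed.

End Bound.

End CoreBound.

(** * The analytic estimate *)

Section CoreTheorem.
Context {R : realType}.

Lemma small_pos (a b : R) : 0 <= a -> 0 < b -> exists e : R, [/\ 0 < e, e <= 1 & e * a <= b].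
Proof.
move=> a0 b0; have a1 : 0 < a + 1 by lra.
exists (Num.min 1 (b / (a + 1))); split.
- by rewrite lt_min ltr01 divr_gt0.
- by rewrite ge_min lexx.
- have : Num.min 1 (b / (a + 1)) <= b / (a + 1) by rewrite ge_min lexx orbT.
  have : 0 < Num.min 1 (b / (a + 1)) by rewrite lt_min ltr01 divr_gt0.
  by move: (Num.min _ _) => e e0; rewrite ler_pdivlMr //; lra.
Qed.

Lemma expR_sqr_small (t a L c : R) : 0 < L -> 0 < c -> 0 <= a -> 8 * a <= L ->
  8 * a / c <= L -> `|t| <= 4 * a / L -> (expR t + -1) ^+ 2 <= c.
Proof.
move=> L0 c0 a0 aL acL ht.
have z0 : 0 <= 8 * a / L by rewrite divr_ge0 ?mulr_ge0 // ltW.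
have z1 : 8 * a / L <= 1 by rewrite ler_pdivrMr // mul1r.
have z2 : 8 * a / L <= c by move: acL; rewrite !ler_pdivrMr // [L * c]mulrC.
have z3 : 8 * a / L = 2 * (4 * a / L) by ring.
have z4 : `|t| <= 2^-1 by lra.
have z5 := expR_lip t z4.
rewrite -(real_normK (num_real (expR t + -1))).
have z6 : `|expR t + -1| <= 8 * a / L by lra.
apply: (@le_trans _ _ ((8 * a / L) ^+ 2)); first by rewrite lerXn2r ?nnegrE.
by apply: le_trans z2; rewrite expr2 ler_piMr.
Qed.

Lemma value_arith (r0 r1 kap K c t w z : R) : 0 < r0 -> r0 <= r1 -> 0 < kap -> 0 <= K ->
  0 < c -> 0 < t -> c * (r1 ^+ 2 + 1) <= t / 12 ->
  kap * ((K + 1) * (r1 + 1)) <= t / 12 -> kap * w <= kap * K ->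
  z * (r1 + 1) <= t / 12 -> 0 <= z ->
  (r1 - r0) * (2 * (r1 / 2) * c + (kap * w + z)) <= t / 4.
Proof.
move=> r00 r01 kap0 K0 c0 t0 cE kE wK zE z0; have r10 : 0 < r1 by lra.
have s1 : c * r1 ^+ 2 <= t / 12 by lra.
have s2 : r1 * (kap * w) <= r1 * (kap * K) by rewrite ler_pM2l.
have s3 : r1 * (kap * K) <= t / 12.
  by have := mulr_ge0 (ltW kap0) K0; have := mulr_gt0 kap0 r10; lra.
have s4 : r1 * z <= t / 12 by lra.
have rB : r1 * (2 * (r1 / 2) * c + (kap * w + z)) <= t / 4 by lra.
have [B0|B0] := leP 0 (2 * (r1 / 2) * c + (kap * w + z)).
  by apply: le_trans rB; rewrite ler_wpM2r //; lra.
apply: (@le_trans _ _ 0); last by lra.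
by rewrite mulr_ge0_le0 ?(ltW B0) // subr_ge0.
Qed.

Lemma sum_arith (e t X Y Z W : R) : 0 < e -> X <= e * t / 4 -> Y <= e * t / 4 ->
  Z <= e * t / 4 -> W <= t / 4 -> W + e^-1 * (X + (Y + Z)) <= t.
Proof.
move=> e0 hX hY hZ hW.
have : e^-1 * (X + (Y + Z)) <= 3 * t / 4 by rewrite mulrC ler_pdivrMr //; lra.
by lra.
Qed.

Lemma tri_arith (s t a b : R) : s <= a -> t <= a -> a <= b -> 2 * t + 2 * s <= 4 * b.
Proof. by lra. Qed.

(** [c2] is the square of the conformal defect, and [Q] adds the squares of the values to the
    energy. The product rule is handled by [(2 x a + x^2 a1)^2 <= 8 x^2 a^2 + 2 (x^2 a1)^2]. *)
Lemma pointwise_arith (W M E c2 d1 d2 a a1 a2 x : R) : 8 <= M -> 1 <= W -> M <= W -> 0 <= E ->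
  8 * x ^+ 2 <= M -> 8 * x ^+ 4 <= M -> 0 <= c2 ->
  d1 ^+ 2 <= W * E -> d2 ^+ 2 <= W * E ->
  2 * (x ^+ 2 * a1) ^+ 2 <= W * E -> 2 * (x ^+ 2 * a2) ^+ 2 <= W * E ->
  let Q := E + (c2 + a ^+ 2) in
  [/\ c2 <= W * Q, d1 ^+ 2 <= W * Q /\ d2 ^+ 2 <= W * Q, (x ^+ 2 * a) ^+ 2 <= W * Q,
    (2 * x * a + x ^+ 2 * a1) ^+ 2 <= W * Q & (x ^+ 2 * a2) ^+ 2 <= W * Q].
Proof.
move=> M8 W1 WM E0 x2 x4 c20 h1 h2 h3 h4 Q.
have a0 := sqr_ge0 a; have W0 : 0 <= W by lra.
have wc : 0 <= W * c2 by exact: mulr_ge0.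
have wa : 0 <= W * a ^+ 2 by exact: mulr_ge0.
have wQ : W * Q = W * E + (W * c2 + W * a ^+ 2) by rewrite /Q; ring.
have we : 0 <= W * E by exact: mulr_ge0.
have xa : 8 * x ^+ 4 * a ^+ 2 <= W * a ^+ 2 by rewrite ler_wpM2r //; lra.
have xb : 8 * x ^+ 2 * a ^+ 2 <= W * a ^+ 2 by rewrite ler_wpM2r //; lra.
have cc : c2 <= W * c2 by rewrite ler_peMl.
have s1 := sqr_ge0 (x ^+ 2 * a); have s2 := sqr_ge0 (x ^+ 2 * a2).
have e1 : (x ^+ 2 * a) ^+ 2 = x ^+ 4 * a ^+ 2 by ring.
have e2 : (2 * x * a + x ^+ 2 * a1) ^+ 2 + (2 * x * a - x ^+ 2 * a1) ^+ 2 =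
  8 * x ^+ 2 * a ^+ 2 + 2 * (x ^+ 2 * a1) ^+ 2 by ring.
have s3 := sqr_ge0 (2 * x * a - x ^+ 2 * a1).
rewrite wQ {wQ Q}; move: (W * E) (W * c2) (W * a ^+ 2) wc wa we xa xb cc h1 h2 h3 h4 => z1 z2 z3.
by move=> *; split; [lra|split; lra|rewrite e1 in s1 *; lra|lra|lra].
Qed.

(** The majorant is [e * W ^+ N + Q / e], from [powR_young] with [T] the weight. Three nested
    rectangles are needed: the integral of [W ^+ N] on the one of size [La] fixes [e]; only then is
    the tolerance [e * tau] for [Q] known, which determines [L1], where the values are small by
    decay; the weight on that rectangle fixes [kap], hence the energy level [e2], and this in turn
    [L2] and the mass threshold. *)
Lemma core_estimate (C R0 rho0 rho1 p tau : R) : 0 < rho0 -> rho0 <= rho1 ->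
  1 <= p -> p < 2 -> 0 < tau ->
  exists2 delta : R, 0 < delta & forall m (u al : @C2fun R),
    axi_data rho0 R0 C m u al -> m < delta ->
    exists G : R -> R -> R, [/\ cont2 G,
      I2 rho0 rho1 (- (rho1 / 2)) (rho1 / 2) G <= tau &
      forall x y, rho0 <= x <= rho1 -> - (rho1 / 2) <= y <= rho1 / 2 ->
        [/\ `|conf u al x y| `^ p <= G x y,
            `|conf1 u al x y| `^ p <= G x y /\ `|conf2 u al x y| `^ p <= G x y,
            `|x ^+ 2 * ang u x y| `^ p <= G x y,
            `|2 * x * ang u x y + x ^+ 2 * ang1 u x y| `^ p <= G x y
          & `|x ^+ 2 * ang2 u x y| `^ p <= G x y]].
Proof.
move=> rho0_gt0 rho01 p1 p2 tau0.
have rho1_gt0 : 0 < rho1 := lt_le_trans rho0_gt0 rho01.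
have [N [N2 qN]] : exists N : nat, (2 <= N)%N /\ p / (2 - p) <= N%:R.
  exists (Num.bound `|p / (2 - p)|).+2; split => //.
  apply: le_trans (ler_norm _) _; apply/ltW/(lt_le_trans (archi_boundP (normr_ge0 _))).
  by rewrite ler_nat; apply/leqW/leqW.
have [M [M8 M2 M4]] : exists M : R, [/\ 8 <= M, forall x, 0 <= x <= rho1 -> 8 * x ^+ 2 <= M
    & forall x, 0 <= x <= rho1 -> 8 * x ^+ 4 <= M].
  exists (8 * (1 + rho1) ^+ 4); have r1 : 1 <= 1 + rho1 by lra.
  have r0 : 0 <= 1 + rho1 by lra.
  split; first by rewrite ler_peMr // exprn_ege1.
    move=> x /andP[x0 xr]; rewrite ler_pM2l //; apply: (@le_trans _ _ ((1 + rho1) ^+ 2)).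
      by rewrite lerXn2r ?nnegrE //; lra.
    by rewrite ler_weXn2l.
  by move=> x /andP[x0 xr]; rewrite ler_pM2l // lerXn2r ?nnegrE //; lra.
have nC := normr_ge0 C; have lC := ler_norm C; have lR := ler_norm R0.
have [La [r1La RLa CLa]] : exists La : R, [/\ rho1 <= La, R0 <= La & 3 * C <= La].
  by exists (rho1 + `|R0| + 3 * `|C|); have nR := normr_ge0 R0; split; lra.
have rLa : rho0 <= La := le_trans rho01 r1La.
have La0 : 0 < La := lt_le_trans rho1_gt0 r1La.
have exK L : exists K : R, 0 <= K /\ weight_cst rho0 M L N <= K.
  by exists `|weight_cst rho0 M L N|; rewrite ler_norm.
have [Ka [Ka0 KaE]] := exK La.
have [e [e0 e1 eKa]] := small_pos Ka (tau / 4) Ka0 (divr_gt0 tau0 (ltr0n _ 4)).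
(* [Q] enters the majorant divided by [e], so its integral has to be small compared with
   [e * tau]. *)
have [et [et0 etE]] : exists et : R, 0 < et /\ et = e * tau by exists (e * tau); rewrite mulr_gt0.
have et12 : 0 < et / 12 by lra.
have [c0 [c00 _ c0E]] := small_pos (rho1 ^+ 2 + 1) (et / 12) (addr_ge0 (sqr_ge0 _) ler01) et12.
have [L1 [LaL1 L18 L1c]] : exists L1 : R, [/\ La <= L1, 8 * `|C| <= L1 & 8 * `|C| / c0 <= L1].
  have Cc0 : 0 <= 8 * `|C| / c0 by rewrite divr_ge0 ?mulr_ge0 // ltW.
  by exists (La + 8 * `|C| + 8 * `|C| / c0); split; lra.
have rho1L1 : rho1 <= L1 := le_trans r1La LaL1.
have L10 : 0 < L1 := lt_le_trans rho1_gt0 rho1L1.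
have [K1 [K10 K1E]] := exK L1.
have r11 : 0 < rho1 + 1 by lra.
have rr : - (rho1 / 2) <= rho1 / 2 by lra.
have hL1 : rho1 / 2 <= L1 by lra.
have r20 : 0 <= rho1 / 2 by lra.
have hLa : rho1 / 2 <= La by lra.
have [kap [kap0 _ kapE]] := small_pos ((K1 + 1) * (rho1 + 1)) (et / 12)
  (mulr_ge0 (addr_ge0 K10 ler01) (ltW r11)) et12.
have [e2 [e20 e2a e2b e2c]] : exists e2 : R, [/\ 0 < e2, e2 <= et / 8,
    2 * e2 / kap * (rho1 + 1) <= et / 12 & 8 * e2 * expR (10 * N)%:R <= 1].
  have k0 : 0 < expR (10 * N)%:R :> R := expR_gt0 _.
  have f0 : 0 <= 2 / kap * (rho1 + 1) by rewrite mulr_ge0 ?divr_ge0 // ltW.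
  have [a [a0 _ aE]] := small_pos 1 (et / 8) ler01 (divr_gt0 et0 (ltr0n _ 8)).
  have [b [b0 _ bE]] := small_pos (2 / kap * (rho1 + 1)) (et / 12) f0 et12.
  have [c [c0' _ cE]] := small_pos (8 * expR (10 * N)%:R) 1 (mulr_ge0 (ler0n _ 8) (ltW k0)) ltr01.
  exists (Num.min a (Num.min b c)).
  have ha : Num.min a (Num.min b c) <= a by rewrite ge_min lexx.
  have hb : Num.min a (Num.min b c) <= b by rewrite !ge_min lexx orbT.
  have hc : Num.min a (Num.min b c) <= c by rewrite !ge_min lexx !orbT.
  have h0 : 0 < Num.min a (Num.min b c) by rewrite !lt_min a0 b0 c0'.
  move: ha hb hc h0; move: (Num.min _ _) => s ha hb hc h0; split => //; first lra.
    by apply: le_trans bE; rewrite (_ : 2 * s / kap * (rho1 + 1) = s * (2 / kap * (rho1 + 1)));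
      [rewrite ler_wpM2r|ring].
  apply: le_trans cE; rewrite (_ : 8 * s * expR (10 * N)%:R = s * (8 * expR (10 * N)%:R)); last by ring.
  by rewrite ler_wpM2r // mulr_ge0 // ltW.
(* The lower bound [L1] makes the rectangle of the energy estimate contain the two earlier ones. *)
have [L2 [d [L1L2 rL2 RL2 d0 H]]] := energy_small C R0 rho0 e2 L1 rho0_gt0 e20.
exists d => // m u al D md; have EVU := H m u al D md.
pose W := weight u al M; pose Q x y := energy u al x y + (conf u al x y ^+ 2 + ang u x y ^+ 2).
have cW : cont2 W by exact: cont2_weight.
have cen : cont2 (energy u al) by exact: cont2_energy.
have [ccf _ _ _] := conf_C1 u al; have [can _ _ _] := ang_C1 u.
have cQ : cont2 Q by rewrite /Q; solve_cont2.
exists (fun x y => e * W x y ^+ N + Q x y / e); split.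
- by solve_cont2.
- have RL1 : R0 <= L1 := le_trans RLa LaL1.
  have CL1 : 3 * C <= L1 := le_trans CLa LaL1.
  have L1h y : [/\ `|val0 u L1 y| <= C / L1 & `|val0 al L1 y| <= C / L1].
    by have [] := decay_outer _ _ _ _ _ _ D L1 y L1 L10 RL1 L10 (or_introl (lexx _)).
  have bnd (t : R) : `|t| <= 4 * `|C| / L1 -> (expR t + -1) ^+ 2 <= c0.
    exact: expR_sqr_small.
  have lCL : C / L1 <= `|C| / L1 by rewrite ler_pM2r ?invr_gt0.
  have bcf y : conf u al L1 y ^+ 2 <= c0.
    apply: bnd; have [h1 h2] := L1h y; apply: le_trans (ler_normD _ _) _.
    by rewrite !normrM normrN (ger0_norm (ler0n R 2)) -!mulrA; exact: (tri_arith _ _ _ _ h1 h2 lCL).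
  have ban y : ang u L1 y ^+ 2 <= c0.
    apply: bnd; have [h1 h2] := L1h y.
    by rewrite !normrM normrN (ger0_norm (ler0n R 2)) -!mulrA; apply: le_trans (tri_arith _ _ _ _ h1 h2 lCL); rewrite lerDr mulr_ge0.
  have vI F F1 F2 : C1 F F1 F2 -> (forall y, F L1 y ^+ 2 <= c0) ->
      (forall x y, F x y ^+ 2 <= W x y) ->
      (forall x y, F1 x y ^+ 2 <= W x y * energy u al x y) ->
      I2 rho0 rho1 (- (rho1 / 2)) (rho1 / 2) (fun x y => F x y ^+ 2) <= et / 4.
    move=> CF b1 b2 b3.
    apply: le_trans (value_integral _ _ _ _ _ _ _ _ M rho0_gt0 D M8 EVU.1 EVU.2 F F1 F2 rho1 (rho1 / 2)
      L1 c0 kap N CF rho01 rho1L1 r20 hL1 RL1 CL1 L1L2 _ e2c kap0 b1 b2 b3) _ => //.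
    have e2k : 0 <= 2 * e2 / kap by rewrite divr_ge0 ?mulr_ge0 // ltW.
    have k1 : kap * weight_cst rho0 M L1 N <= kap * K1 by rewrite ler_pM2l.
    move: (weight_cst rho0 M L1 N) (2 * e2 / kap) k1 e2b e2k => w z k1 zE z0.
    exact: (value_arith _ _ kap K1).
  have vc := vI _ _ _ (conf_C1 u al) bcf (conf_sqr u al M M8) (conf1_sqr u al M M8).
  have va := vI _ _ _ (ang_C1 u) ban (ang_sqr u al M M8) (ang1_sqr' u al M M8).
  have ien : I2 rho0 rho1 (- (rho1 / 2)) (rho1 / 2) (energy u al) <= et / 4.
    apply: (@le_trans _ _ (I2 rho0 L1 (- L1) L1 (energy u al))).
      apply: le_I2_sub; [exact: cen|by move=> *; exact: energy_ge0|exact: lexx|exact: rho1L1|by rewrite lerN2|exact: hL1].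
    apply: le_trans (energy_integral _ _ _ _ _ EVU.1 EVU.2 L1 L1L2) _.
    by rewrite (_ : et / 4 = 2 * (et / 8)); [rewrite ler_pM2l|field].
  have iW : I2 rho0 rho1 (- (rho1 / 2)) (rho1 / 2) (fun x y => W x y ^+ N) <= Ka.
    apply: (@le_trans _ _ (I2 rho0 La (- La) La (fun x y => W x y ^+ N))).
      apply: le_I2_sub; [exact: cont2X| |exact: lexx|exact: r1La|by rewrite lerN2|exact: hLa].
      by move=> x y _ _; rewrite exprn_ge0 // (le_trans ler01) // weight1.
    apply: le_trans KaE.
    exact: (weight_integral _ _ _ _ _ _ _ _ M rho0_gt0 D M8 EVU.1 EVU.2 La N rLa RLa CLa (le_trans LaL1 L1L2) e2c).
  have cWN : cont2 (fun x y => W x y ^+ N) by exact: cont2X.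
  have cc2 : cont2 (fun x y => conf u al x y ^+ 2) by exact: cont2X.
  have ca2 : cont2 (fun x y => ang u x y ^+ 2) by exact: cont2X.
  rewrite I2D; [|by solve_cont2|by solve_cont2].
  rewrite (I2Z _ _ _ _ _ _ cWN).
  rewrite [X in _ + X](_ : _ = e^-1 * I2 rho0 rho1 (- (rho1 / 2)) (rho1 / 2) Q); last first.
    by rewrite -(I2Z _ _ _ _ _ _ cQ); apply: eq_I2 => x y _ _; rewrite mulrC.
  rewrite /Q I2D; [|exact: cen|exact: cont2D].
  rewrite (I2D _ _ _ _ _ _ cc2 ca2).
  have {}iW := ler_wpM2l (ltW e0) iW.
  move: vc va ien iW; move: (I2 _ _ _ _ _) (I2 _ _ _ _ _) (I2 _ _ _ _ _) (I2 _ _ _ _ _) => X1 X2 X3 X4 h1 h2 h3 h4.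
  rewrite etE in h1 h2 h3; apply: sum_arith e0 h3 h1 h2 (le_trans h4 eKa).
- move=> x y /andP[rx xr] _ {EVU H}.
  have x0 : 0 < x := lt_le_trans rho0_gt0 rx.
  have W1 : 1 <= W x y by exact: weight1.
  have WM : M <= W x y by exact: weight_ge_M.
  have en0 := energy_ge0 u al x y.
  have x0r : 0 <= x <= rho1 by rewrite (ltW x0).
  have Q0 : 0 <= Q x y by apply: addr_ge0 => //; rewrite addr_ge0 ?sqr_ge0.
  have Y (z : R) : z ^+ 2 <= W x y * Q x y -> `|z| `^ p <= e * W x y ^+ N + Q x y / e.
    by move=> zq; apply: powR_young => //; rewrite real_normK ?num_real.
  have [q1 [q2 q2'] q3 q4 q5] := pointwise_arith (W x y) M (energy u al x y) _ (conf1 u al x y)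
    (conf2 u al x y) (ang u x y) (ang1 u x y) (ang2 u x y) x M8 W1 WM en0
    (M2 x x0r) (M4 x x0r) (sqr_ge0 (conf u al x y)) (conf1_sqr u al M M8 x y) (conf2_sqr u al M M8 x y)
    (ang1_sqr_weight u al M x y (M4 x x0r)) (ang2_sqr_weight u al M x y (M4 x x0r)).
  by split; [exact: Y q1|split; [exact: Y q2|exact: Y q2']|exact: Y q3|exact: Y q4|exact: Y q5].
Qed.

End CoreTheorem.

(** * The divergence theorem on half discs *)

Section Flux.
Context {R : realType}.
Variables (X1 X2 a1 a2 b1 b2 : R -> R -> R).
Hypotheses (CX1 : C1 X1 a1 a2) (CX2 : C1 X2 b1 b2).
Hypothesis X1_axis : forall y, X1 0 y = 0.

(** The outward flux density through the half circle of radius [r], parametrised by the angle [t]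
    from the positive axis: normal [(sin t, cos t)], length element [r dt]. *)
Definition half_flux (Y1 Y2 : R -> R -> R) (r t : R) : R :=
  (Y1 (r * sin t) (r * cos t) * sin t + Y2 (r * sin t) (r * cos t) * cos t) * r.

Let cX1 : cont2 X1. Proof. by case: CX1. Qed.
Let cX2 : cont2 X2. Proof. by case: CX2. Qed.
Let ca1 : cont2 a1. Proof. by case: CX1. Qed.
Let ca2 : cont2 a2. Proof. by case: CX1. Qed.
Let cb2 : cont2 b2. Proof. by case: CX2. Qed.

Lemma continuous_half_flux Y1 Y2 r : cont2 Y1 -> cont2 Y2 -> continuous (half_flux Y1 Y2 r).
Proof.
move=> c1 c2; rewrite /half_flux.
have cs : continuous (fun t : R => r * sin t) by apply: contM; [exact: cont_cst|exact: continuous_sin].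
have cc : continuous (fun t : R => r * cos t) by apply: contM; [exact: cont_cst|exact: continuous_cos].
apply: contM; last exact: cont_cst.
move=> t; apply: (@continuousD _ _ _ (fun t => Y1 (r * sin t) (r * cos t) * sin t)).
  by apply: contM; [exact: (continuous_diag Y1)|exact: continuous_sin].
by apply: contM; [exact: (continuous_diag Y2)|exact: continuous_cos].
Qed.

Section HalfDisc.
Variable r : R.

(* The half disc is swept by [(t, s) |-> (r sin t, s r cos t)], which reduces the
   divergence theorem on it to the one on a rectangle. *)
Let px (t s : R) := r * sin t.
Let py (t s : R) := s * (r * cos t).

Let cx : cont2 px.
Proof. by apply: cont2_dom; apply: contM; [exact: cont_cst|exact: continuous_sin]. Qed.
Let crc : cont2 (fun t _ : R => r * cos t).
Proof. by apply: cont2_dom; apply: contM; [exact: cont_cst|exact: continuous_cos]. Qed.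
Let crs : cont2 (fun t _ : R => r * sin t).
Proof. exact: cx. Qed.
Let cy : cont2 py.
Proof. by apply: cont2M; [exact: cont2_snd|exact: crc]. Qed.
Let cP h : cont2 h -> cont2 (fun t s => h (px t s) (py t s)).
Proof. by move=> ch; exact: cont2_pair. Qed.

Let dsin t : der (fun t => r * sin t) t (r * cos t).
Proof. by apply: der_eq (derM _ _ _ _ _ (der_cst r t) (der_sin t)) _; rewrite mul0r add0r. Qed.
Let dcos t : der (fun t => r * cos t) t (r * - sin t).
Proof. by apply: der_eq (derM _ _ _ _ _ (der_cst r t) (der_cos t)) _; rewrite mul0r add0r. Qed.
Let dpy t s : der (fun t => py t s) t (s * (r * - sin t)).
Proof. by apply: der_eq (derM _ _ _ _ _ (der_cst s t) (dcos t)) _; rewrite mul0r add0r. Qed.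
Let dpys t s : der (py t) s (r * cos t).
Proof.
by apply: der_eq (derM _ _ _ _ _ (der_id s) (der_cst (r * cos t) s)) _; rewrite mul1r mulr0 addr0.
Qed.

(** The Jacobian of the sweep is [(r cos t)^2], and [F], [H] are the components of the pulled back
    field. The side [t = 0] contributes nothing because [X1] vanishes on the axis, the side
    [t = pi / 2] because the sweep degenerates there. The sides [s = 1] and [s = -1] are the two
    quarter circles, the second traversed by [pi - t]; this explains the antiderivative
    [Phi t - Phi (pi - t)]. *)
Lemma half_disc_green :
  I2 0 (pi / 2) (-1) 1 (fun t s =>
    (a1 (px t s) (py t s) + b2 (px t s) (py t s)) * (r * cos t) * (r * cos t)) =
  I1 0 pi (half_flux X1 X2 r).
Proof.
have pi0 : 0 < pi :> R := pi_gt0 R.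
have p2 : 0 <= pi / 2 :> R by rewrite divr_ge0 // ltW.
have m11 : -1 <= 1 :> R by lra.
pose F t s := X1 (px t s) (py t s) * (r * cos t).
pose F1 t s := (a1 (px t s) (py t s) * (r * cos t) + a2 (px t s) (py t s) * (s * - (r * sin t))) * (r * cos t)
  + X1 (px t s) (py t s) * - (r * sin t).
pose H t s := X1 (px t s) (py t s) * (s * (r * sin t)) + X2 (px t s) (py t s) * (r * cos t).
pose H2 t s := a2 (px t s) (py t s) * (r * cos t) * (s * (r * sin t)) + X1 (px t s) (py t s) * (r * sin t)
   + b2 (px t s) (py t s) * (r * cos t) * (r * cos t).
have c1 := cP X1 cX1; have c2 := cP X2 cX2; have c3 := cP a1 ca1.
have c4 := cP a2 ca2; have c5 := cP b2 cb2; have cc := crc; have cs := crs.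
have cF : cont2 F by rewrite /F; solve_cont2.
have cF1 : cont2 F1 by rewrite /F1; solve_cont2.
have cH : cont2 H by rewrite /H; solve_cont2.
have cH2 : cont2 H2 by rewrite /H2; solve_cont2.
rewrite [LHS](_ : _ = I2 0 (pi / 2) (-1) 1 (fun t s => F1 t s + H2 t s)); last first.
  by apply: eq_I2 => t s _ _; rewrite /F1 /H2; ring.
rewrite (green_rectangle 0 (pi / 2) (-1) 1 F F1 H H2 p2 m11 cF cH cF1 cH2); first last.
- move=> t s _ _.
  have [_ _ _ ch1] := CX1; have [_ _ _ ch2] := CX2.
  have d1 := ch1 (fun=> r * sin t) (py t) s _ _ (der_cst _ _) (dpys t s).
  have d2 := ch2 (fun=> r * sin t) (py t) s _ _ (der_cst _ _) (dpys t s).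
  have dl : der (fun s => s * (r * sin t)) s (r * sin t).
    by apply: der_eq (derM _ _ _ _ _ (der_id s) (der_cst (r * sin t) s)) _; rewrite mul1r mulr0 addr0.
  apply: der_eq (derD _ _ _ _ _ (derM _ _ _ _ _ d1 dl) (derM _ _ _ _ _ d2 (der_cst (r * cos t) s))) _.
  by rewrite /H2 /px; ring.
- move=> t s _ _.
  have [_ _ _ ch1] := CX1.
  have d1 := ch1 (fun t => r * sin t) (fun t => py t s) t _ _ (dsin t) (dpy t s).
  apply: der_eq (derM _ _ _ _ _ d1 (dcos t)) _.
  by rewrite /F1 /px; ring.
rewrite [X in X + _](_ : _ = 0); last first.
  rewrite (_ : I1 _ _ _ = I1 (-1) 1 (fun=> 0)); first by rewrite I1_cst // mul0r.
  by apply: eq_I1 => s _; rewrite /F /px sin0 cos_pihalf !mulr0 X1_axis mul0r subrr.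
rewrite add0r.
have cf := continuous_half_flux X1 X2 r cX1 cX2.
have [Phi dPhi] := @antiderivative _ (-1) _ cf.
rewrite (I1_FTC 0 pi _ Phi (ltW pi0) cf); last first.
  by move=> t /andP[t0 _]; apply: dPhi; lra.
pose G t := Phi t - Phi (pi - t).
rewrite (I1_FTC 0 (pi / 2) _ G p2) /G.
- have -> : pi - pi / 2 = pi / 2 :> R by field.
  by rewrite subr0; ring.
- by apply: contB; apply: (cont2_l H).
- move=> t /andP[t0 t1].
  have d1 : der Phi t (half_flux X1 X2 r t) by apply: dPhi; lra.
  have d2 : der Phi (pi - t) (half_flux X1 X2 r (pi - t)) by apply: dPhi; lra.
  have d3 : der (fun t => pi - t) t (0 - 1).
    by apply: derB; [exact: der_cst|exact: der_id].
  apply: der_eq (derB _ _ _ _ _ d1 (der_comp (fun t => pi - t) Phi t _ _ d2 d3)) _.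
  have sp : sin (pi - t) = sin t.
    by rewrite sinD sinN cosN sinpi cospi mul0r add0r mulN1r opprK.
  have cp : cos (pi - t) = - cos t.
    by rewrite cosD sinN cosN sinpi cospi mul0r subr0 mulN1r.
  by rewrite /half_flux sp cp /H /px /py !mul1r !mulN1r !mulrN; ring.
Qed.

(** The box lies in the half disc and the divergence is nonnegative. In the swept coordinates the
    box is reached for [t <= asin (L / r)], and there the half chord [r * cos t] is at least [L],
    because [2 * L <= r]. *)
Lemma box_le_flux L : 0 < L -> 2 * L <= r ->
  (forall x y, 0 <= x -> 0 <= a1 x y + b2 x y) ->
  I2 0 L (- L) L (fun x y => a1 x y + b2 x y) <= I1 0 pi (half_flux X1 X2 r).
Proof.
move=> L0 Lr f0; rewrite -half_disc_green.
have pi0 : 0 < pi :> R := pi_gt0 R.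
have r0 : 0 < r by lra.
have LL : - L <= L by lra.
have m11 : -1 <= 1 :> R by lra.
pose f x y := a1 x y + b2 x y.
have cf : cont2 f by exact: cont2D.
have Lr1 : -1 <= L / r <= 1.
  by apply/andP; split; [apply: le_trans (divr_ge0 (ltW L0) (ltW r0)); lra|rewrite ler_pdivrMr //; lra].
have Lr01 : 0 <= L / r <= 1 by rewrite divr_ge0 ?(ltW L0) ?(ltW r0) //; case/andP: Lr1.
pose t0 := asin (L / r).
have st0 : sin t0 = L / r by rewrite asinK // in_itv.
have t00 : 0 <= t0.
  rewrite leNgt; apply/negP => h.
  have := asin_geNpi2 Lr1; rewrite -/t0 => h2.
  have : sin t0 < 0.
    rewrite -[t0]opprK sinN oppr_lt0; apply: sin_gt0_pi; apply/andP; split; lra.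
  by rewrite st0; have := divr_ge0 (ltW L0) (ltW r0); lra.
have t01 : t0 <= pi / 2 by exact: asin_lepi2.
have ct0 : L <= r * cos t0.
  rewrite cos_asin //.
  have q0 : 0 <= 1 - (L / r) ^+ 2 by rewrite subr_ge0 expr_le1 //; case/andP: Lr01.
  rewrite -(@ler_pXn2r _ 2) ?nnegrE ?mulr_ge0 ?sqrtr_ge0 ?(ltW L0) ?(ltW r0) //.
  rewrite exprMn sqr_sqrtr //.
  have -> : r ^+ 2 * (1 - (L / r) ^+ 2) = r ^+ 2 - L ^+ 2 by field; rewrite gt_eqF.
  have : (2 * L) ^+ 2 <= r ^+ 2 by rewrite lerXn2r ?nnegrE ?mulr_ge0 // ?(ltW L0) ?(ltW r0).
  by have := sqr_ge0 L; rewrite exprMn; lra.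
have ct (t : R) : 0 <= t <= t0 -> L <= r * cos t.
  move=> /andP[h1 h2]; apply: le_trans ct0 _; rewrite ler_pM2l //.
  have [->//|ne] := eqVneq t t0.
  apply: ltW; rewrite ltr_cos ?in_itv /=; first by rewrite lt_neqAle ne.
    by apply/andP; split; lra.
  by apply/andP; split; lra.
have ct2 (t : R) : 0 <= t <= pi / 2 -> 0 <= cos t.
  by move=> /andP[h1 h2]; apply: cos_ge0_pihalf; apply/andP; split; lra.
pose g x := I1 (- L) L (f x).
have cg : continuous g by exact: continuous_I1.
pose K t s := f (px t s) (py t s) * (r * cos t) * (r * cos t).
have cK : cont2 K by apply: cont2M; [apply: cont2M; [exact: cP|exact: crc]|exact: crc].
have K0 (t s : R) : 0 <= t <= pi / 2 -> 0 <= K t s.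
  move=> ht; have c0 : 0 <= r * cos t by rewrite mulr_ge0 ?(ltW r0) // ct2.
  apply: mulr_ge0 => //; apply: mulr_ge0 => //; apply: f0; rewrite mulr_ge0 ?(ltW r0) //.
  by apply: sin_ge0_pi; apply/andP; split; case/andP: ht => *; lra.
apply: (@le_trans _ _ (I2 0 t0 (-1) 1 K)); last first.
  by apply: le_I2_sub => // t s ht _; apply: K0.
have -> : I2 0 L (- L) L f = I1 0 t0 (fun t => g (r * sin t) * (r * cos t)).
  have e0 : r * sin 0 = 0 :> R by rewrite sin0 mulr0.
  have e1 : r * sin t0 = L by rewrite st0 mulrC divfK // gt_eqF.
  have cc : continuous (fun t : R => r * cos t) by apply: contM; [exact: cont_cst|exact: continuous_cos].
  have cs : continuous (fun t : R => r * sin t) by apply: contM; [exact: cont_cst|exact: continuous_sin].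
  have := @I1_subst R 0 t0 (fun t => r * sin t) (fun t => r * cos t) g t00 cg cc.
  rewrite e0 e1 => -> //.
  move=> t /andP[h1 h2]; rewrite mulr_ge0 ?(ltW r0) //.
  by apply: sin_ge0_pi; apply/andP; split; lra.
rewrite I2E; apply: le_I1.
- apply: contM; last by apply: contM; [exact: cont_cst|exact: continuous_cos].
  move=> t; apply: (@continuous_comp _ _ _ (fun t => r * sin t) g); last exact: cg.
  by apply: contM; [exact: cont_cst|exact: continuous_sin].
- exact: continuous_I1.
move=> t ht; have ht' : 0 <= t <= pi / 2 by case/andP: ht => h1 h2; rewrite h1 (le_trans h2).
have c0 : 0 <= r * cos t by rewrite mulr_ge0 ?(ltW r0) // ct2.
have ctL := ct t ht.
have x0 : 0 <= r * sin t.
  by rewrite mulr_ge0 ?(ltW r0) //; apply: sin_ge0_pi; apply/andP; split; case/andP: ht' => *; lra.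
have cfr : continuous (f (r * sin t)) by exact: cont2_r.
have cK' : continuous (fun s : R => f (r * sin t) (s * (r * cos t)) * (r * cos t)).
  by apply: contM; [apply: (continuous_diag f cf (fun=> r * sin t)); [exact: cont_cst|
    apply: contM; [move=> ?; exact: cvg_id|exact: cont_cst]]|exact: cont_cst].
have -> : I1 (-1) 1 (K t) = (r * cos t) * I1 (- (r * cos t)) (r * cos t) (f (r * sin t)).
  rewrite (_ : I1 (-1) 1 (K t) = r * cos t * I1 (-1) 1 (fun s : R => f (r * sin t) (s * (r * cos t)) * (r * cos t))); last first.
    by rewrite -I1Z //; apply: eq_I1 => s _; rewrite /K mulrC.
  congr (_ * _).
  have := @I1_subst R (-1) 1 (fun s : R => s * (r * cos t)) (fun=> r * cos t) (f (r * sin t)) m11 cfr (cont_cst _).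
  rewrite mulN1r mul1r => -> //.
  - by move=> s _; exact: dpys.
  - by apply: contM; [move=> ?; exact: cvg_id|exact: cont_cst].
  - by move=> s /andP[s1 s2]; rewrite -mulN1r ler_wpM2r.
rewrite mulrC ler_wpM2l //.
apply: le_I1_sub => //; first by move=> y _; exact: f0.
by rewrite lerN2.
Qed.

End HalfDisc.
End Flux.

(** * Metrics in cylindrical coordinates *)

Section Differentials.
Context {R : realType}.

Lemma sum3 (V : nmodType) (F : 'I_3 -> V) : \sum_i F i = F crho + F cz + F cphi.
Proof.
rewrite !big_ord_recl big_ord0 addr0 addrA.
by congr (F _ + F _ + F _); exact: val_inj.
Qed.

Lemma ord3P (P : 'I_3 -> Prop) : P crho -> P cz -> P cphi -> forall i, P i.
Proof.
move=> h0 h1 h2 [[|[|[|n]]] lt] //.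
- by rewrite (_ : Ordinal lt = crho) //; exact: val_inj.
- by rewrite (_ : Ordinal lt = cz) //; exact: val_inj.
- by rewrite (_ : Ordinal lt = cphi) //; exact: val_inj.
Qed.

Lemma pd_line n (i : 'I_n.+1) (f : 'rV[R]_n.+1 -> R) x (l : R) :
  der (fun t => f (t *: delta_mx 0 i + x)) 0 l -> pd i f x = l.
Proof.
case=> _ <-; rewrite /pd /derive.
set d := (X in lim (X @ _) = _); set d' := (X in _ = lim (X @ _)).
suff -> : d = d' by [].
apply/funext => h; rewrite /d /d' /= scale0r add0r.
by rewrite [h *: 1](_ : _ = h) ?addr0 // /GRing.scale /= mulr1.
Qed.

Lemma der_curve n (H : 'rV[R]_n.+1 -> R) (c : R -> 'rV[R]_n.+1) t (w : 'I_n.+1 -> R) :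
  differentiable H (c t) -> (forall j, der (fun s => c s 0 j) t (w j)) ->
  der (fun s => H (c s)) t (\sum_j pd j H (c t) * w j).
Proof.
move=> dH dc.
have dcm : derivable c t 1.
  by apply/derivable_mxP => i j; rewrite (ord1 i); have [] := dc j.
have dc1 : differentiable c t by apply/derivable1_diffP.
have dd : differentiable (H \o c) t by exact: differentiable_comp.
apply: DeriveDef; first exact/derivable1_diffP.
rewrite (deriveE _ dd) diff_comp //= -(deriveE _ dc1) derive_mx //.
rewrite [X in 'd H (c t) X](_ : _ = \sum_j w j *: delta_mx 0 j).
  rewrite linear_sum; apply: eq_bigr => j _.
  by rewrite linearZ /= /pd deriveE // mulrC.
apply/rowP => j; rewrite !mxE summxE (bigD1 j) //= !mxE !eqxx mulr1 big1 ?addr0.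
  by have [_ ->] := dc j.
by move=> k kj; rewrite !mxE eqxx eq_sym (negbTE kj) mulr0.
Qed.

Lemma vec3E (a b c : R) : [/\ vec3 a b c 0 crho = a, vec3 a b c 0 cz = b & vec3 a b c 0 cphi = c].
Proof. by split; rewrite mxE. Qed.

Lemma vec2E (a b : R) : vec2 a b 0 hrho = a /\ vec2 a b 0 hz = b.
Proof. by split; rewrite mxE. Qed.

Lemma vec3_eta (x : 'rV[R]_3) : x = vec3 (x 0 crho) (x 0 cz) (x 0 cphi).
Proof. by apply/rowP; apply: ord3P; rewrite mxE. Qed.

Lemma lineE n (i : 'I_n.+1) (x : 'rV[R]_n.+1) (t : R) k :
  (t *: delta_mx 0 i + x) 0 k = t * (k == i)%:R + x 0 k.
Proof. by rewrite !mxE eqxx. Qed.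

Lemma der_shift0 (h : R -> R) (a l : R) : der h a l -> der (fun t => h (t * 1 + a)) 0 l.
Proof.
move=> dh; have d1 : der (fun t : R => t * 1 + a) 0 1.
  apply: der_eq (derD _ _ _ _ _ (derM _ _ _ _ _ (der_id 0) (der_cst 1 0)) (der_cst a 0)) _.
  by rewrite mulr0 !addr0 mulr1.
apply: der_eq (der_comp (fun t => t * 1 + a) h 0 1 l _ d1) _; last by rewrite mulr1.
by rewrite mul0r add0r.
Qed.

(** At Cartesian points the indices [crho], [cz], [cphi] denote the coordinates x, y, z. This is the
    plane y = 0 through the axis, whose half x > 0 is the orbit half-plane. *)
Definition emb (x y : R) : 'rV[R]_3 := vec3 x 0 y.

Lemma smooth_C1 (H : 'rV[R]_3 -> R) : smooth_on setT H ->
  C1 (fun x y => H (emb x y)) (fun x y => pd crho H (emb x y)) (fun x y => pd cphi H (emb x y)).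
Proof.
move=> sH.
have ce (F : 'rV[R]_3 -> R) : (forall x, differentiable F x) -> cont2 (fun x y => F (emb x y)).
  move=> dF z; apply: (@continuous_comp _ _ _ (fun z : R * R => emb z.1 z.2) F); last first.
    exact: differentiable_continuous.
  rewrite (_ : (fun z : R * R => emb z.1 z.2) =
    (fun z => z.1 *: delta_mx 0 crho + z.2 *: delta_mx 0 cphi : 'rV[R]_3)).
    by apply: cvgD; apply: cvgZr_tmp; [exact: cvg_fst|exact: cvg_snd].
  by apply/funext => w; apply/rowP; apply: ord3P; rewrite !mxE /= ?mulr1 ?mulr0 ?addr0 ?add0r.
split.
- by apply: ce => x; exact: (sH [::] x).
- by apply: ce => x; exact: (sH [:: crho] x).
- by apply: ce => x; exact: (sH [:: cphi] x).
move=> c d t c' d' dc dd.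
apply: der_eq (der_curve _ H (fun s => emb (c s) (d s)) t
  (fun j => if j == crho then c' else if j == cphi then d' else 0) (sH [::] _ I) _) _.
  apply: ord3P => /=.
  - by apply: der_ext dc => s; rewrite mxE.
  - by apply: der_ext (der_cst 0 t) => s; rewrite mxE.
  - by apply: der_ext dd => s; rewrite mxE.
by rewrite sum3 /= mulr0 addr0.
Qed.

Lemma smooth_pd (i : 'I_3) (H : 'rV[R]_3 -> R) : smooth_on setT H -> smooth_on setT (pd i H).
Proof.
move=> sH s x _; have := sH (s ++ [:: i]) x I.
by rewrite /pds foldr_cat.
Qed.

Definition smooth_C2 (H : 'rV[R]_3 -> R) (sH : smooth_on setT H) : C2fun :=
  @MkC2fun R _ _ _ _ _ _ _ (smooth_C1 H sH) (smooth_C1 _ (smooth_pd crho H sH))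
    (smooth_C1 _ (smooth_pd cphi H sH)).

Lemma C1_inv (h h1 h2 : R -> R -> R) : C1 h h1 h2 -> (forall x y, 0 < h x y) ->
  C1 (fun x y => (h x y)^-1) (fun x y => - (h x y) ^- 2 * h1 x y)
     (fun x y => - (h x y) ^- 2 * h2 x y).
Proof.
move=> H h0; have [c _ _ _] := H.
have n0 x y : h x y != 0 by rewrite gt_eqF.
apply: (C1_comp (fun s => s^-1) (fun s => - s ^- 2)) => //.
- exact: cont2_inv.
- apply: cont2N; apply: (cont2_inv (fun x y => h x y ^+ 2)); first exact: cont2X.
  by move=> x y; rewrite expf_eq0 /=.
- move=> x y; apply: der_eq (der_inv id _ _ (n0 x y) (der_id _)) _.
  by rewrite mulr1.
Qed.

Lemma C2_ln (h : C2fun) : (forall x y, 0 < val0 h x y) ->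
  exists k : @C2fun R, forall x y, val0 k x y = ln (val0 h x y).
Proof.
move=> h0.
have i1 := C1M _ _ _ _ _ _ (C1_inv _ _ _ (val0_C1 h) h0) (val1_C1 h).
have i2 := C1M _ _ _ _ _ _ (C1_inv _ _ _ (val0_C1 h) h0) (val2_C1 h).
by exists (@MkC2fun R _ _ _ _ _ _ _ (C1_ln _ _ _ (val0_C1 h) h0) i1 i2).
Qed.

Lemma C2_lin (a b : R) (h k : C2fun) :
  exists l : @C2fun R, forall x y, val0 l x y = a * val0 h x y + b * val0 k x y.
Proof.
exists (@MkC2fun R _ _ _ _ _ _ _
  (C1D _ _ _ _ _ _ (C1Z a _ _ _ (val0_C1 h)) (C1Z b _ _ _ (val0_C1 k)))
  (C1D _ _ _ _ _ _ (C1Z a _ _ _ (val1_C1 h)) (C1Z b _ _ _ (val1_C1 k)))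
  (C1D _ _ _ _ _ _ (C1Z a _ _ _ (val2_C1 h)) (C1Z b _ _ _ (val2_C1 k)))).
by [].
Qed.

End Differentials.

(** * Cartesian components of the metric in terms of the potentials *)

Section MetricEntries.
Context {R : realType}.

(** The inverse, off the axis, of the Jacobian [jac_cyl] of cylindrical coordinates; it solves the
    pullback equation for the Cartesian components. *)
Definition frame (x : 'rV[R]_3) : 'M[R]_3 := \matrix_(i, j)
  (nth [::] [:: [:: cos (x 0 cphi); 0; - sin (x 0 cphi) / x 0 crho];
               [:: sin (x 0 cphi); 0; cos (x 0 cphi) / x 0 crho];
               [:: 0; 1; 0]] i)`_j.

Definition jac_cyl (x : 'rV[R]_3) : 'M[R]_3 := \matrix_(i, j)
  (nth [::] [:: [:: cos (x 0 cphi); sin (x 0 cphi); 0];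
               [:: 0; 0; 1];
               [:: - (x 0 crho * sin (x 0 cphi)); x 0 crho * cos (x 0 cphi); 0]] i)`_j.

Lemma differentiable_coord_fun (f : R -> R) (k : 'I_3) (x : 'rV[R]_3) : (forall t, differentiable f t) ->
  differentiable (fun y : 'rV[R]_3 => f (y 0 k)) x.
Proof.
move=> df; apply: (@differentiable_comp _ _ _ _ (fun y : 'rV[R]_3 => y 0 k : R) f); last exact: df.
exact: differentiable_coord.
Qed.

Lemma differentiable_cart (x : 'rV[R]_3) : differentiable (@cart_of_cyl R) x.
Proof.
have dc t : differentiable (@cos R) t by apply/derivable1_diffP; have [] := der_cos t.
have ds t : differentiable (@sin R) t by apply/derivable1_diffP; have [] := der_sin t.
rewrite (_ : @cart_of_cyl R = fun x => ((x 0 crho * cos (x 0 cphi)) *: delta_mx 0 crho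
  + (x 0 crho * sin (x 0 cphi)) *: delta_mx 0 cz) + x 0 cz *: delta_mx 0 cphi); last first.
  by apply/funext => w; apply/rowP; apply: ord3P; rewrite !mxE /= ?mulr1 ?mulr0 ?addr0 ?add0r.
have d0 (k : 'I_3) : differentiable (fun y : 'rV[R]_3 => y 0 k : R) x by exact: differentiable_coord.
apply: differentiableD; last exact/differentiableZl.
apply: differentiableD; apply: differentiableZl; apply: differentiableM => //;
  exact: differentiable_coord_fun.
Qed.

Lemma der_affine (e a : R) : der (fun t : R => t * e + a) 0 e.
Proof.
apply: der_eq (derD _ _ _ _ _ (derM _ _ _ _ _ (der_id 0) (der_cst e 0)) (der_cst a 0)) _.
by rewrite mulr0 !addr0 mul1r.
Qed.

Lemma pd_cart (x : 'rV[R]_3) i j : pd i (fun y => cart_of_cyl y 0 j) x =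
  vec3 ((crho == i)%:R * cos (x 0 cphi) - x 0 crho * sin (x 0 cphi) * (cphi == i)%:R)
    ((crho == i)%:R * sin (x 0 cphi) + x 0 crho * cos (x 0 cphi) * (cphi == i)%:R)
    ((cz == i)%:R) 0 j.
Proof.
apply: pd_line.
have dl k := der_affine (k == i)%:R (x 0 k).
move: j; apply: ord3P; rewrite mxE /=.
- apply: (der_ext (fun t => (t * (crho == i)%:R + x 0 crho) * cos (t * (cphi == i)%:R + x 0 cphi))).
    by move=> t; rewrite /cart_of_cyl mxE /= !lineE.
  apply: der_eq (derM _ _ _ _ _ (dl crho) (der_comp _ cos _ _ _ (der_cos _) (dl cphi))) _.
  by rewrite !mul0r !add0r; ring.
- apply: (der_ext (fun t => (t * (crho == i)%:R + x 0 crho) * sin (t * (cphi == i)%:R + x 0 cphi))).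
    by move=> t; rewrite /cart_of_cyl mxE /= !lineE.
  apply: der_eq (derM _ _ _ _ _ (dl crho) (der_comp _ sin _ _ _ (der_sin _) (dl cphi))) _.
  by rewrite !mul0r !add0r; ring.
- apply: (der_ext (fun t => t * (cz == i)%:R + x 0 cz)); last exact: dl.
  by move=> t; rewrite /cart_of_cyl mxE /= !lineE.
Qed.

Lemma jacobian_cart (x : 'rV[R]_3) : 'J (@cart_of_cyl R) x = jac_cyl x.
Proof.
apply/matrixP => i j.
have dd := differentiable_cart x.
have -> : 'J (@cart_of_cyl R) x i j = pd i (fun y => cart_of_cyl y 0 j) x.
  have /rowP/(_ j) := @deriveEjacobian R _ _ (@cart_of_cyl R) x (delta_mx 0 i) dd.
  rewrite -rowE mxE => <-; rewrite derive_mx ?mxE //.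
  exact: diff_derivable.
rewrite pd_cart !mxE.
by move: i j; apply: ord3P; apply: ord3P; rewrite /=; ring.
Qed.

Lemma frame_jac (x : 'rV[R]_3) : 0 < x 0 crho -> frame x *m jac_cyl x = 1%:M.
Proof.
move=> x0; have cs := cos2Dsin2 (x 0 cphi); have n0 : x 0 crho != 0 by rewrite gt_eqF.
apply/matrixP; apply: ord3P; apply: ord3P; rewrite !mxE sum3 !mxE /=.
all: try by field.
all: by rewrite -cs; field.
Qed.

Lemma metric_frame (g : axisym_metric R) x : off_axis x ->
  metric g (cart_of_cyl x) =
  frame x *m cyl_form (coef_alpha g) (coef_u g) (coef_A g) (coef_B g) x *m (frame x)^T.
Proof.
move=> ox; rewrite -metric_cyl // /pullback jacobian_cart.
have fj := frame_jac x ox.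
rewrite !mulmxA fj mul1mx -[RHS]mulmxA -trmx_mul fj trmx1 mulmx1 //.
Qed.

(** The rotation, by the angle with cosine [c] and sine [s], of the diagonal form with [b] in the
    radial and vertical directions and [a] in the angular one. *)
Definition block_form (c s a b : R) : 'M[R]_3 := \matrix_(i, j)
  (nth [::] [:: [:: c ^+ 2 * b + s ^+ 2 * a; c * s * (b - a); 0];
               [:: c * s * (b - a); s ^+ 2 * b + c ^+ 2 * a; 0];
               [:: 0; 0; b]] i)`_j.

Definition diag3 (a b c : R) : 'M[R]_3 := diag_mx (vec3 a b c).

Lemma cyl_form_diag (al u A B : 'rV[R]_2 -> R) x : A (meridian x) = 0 -> B (meridian x) = 0 ->
  cyl_form al u A B x =
  diag3 (expR (2 * al (meridian x) - 2 * u (meridian x)))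
        (expR (2 * al (meridian x) - 2 * u (meridian x)))
        (x 0 crho ^+ 2 * expR (- 2 * u (meridian x))).
Proof.
move=> A0 B0; rewrite /cyl_form A0 B0.
apply/matrixP; apply: ord3P; apply: ord3P; rewrite !mxE big_ord1 !mxE /=; ring.
Qed.

Lemma metric_block (g : axisym_metric R) (rho z phi : R) : 0 < rho ->
  (forall h, half_plane h -> coef_A g h = 0 /\ coef_B g h = 0) ->
  metric g (vec3 (rho * cos phi) (rho * sin phi) z) =
  block_form (cos phi) (sin phi) (expR (- 2 * coef_u g (vec2 rho z)))
    (expR (2 * coef_alpha g (vec2 rho z) - 2 * coef_u g (vec2 rho z))).
Proof.
move=> rho0 AB; pose x : 'rV[R]_3 := vec3 rho z phi.
have [e0 e1 e2] := vec3E rho z phi.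
have mx : meridian x = vec2 rho z by rewrite /meridian e0 e1.
have ox : off_axis x by rewrite /off_axis /= e0.
have -> : vec3 (rho * cos phi) (rho * sin phi) z = cart_of_cyl x.
  by rewrite /cart_of_cyl e0 e1 e2.
have [|A0 B0] := AB (vec2 rho z); first by rewrite /half_plane /= mxE.
rewrite metric_frame // cyl_form_diag ?mx //.
rewrite /frame e0 e2; have n0 : rho != 0 by rewrite gt_eqF.
apply/matrixP; apply: ord3P; apply: ord3P; rewrite /diag3 mul_mx_diag !mxE sum3 !mxE /=; field.
all: by [].
Qed.

End MetricEntries.

(** * Scalar curvature of diagonal metrics *)

Section Curvature.
Context {R : realType}.

(** Partial derivatives of an axisymmetric function, indexed by the three cylindrical coordinates so
    that they can stand under the sums of the curvature formulas. *)
Definition D3 (h : R -> R -> R) (h' : 'I_3 -> R -> R -> R) : Prop :=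
  forall rho z, 0 < rho ->
  [/\ der (h^~ z) rho (h' crho rho z), der (h rho) z (h' cz rho z) & h' cphi rho z = 0].

Lemma D3_cst c : D3 (fun _ _ => c) (fun _ _ _ => 0).
Proof. by move=> rho z _; split => //; exact: der_cst. Qed.

Lemma D3D h h' k k' : D3 h h' -> D3 k k' ->
  D3 (fun x y => h x y + k x y) (fun n x y => h' n x y + k' n x y).
Proof.
move=> dh dk rho z r0; have [a1 a2 a3] := dh rho z r0; have [b1 b2 b3] := dk rho z r0.
by split; [exact: derD|exact: derD|rewrite a3 b3 addr0].
Qed.

Lemma D3M h h' k k' : D3 h h' -> D3 k k' ->
  D3 (fun x y => h x y * k x y) (fun n x y => h' n x y * k x y + h x y * k' n x y).
Proof.
move=> dh dk rho z r0; have [a1 a2 a3] := dh rho z r0; have [b1 b2 b3] := dk rho z r0.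
by split; [exact: derM|exact: derM|rewrite a3 b3 mul0r mulr0 addr0].
Qed.

Lemma D3_exp h h' : D3 h h' -> D3 (fun x y => expR (h x y)) (fun n x y => expR (h x y) * h' n x y).
Proof.
move=> dh rho z r0; have [a1 a2 a3] := dh rho z r0.
by split; [exact: (der_expR (h^~ z))|exact: (der_expR (h rho))|rewrite a3 mulr0].
Qed.

Lemma D3_ext h h' k k' : D3 h h' -> (forall x y, h x y = k x y) ->
  (forall n x y, 0 < x -> h' n x y = k' n x y) -> D3 k k'.
Proof.
move=> dh e e' rho z r0; have [a1 a2 a3] := dh rho z r0.
split; last by rewrite -e'.
- by rewrite -e' //; apply: der_ext a1 => x; rewrite e.
- by rewrite -e' //; apply: der_ext a2 => x; rewrite e.
Qed.

Lemma near_shift_gt0 (a : R) : 0 < a -> \forall t \near (0 : R), 0 < t * 1 + a.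
Proof.
move=> a0; near=> t; rewrite mulr1 -ltrBlDr sub0r.
near: t; apply: lt_nbhsr; by rewrite oppr_lt0.
Unshelve. all: by end_near. Qed.

Lemma pd_off (F : 'rV[R]_3 -> R) h h' x n :
  (forall y, off_axis y -> F y = h (y 0 crho) (y 0 cz)) -> D3 h h' -> off_axis x ->
  pd n F x = h' n (x 0 crho) (x 0 cz).
Proof.
move=> Fh dh ox; have [a1 a2 a3] := dh (x 0 crho) (x 0 cz) ox.
apply: pd_line; move: n; apply: ord3P.
- apply: der_near (der_shift0 _ _ _ a1).
  near=> t; rewrite Fh ?/off_axis /= !lineE /= ?mulr0 ?add0r //.
  by near: t; exact: near_shift_gt0.
- apply: (der_near (fun t => h (x 0 crho) (t * 1 + x 0 cz))); last exact: der_shift0.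
  near=> t; rewrite Fh ?/off_axis /= !lineE /= ?mulr0 ?add0r //.
- rewrite a3; apply: (der_near (fun t => F x)); last exact: der_cst.
  near=> t; rewrite !Fh ?/off_axis /= ?lineE /= ?mulr0 ?add0r //.
Unshelve. all: by end_near. Qed.

Lemma invmx_diag (d : 'rV[R]_3) (A : 'M[R]_3) : (forall i, 0 < d 0 i) -> A = diag_mx d ->
  invmx A = diag_mx (\row_i (d 0 i)^-1).
Proof.
move=> d0 ->; set B := diag_mx (\row__ _).
have AB : diag_mx d *m B = 1%:M.
  rewrite mulmx_diag; apply/matrixP => i j; rewrite !mxE.
  by case: eqP => // _; rewrite divff // gt_eqF.
have [Au _] := mulmx1_unit AB.
by rewrite -[invmx _]mulmx1 -AB mulmxA mulVmx // mul1mx.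
Qed.

Section Diagonal.
Variables (lam : 'I_3 -> R -> R -> R) (L : 'I_3 -> 'I_3 -> R -> R -> R)
  (LL : 'I_3 -> 'I_3 -> 'I_3 -> R -> R -> R) (F : 'rV[R]_3 -> 'M[R]_3).
Hypothesis dlam : forall k, D3 (lam k) (L k).
Hypothesis dL : forall k m, D3 (L k m) (LL k m).
Hypothesis FE : forall y, off_axis y ->
  F y = diag_mx (\row_i expR (2 * lam i (y 0 crho) (y 0 cz))).

Lemma inv_entry y k l : off_axis y ->
  invmx (F y) k l = (k == l)%:R * expR (-2 * lam k (y 0 crho) (y 0 cz)).
Proof.
move=> oy; rewrite (invmx_diag _ _ _ (FE y oy)).
  rewrite !mxE; case: eqP => [->|_]; last by rewrite mul0r.
  by rewrite mul1r mulNr expRN.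
by move=> i; rewrite mxE expR_gt0.
Qed.

Lemma pd_metric n i j y : off_axis y ->
  pd n (fun y => F y i j) y = (i == j)%:R * (expR (2 * lam i (y 0 crho) (y 0 cz)) *
    (2 * L i n (y 0 crho) (y 0 cz))).
Proof.
move=> oy.
pose h x z := (i == j)%:R * expR (2 * lam i x z).
have dh : D3 h (fun n x z => 0 * expR (2 * lam i x z) + (i == j)%:R *
    (expR (2 * lam i x z) * (0 * lam i x z + 2 * L i n x z))).
  by apply: D3M; [exact: D3_cst|apply: D3_exp; apply: D3M; [exact: D3_cst|exact: dlam]].
rewrite (pd_off _ _ _ _ n _ dh oy); first by rewrite !mul0r !add0r.
move=> y' oy'; rewrite FE // !mxE /h.
by case: eqP => [->|_]; rewrite ?mul1r ?mul0r.
Qed.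

(** Christoffel symbols of the diagonal metric with entries [expR (2 lam_i)]. The Kronecker symbols
    stay numbers, so that one expression covers all index triples and can be differentiated once. *)
Definition gam (k i j : 'I_3) (x z : R) : R :=
  (j == k)%:R * L k i x z + (i == k)%:R * L k j x z
  + - ((i == j)%:R) * (expR (2 * lam i x z + -2 * lam k x z) * L i k x z).

Definition dgam (k i j n : 'I_3) (x z : R) : R :=
  (j == k)%:R * LL k i n x z + (i == k)%:R * LL k j n x z
  + - ((i == j)%:R) * (expR (2 * lam i x z + -2 * lam k x z) *
    ((2 * L i n x z + -2 * L k n x z) * L i k x z + LL i k n x z)).

Lemma christoffelE k i j y : off_axis y ->
  christoffel F k i j y = gam k i j (y 0 crho) (y 0 cz).
Proof.
move=> oy; rewrite /christoffel (bigD1 k) //= big1 ?addr0; last first.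
  by move=> l lk; rewrite inv_entry // eq_sym (negbTE lk) !mul0r.
rewrite inv_entry // eqxx mul1r !pd_metric // /gam.
move: (y 0 crho) (y 0 cz) => x z.
have e1 : expR (-2 * lam k x z) * expR (2 * lam k x z) = 1.
  by rewrite -expRD -mulrDl addNr mul0r expR0.
have e2 : expR (2 * lam i x z + -2 * lam k x z) = expR (-2 * lam k x z) * expR (2 * lam i x z).
  by rewrite expRD mulrC.
have pk m n : (m == k)%:R * (expR (2 * lam m x z) * (2 * L m n x z)) =
    (m == k)%:R * (expR (2 * lam k x z) * (2 * L k n x z)).
  by case: eqP => [->|_]; rewrite ?mul0r.
rewrite e2 pk (pk i).
move: (j == k)%:R (i == k)%:R (i == j)%:R (expR (-2 * lam k x z)) (expR (2 * lam k x z)) e1 => p q r m w e1.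
rewrite (_ : _ * (m * _) = p * ((m * w) * L k i x z) + q * ((m * w) * L k j x z)
  + - r * (m * expR (2 * lam i x z) * L i k x z)); last by field.
by rewrite e1 !mul1r.
Qed.

Lemma D3_gam k i j : D3 (gam k i j) (fun n => dgam k i j n).
Proof.
have c (a : R) h h' : D3 h h' -> D3 (fun x z => a * h x z) (fun n x z => 0 * h x z + a * h' n x z).
  by move=> dh; apply: D3M => //; exact: D3_cst.
apply: (D3_ext _ _ _ _ (D3D _ _ _ _ (D3D _ _ _ _ (c _ _ _ (dL k i)) (c _ _ _ (dL k j)))
  (c _ _ _ (D3M _ _ _ _ (D3_exp _ _ (D3D _ _ _ _ (c 2 _ _ (dlam i)) (c (-2) _ _ (dlam k)))) (dL i k))))).
  by [].
by move=> n x z _; rewrite /dgam; ring.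
Qed.

Lemma pd_christoffel k i j n y : off_axis y ->
  pd n (christoffel F k i j) y = dgam k i j n (y 0 crho) (y 0 cz).
Proof.
by move=> oy; apply: (pd_off _ _ _ _ n _ (D3_gam k i j)) => // y' oy'; exact: christoffelE.
Qed.

Lemma ricciE i y : off_axis y -> let x := y 0 crho in let z := y 0 cz in
  ricci F i i y = \sum_k (dgam k i i k x z - dgam k i k i x z)
    + \sum_k \sum_l (gam k k l x z * gam l i i x z - gam k i l x z * gam l i k x z).
Proof.
move=> oy x z; rewrite /ricci; congr (_ + _).
  by apply: eq_bigr => k _; rewrite !pd_christoffel.
by apply: eq_bigr => k _; apply: eq_bigr => l _; rewrite !christoffelE.
Qed.

Hypothesis lam01 : lam crho = lam cz.
Hypothesis L01 : L crho = L cz.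
Hypothesis LL01 : LL crho = LL cz.
Hypothesis LL0 : forall k m x z, 0 < x -> LL k cphi m x z = 0.

(** The warped product formula: twice the Gauss curvature of the conformally flat orbit metric,
    minus twice the Laplacian of [f] over [f] for [f = expR (lam cphi)], the length of the Killing
    field. *)
Lemma scalar_curvatureE y : off_axis y -> let x := y 0 crho in let z := y 0 cz in
  scalar_curvature F y = expR (-2 * lam cz x z) *
   (-2 * (LL cz crho crho x z + LL cz cz cz x z)
    - 2 * (LL cphi crho crho x z + LL cphi cz cz x z + L cphi crho x z ^+ 2 + L cphi cz x z ^+ 2)).
Proof.
move=> oy x z.
have x0 : 0 < x by exact: oy.
have L0 k : L k cphi x z = 0 by have [_ _ ->] := dlam k x z x0.
have LL0' k m : LL k m cphi x z = 0 by have [_ _ ->] := dL k m x z x0.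
have LL0'' k m := LL0 k m x z x0.
rewrite /scalar_curvature !sum3 !inv_entry // !mul0r !addr0 !add0r !eqxx !mul1r.
rewrite !ricciE // -/x -/z !sum3 /gam /dgam /=.
rewrite ?lam01 ?L01 ?LL01 !L0 !LL0' !LL0''.
have e0 : 2 * lam cz x z + -2 * lam cz x z = 0 by ring.
have e0' : 2 * lam cphi x z + -2 * lam cphi x z = 0 by ring.
rewrite !e0 !e0' expR0.
have E1 : expR (2 * lam cphi x z + -2 * lam cz x z) * expR (-2 * lam cphi x z) = expR (-2 * lam cz x z).
  by rewrite -expRD; congr expR; ring.
rewrite -E1.
move: (expR (2 * lam cphi x z + -2 * lam cz x z)) (expR (-2 * lam cphi x z)) => E ew.
move: (expR (2 * lam cz x z + -2 * lam cphi x z)) => E'.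
ring.
Qed.

End Diagonal.

End Curvature.

(** * Potentials of an axisymmetric metric *)

Section Potentials.
Context {R : realType}.
Variable g : axisym_metric R.
Hypothesis AB : forall h, half_plane h -> coef_A g h = 0 /\ coef_B g h = 0.

Lemma metric_diag_gt0 i x : 0 < metric g x i i.
Proof.
have [_ _ pos] := metric_riemannian g.
have := pos x (delta_mx 0 i); rewrite /inner -rowE trmx_delta -colE !mxE; apply.
by apply/eqP => /rowP/(_ i); rewrite !mxE !eqxx => /eqP; rewrite oner_eq0.
Qed.

Lemma continuous_ge0_at0 (d : R -> R) : continuous d -> (forall x, 0 < x -> 0 <= d x) -> 0 <= d 0.
Proof.
move=> cd d0; rewrite leNgt; apply/negP => dn.
have /nbhs_ballP[e /= e0 he] : \forall t \near (0 : R), d t < 0.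
  exact: (cvgr_lt (d 0) (cd 0)).
have := he (e / 2); rewrite /ball /= sub0r normrN gtr0_norm ?divr_gt0 //.
have lt : e / 2 < e by rewrite ltr_pdivrMr // ltr_pMr // ltr1n.
by move=> /(_ lt); rewrite ltNge d0 // divr_gt0.
Qed.

(** Turning by a right angle exchanges the two Cartesian directions: the xx entry on the y axis
    equals the yy entry on the x axis, both being angular. Smoothness across the axis lets both tend
    to their values there. It excludes conical singularities, that is, alpha vanishes on the
    axis. *)
Lemma metric_axis y : metric g (emb 0 y) crho crho = metric g (emb 0 y) cz cz.
Proof.
have sm i := let: And3 sG _ _ := metric_riemannian g in sG i i.
have cG i (c d : R) : continuous (fun t : R => metric g (vec3 (t * c) (t * d) y) i i).
  move=> t; apply: (@continuous_comp _ _ _ (fun t : R => vec3 (t * c) (t * d) y : 'rV[R]_3) (fun x => metric g x i i)).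
    apply/differentiable_continuous/derivable1_diffP/derivable_mxP => i' j; rewrite (ord1 i').
    have dl (e : R) : derivable (fun t : R => t * e) t 1.
      by have [] := derM _ _ _ _ _ (der_id t) (der_cst e t).
    move: j; apply: ord3P.
    - by rewrite (_ : (fun _ => _) = (fun t => t * c)) //; apply/funext => s; rewrite mxE.
    - by rewrite (_ : (fun _ => _) = (fun t => t * d)) //; apply/funext => s; rewrite mxE.
    - rewrite (_ : (fun _ => _) = (fun=> y)); first by have [] := der_cst y t.
      by apply/funext => s; rewrite mxE.
  exact/differentiable_continuous/(sm i [::]).
have E t : 0 < t -> metric g (vec3 (t * 0) (t * 1) y) crho crho = metric g (vec3 (t * 1) (t * 0) y) cz cz.
  move=> t0; have := metric_block g t y (pi / 2) t0 AB; have := metric_block g t y 0 t0 AB.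
  rewrite cos_pihalf sin_pihalf cos0 sin0 => -> ->.
  by rewrite !mxE.
have z0 (i : 'I_3) (c d : R) : metric g (vec3 (0 * c) (0 * d) y) i i = metric g (emb 0 y) i i.
  by rewrite !mul0r.
apply/eqP; rewrite eq_le; apply/andP; split.
- rewrite -subr_ge0 -(z0 crho 0 1) -(z0 cz 1 0).
  apply: (continuous_ge0_at0 (fun t => metric g (vec3 (t * 1) (t * 0) y) cz cz - metric g (vec3 (t * 0) (t * 1) y) crho crho)).
    exact: contB.
  by move=> t t0; rewrite E // subrr.
- rewrite -subr_ge0 -(z0 crho 0 1) -(z0 cz 1 0).
  apply: (continuous_ge0_at0 (fun t => metric g (vec3 (t * 0) (t * 1) y) crho crho - metric g (vec3 (t * 1) (t * 0) y) cz cz)).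
    exact: contB.
  by move=> t t0; rewrite E // subrr.
Qed.

(** On the plane y = 0 the xx and yy entries are [expR (2 alpha - 2 u)] and [expR (- 2 u)] for x >
    0, and they are smooth and positive on the whole plane; their logarithms give the extensions. *)
Lemma potentials_exist : exists u al : @C2fun R,
  [/\ forall x y, 0 < x -> val0 u x y = coef_u g (vec2 x y),
      forall x y, 0 < x -> val0 al x y = coef_alpha g (vec2 x y)
    & forall y, val0 al 0 y = 0].
Proof.
have sm i := let: And3 sG _ _ := metric_riemannian g in sG i i.
have [k0 k0E] := C2_ln (smooth_C2 _ (sm crho)) (fun x y => metric_diag_gt0 crho (emb x y)).
have [k1 k1E] := C2_ln (smooth_C2 _ (sm cz)) (fun x y => metric_diag_gt0 cz (emb x y)).
have [u uE] := C2_lin (- 2^-1) 0 k1 k1.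
have [al alE] := C2_lin (2^-1) (- 2^-1) k0 k1.
exists u, al.
have B x y : 0 < x -> val0 k0 x y = 2 * coef_alpha g (vec2 x y) - 2 * coef_u g (vec2 x y) /\
    val0 k1 x y = - 2 * coef_u g (vec2 x y).
  move=> x0; have := metric_block g x y 0 x0 AB; rewrite cos0 sin0 mulr1 mulr0.
  rewrite k0E k1E /= /emb => ->; rewrite !mxE /= expr1n expr0n !mul0r !mul1r addr0 add0r.
  by rewrite !expRK.
split.
- by move=> x y x0; have [_ e] := B x y x0; rewrite uE e; field.
- by move=> x y x0; have [e e'] := B x y x0; rewrite alE e e'; field.
- by move=> y; rewrite alE k0E k1E /= metric_axis; ring.
Qed.

Lemma vec2_eta (w : 'rV[R]_2) : w = vec2 (w 0 hrho) (w 0 hz).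
Proof.
apply/rowP => -[[|[|n]] lt] //; rewrite mxE /=; congr (w 0 _); exact: val_inj.
Qed.

Lemma pd_half (f : 'rV[R]_2 -> R) h h1 h2 x y : C1 h h1 h2 ->
  (forall x y, 0 < x -> f (vec2 x y) = h x y) -> 0 < x ->
  pd hrho f (vec2 x y) = h1 x y /\ pd hz f (vec2 x y) = h2 x y.
Proof.
move=> Ch fh x0; have [e0 e1] := vec2E x y; split; apply: pd_line.
- apply: der_near (der_shift0 _ _ _ (C1_der1 _ _ _ x y Ch)).
  near=> t; rewrite [t *: _ + _]vec2_eta !lineE e0 e1 /= mulr0 add0r fh //.
  by near: t; exact: near_shift_gt0.
- apply: der_ext (der_shift0 _ _ _ (C1_der2 _ _ _ x y Ch)) => t.
  by rewrite [t *: _ + _]vec2_eta !lineE e0 e1 /= mulr0 add0r fh.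
Unshelve. all: by end_near. Qed.

Variables (u al : @C2fun R).
Hypothesis uE : forall x y, 0 < x -> val0 u x y = coef_u g (vec2 x y).
Hypothesis alE : forall x y, 0 < x -> val0 al x y = coef_alpha g (vec2 x y).

Lemma decay_potentials (C R0 x y r : R) :
  (forall (s : seq 'I_2) x, (size s <= 2)%N -> half_plane x -> R0 <= enorm x ->
    [/\ `|pds s (coef_u g) x| <= C / enorm x ^+ (1 + size s),
        `|pds s (coef_alpha g) x| <= C / enorm x ^+ (1 + size s),
        `|pds s (coef_A g) x| <= C / enorm x ^+ (1 + size s)
      & `|pds s (coef_B g) x| <= C / enorm x ^+ (1 + size s)]) ->
  0 < x -> 0 < r -> R0 <= r -> r ^+ 2 = x ^+ 2 + y ^+ 2 ->
    [/\ `|val0 u x y| <= C / r, `|val0 al x y| <= C / r,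
        `|val1 u x y| <= C / r ^+ 2 /\ `|val2 u x y| <= C / r ^+ 2
      & `|val1 al x y| <= C / r ^+ 2 /\ `|val2 al x y| <= C / r ^+ 2].
Proof.
move=> H x0 r0 Rr r2.
have nE : enorm (vec2 x y) = r.
  rewrite /enorm !big_ord_recl big_ord0 addr0 !mxE /= -r2.
  by rewrite sqrtr_sqr gtr0_norm.
have hp : half_plane (vec2 x y) by rewrite /half_plane /= mxE.
have RE : R0 <= enorm (vec2 x y) by rewrite nE.
have [a1 a2 _ _] := H [::] _ isT hp RE.
have [b1 b2 _ _] := H [:: hrho] _ isT hp RE.
have [c1 c2 _ _] := H [:: hz] _ isT hp RE.
move: a1 a2 b1 b2 c1 c2; rewrite /pds /= nE /= !expr1.
have [-> ->] := pd_half _ _ _ _ x y (val0_C1 u) (fun x y x0 => esym (uE x y x0)) x0.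
have [-> ->] := pd_half _ _ _ _ x y (val0_C1 al) (fun x y x0 => esym (alE x y x0)) x0.
by rewrite -(uE _ _ x0) -(alE _ _ x0).
Qed.

Let lam (k : 'I_3) (x z : R) : R :=
  if k == cphi then ln x + -1 * val0 u x z else val0 al x z + -1 * val0 u x z.
Let L (k m : 'I_3) (x z : R) : R :=
  if k == cphi then
    (if m == crho then x^-1 + -1 * val1 u x z else if m == cz then -1 * val2 u x z else 0)
  else
    (if m == crho then val1 al x z + -1 * val1 u x z
     else if m == cz then val2 al x z + -1 * val2 u x z else 0).
Let LL (k m n : 'I_3) (x z : R) : R :=
  if k == cphi then
    (if m == crho then
       (if n == crho then - x ^- 2 + -1 * val11 u x z else if n == cz then -1 * val12 u x z else 0)
     else if m == cz then
       (if n == crho then -1 * val21 u x z else if n == cz then -1 * val22 u x z else 0)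
     else 0)
  else
    (if m == crho then
       (if n == crho then val11 al x z + -1 * val11 u x z
        else if n == cz then val12 al x z + -1 * val12 u x z else 0)
     else if m == cz then
       (if n == crho then val21 al x z + -1 * val21 u x z
        else if n == cz then val22 al x z + -1 * val22 u x z else 0)
     else 0).

Let C1_D3 (h h1 h2 : R -> R -> R) : C1 h h1 h2 ->
  D3 h (fun n x z => if n == crho then h1 x z else if n == cz then h2 x z else 0).
Proof. by move=> Ch x z _; split => //=; [exact: C1_der1 Ch|exact: C1_der2 Ch]. Qed.

Let C1_sub (h h1 h2 k k1 k2 : R -> R -> R) : C1 h h1 h2 -> C1 k k1 k2 ->
  C1 (fun x y => h x y + -1 * k x y) (fun x y => h1 x y + -1 * k1 x y) (fun x y => h2 x y + -1 * k2 x y).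
Proof. by move=> Ch Ck; apply: C1D => //; exact: C1Z. Qed.

Let D3_lam k : D3 (lam k) (L k).
Proof.
have h0 := C1_D3 _ _ _ (C1_sub _ _ _ _ _ _ (val0_C1 al) (val0_C1 u)).
move: k; apply: ord3P; [exact: h0|exact: h0|].
move=> x z x0; have Cu := val0_C1 u; split => //=.
- apply: derD; first exact: is_derive1_ln.
  by apply: (C1_der1 _ _ _ x z (C1Z (-1) _ _ _ Cu)).
- rewrite /lam /L /=; apply: der_eq (derD _ _ _ _ _ (der_cst (ln x) z) (C1_der2 _ _ _ x z (C1Z (-1) _ _ _ Cu))) _.
  by rewrite add0r.
Qed.

Let D3_L k m : D3 (L k m) (LL k m).
Proof.
have h1 := C1_D3 _ _ _ (C1_sub _ _ _ _ _ _ (val1_C1 al) (val1_C1 u)).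
have h2 := C1_D3 _ _ _ (C1_sub _ _ _ _ _ _ (val2_C1 al) (val2_C1 u)).
have u2 := C1_D3 _ _ _ (C1Z (-1) _ _ _ (val2_C1 u)).
move: k m; apply: ord3P; apply: ord3P; try exact: D3_cst; try exact: h1; try exact: h2; try exact: u2.
move=> x z x0; have Cu := val1_C1 u; split => //=.
- have n0 : id x != 0 by rewrite gt_eqF.
  apply: derD; first by apply: der_eq (der_inv id _ _ n0 (der_id x)) _; rewrite mulr1.
  by apply: (C1_der1 _ _ _ x z (C1Z (-1) _ _ _ Cu)).
- rewrite /L /LL /=; apply: der_eq (derD _ _ _ _ _ (der_cst (x^-1) z) (C1_der2 _ _ _ x z (C1Z (-1) _ _ _ Cu))) _.
  by rewrite add0r.
Qed.

Lemma meridian_half (y : 'rV[R]_3) : off_axis y -> half_plane (meridian y).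
Proof. by rewrite /half_plane /meridian /= mxE. Qed.

Lemma cyl_metric_off (y : 'rV[R]_3) : off_axis y ->
  cyl_metric g y = diag3 (expR (2 * val0 al (y 0 crho) (y 0 cz) - 2 * val0 u (y 0 crho) (y 0 cz)))
    (expR (2 * val0 al (y 0 crho) (y 0 cz) - 2 * val0 u (y 0 crho) (y 0 cz)))
    (y 0 crho ^+ 2 * expR (- 2 * val0 u (y 0 crho) (y 0 cz))).
Proof.
move=> oy; have [A0 B0] := AB _ (meridian_half y oy).
by rewrite /cyl_metric cyl_form_diag // uE // alE.
Qed.

Lemma cyl_metric_exp (y : 'rV[R]_3) : off_axis y ->
  cyl_metric g y = diag_mx (\row_i expR (2 * lam i (y 0 crho) (y 0 cz))).
Proof.
move=> oy; rewrite cyl_metric_off // /diag3; congr diag_mx.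
apply/rowP; apply: ord3P; rewrite !mxE /lam /=.
- by congr expR; ring.
- by congr expR; ring.
- by rewrite mulrDr expRD expRM_natl lnK ?posrE //; congr (_ * expR _); ring.
Qed.

(** The exponent of the angular entry is [ln x - u]. In the curvature the second derivative of
    [ln x] cancels the square of its first one, and the cross term leaves [val1 u / x], the
    first-order term of the density. *)
Lemma density_scalar (x z : R) : nonneg_scalar_curvature g -> 0 < x ->
  2 * x * (val1 u x z ^+ 2 + val2 u x z ^+ 2) <= mass_density u al x z.
Proof.
move=> sc x0; have [e0 e1 e2] := vec3E x z 0.
have oy : off_axis (vec3 x z 0) by rewrite /off_axis /= e0.
have := scalar_curvatureE lam L LL (cyl_metric g) D3_lam D3_L cyl_metric_exp erefl erefl erefl _ _ oy.
rewrite e0 e1 => sE; have := sc _ oy; rewrite sE; last first.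
  by move=> k m x' z' _; move: k m; apply: ord3P; apply: ord3P.
rewrite pmulr_rge0 ?expR_gt0 // /L /LL /= => s0.
rewrite -subr_ge0.
suff -> : mass_density u al x z - 2 * x * (val1 u x z ^+ 2 + val2 u x z ^+ 2) =
  x * (-2 * (val11 al x z + -1 * val11 u x z + (val22 al x z + -1 * val22 u x z)) -
   2 * (- x ^- 2 + -1 * val11 u x z + -1 * val22 u x z + (x^-1 + -1 * val1 u x z) ^+ 2 +
    (-1 * val2 u x z) ^+ 2)) by exact: mulr_ge0 (ltW x0) s0.
by rewrite /mass_density; field; rewrite gt_eqF.
Qed.

Lemma inner_diag3 (a b c : R) (A : 'rV[R]_3 -> 'M[R]_3) y (v : 'rV[R]_3) : A y = diag3 a b c ->
  inner A y v v = a * v 0 crho ^+ 2 + b * v 0 cz ^+ 2 + c * v 0 cphi ^+ 2.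
Proof.
move=> e; rewrite /inner e /diag3 mul_mx_diag mxE sum3 !mxE /=; ring.
Qed.

(** This is the origin of [v = alpha - 2 u]: the Killing field has length [rho * expR (- u)] and the
    gradient of rho has length [expR (u - alpha)]. *)
Lemma radial_ratio (y : 'rV[R]_3) : off_axis y ->
  (y 0 crho)^-1 * (Defs.gnorm (cyl_metric g) y killing
       / Defs.gnorm (cyl_metric g) y (Defs.grad (cyl_metric g) (fun y' => y' 0 crho) y)) =
  expR (vv u al (y 0 crho) (y 0 cz)).
Proof.
move=> oy; have e := cyl_metric_off y oy; move: (y 0 crho) (y 0 cz) (oy : 0 < y 0 crho) e => x z x0 e.
have gk : Defs.gnorm (cyl_metric g) y killing = x * expR (- val0 u x z).
  rewrite /Defs.gnorm (inner_diag3 _ _ _ _ _ _ e) !mxE /= !expr0n !mulr0 !add0r expr1n mulr1.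
  have -> : x ^+ 2 * expR (- 2 * val0 u x z) = (x * expR (- val0 u x z)) ^+ 2.
    by rewrite exprMn -expRM_natl mulrN mulNr.
  by rewrite sqrtr_sqr ger0_norm // mulr_ge0 ?expR_ge0 // ltW.
have pdE : \row_i pd i (fun y' : 'rV[R]_3 => y' 0 crho) y = delta_mx 0 crho.
  apply/rowP => i; rewrite !mxE eqxx /=; apply: pd_line.
  apply: (der_ext (fun t => t * (crho == i)%:R + y 0 crho)); first by move=> t; rewrite lineE.
  by rewrite eq_sym; exact: der_affine.
have gg : Defs.gnorm (cyl_metric g) y (Defs.grad (cyl_metric g) (fun y' => y' 0 crho) y) =
    expR (- (val0 al x z - val0 u x z)).
  rewrite /Defs.gnorm (inner_diag3 _ _ _ _ _ _ e) /Defs.grad pdE.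
  rewrite (invmx_diag _ _ _ e); last first.
    by apply: ord3P; rewrite mxE /= ?mulr_gt0 ?exprn_gt0 ?expR_gt0.
  rewrite mul_mx_diag !mxE /= !mul0r !expr0n !mulr0 !addr0 mul1r.
  rewrite -expRN -expRM_natl -expRD.
  have -> : 2 * val0 al x z - 2 * val0 u x z + 2 * - (2 * val0 al x z - 2 * val0 u x z) =
    2 * - (val0 al x z - val0 u x z) by ring.
  by rewrite expRM_natl sqrtr_sqr ger0_norm // expR_ge0.
rewrite gk gg -expRN mulrA mulrA mulVf ?gt_eqF // mul1r -expRD; congr expR.
by rewrite /vv; ring.
Qed.

Lemma mono_potentials (rho0 : R) (y : R) : 0 < rho0 ->
  (forall x : 'rV[R]_3, x 0 crho = rho0 ->
    pd crho (fun y => (y 0 crho)^-1 *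
      (Defs.gnorm (cyl_metric g) y killing
       / Defs.gnorm (cyl_metric g) y
           (Defs.grad (cyl_metric g) (fun y' => y' 0 crho) y))) x <= 0) ->
  val1 al rho0 y - 2 * val1 u rho0 y <= 0.
Proof.
move=> r0 /(_ (vec3 rho0 y 0)); have [e0 e1 e2] := vec3E rho0 y 0; rewrite e0 => /(_ erefl).
have dv : D3 (fun x z => expR (vv u al x z)) _ := D3_exp _ _ (C1_D3 _ _ _ (vv_C1 u al)).
rewrite (pd_off _ _ _ _ crho radial_ratio dv) ?/off_axis /= ?e0 // e1.
by rewrite pmulr_rle0 ?expR_gt0 // /vv1 mulNr.
Qed.

End Potentials.

(** * The ADM flux *)

Section AdmFlux.
Context {R : realType}.
Variable g : axisym_metric R.
Hypothesis AB : forall h, half_plane h -> coef_A g h = 0 /\ coef_B g h = 0.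
Variables (u al : @C2fun R).
Hypothesis uE : forall x y, 0 < x -> val0 u x y = coef_u g (vec2 x y).
Hypothesis alE : forall x y, 0 < x -> val0 al x y = coef_alpha g (vec2 x y).
Hypothesis al_axis : forall y, val0 al 0 y = 0.

Lemma polar_angle (p q : R) : 0 < p ^+ 2 + q ^+ 2 -> exists phi : R,
  p = Num.sqrt (p ^+ 2 + q ^+ 2) * cos phi /\ q = Num.sqrt (p ^+ 2 + q ^+ 2) * sin phi.
Proof.
move=> s0; set rho := Num.sqrt _.
have r0 : 0 < rho by rewrite sqrtr_gt0.
have r2 : rho ^+ 2 = p ^+ 2 + q ^+ 2 by rewrite sqr_sqrtr // ltW.
have p1 : -1 <= p / rho <= 1.
  rewrite -ler_norml normrM normfV (gtr0_norm r0) ler_pdivrMr // mul1r.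
  rewrite -(@ler_pXn2r _ 2) ?nnegrE ?(ltW r0) // real_normK ?num_real // r2 lerDl.
  exact: sqr_ge0.
have cE : rho * cos (acos (p / rho)) = p.
  by rewrite acosK ?in_itv //= mulrC divfK // gt_eqF.
have sE : rho * sin (acos (p / rho)) = `|q|.
  have n0 : rho != 0 by rewrite gt_eqF.
  have sr0 : 0 <= rho * sin (acos (p / rho)).
    by rewrite mulr_ge0 ?(ltW r0) // sin_acos // sqrtr_ge0.
  rewrite -[LHS]ger0_norm // -!sqrtr_sqr; congr Num.sqrt.
  rewrite exprMn sin2cos2 mulrBr mulr1 -exprMn cE r2; ring.
have [q0|q0] := leP 0 q.
  by exists (acos (p / rho)); rewrite cE sE ger0_norm.
exists (- acos (p / rho)); rewrite cosN sinN cE mulrN sE ltr0_norm // opprK.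
by [].
Qed.

Let A x z := expR (-2 * val0 u x z).
Let A1 x z := expR (-2 * val0 u x z) * (-2 * val1 u x z).
Let A2 x z := expR (-2 * val0 u x z) * (-2 * val2 u x z).
Let B x z := expR (2 * val0 al x z + -2 * val0 u x z).
Let B1 x z := expR (2 * val0 al x z + -2 * val0 u x z) * (2 * val1 al x z + -2 * val1 u x z).
Let B2 x z := expR (2 * val0 al x z + -2 * val0 u x z) * (2 * val2 al x z + -2 * val2 u x z).

Let CA : C1 A A1 A2.
Proof. by apply: C1_exp; apply: C1Z; exact: val0_C1. Qed.
Let CB : C1 B B1 B2.
Proof. by apply: C1_exp; apply: C1D; apply: C1Z; exact: val0_C1. Qed.

(** The tensor of [block_form] without the angle, rational in the Cartesian coordinates [p], [q] and
    [s = p^2 + q^2], hence easily differentiated along coordinate lines. *)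
Definition planar (a b s p q : R) : 'M[R]_3 := \matrix_(i, j)
  (nth [::] [:: [:: a + (b - a) / s * (p * p); (b - a) / s * (p * q); 0];
               [:: (b - a) / s * (p * q); a + (b - a) / s * (q * q); 0];
               [:: 0; 0; b]] i)`_j.

Lemma metric_planar (y : 'rV[R]_3) : let s := y 0 crho ^+ 2 + y 0 cz ^+ 2 in 0 < s ->
  metric g y = planar (A (Num.sqrt s) (y 0 cphi)) (B (Num.sqrt s) (y 0 cphi)) s (y 0 crho) (y 0 cz).
Proof.
move=> s s0; have [phi] := polar_angle _ _ s0; rewrite -/s => -[pE qE].
set rho := Num.sqrt s in pE qE *.
have r0 : 0 < rho by rewrite sqrtr_gt0.
have r2 : s = rho ^+ 2 by rewrite sqr_sqrtr // ltW.
rewrite {1}(vec3_eta y) pE qE metric_block // /A /B uE // alE // r2.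
have n0 : rho != 0 by rewrite gt_eqF.
have cs := cos2Dsin2 phi.
have ss : sin phi ^+ 2 = 1 - cos phi ^+ 2 by rewrite -cs; ring.
set a := expR (-2 * _); set b := expR (2 * _ - _).
have -> : expR (2 * coef_alpha g (vec2 rho (y 0 cphi)) + -2 * coef_u g (vec2 rho (y 0 cphi))) = b.
  by rewrite /b mulNr.
have h (c d : R) : (b - a) / rho ^+ 2 * (rho * c * (rho * d)) = (b - a) * (c * d) by field.
apply/matrixP; apply: ord3P; apply: ord3P; rewrite !mxE /= ?h //.
- by rewrite ss; ring.
- by ring.
- by ring.
- by rewrite -expr2 ss; ring.
Qed.

Section PointDerivatives.
Variable y : 'rV[R]_3.
Let p := y 0 crho.
Let q := y 0 cz.
Let z := y 0 cphi.
Let s := p ^+ 2 + q ^+ 2.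
Let rho := Num.sqrt s.
Hypothesis s0 : 0 < s.
Variable k : 'I_3.
Let e (m : 'I_3) : R := (m == k)%:R.
Let yt (m : 'I_3) (t : R) := t * e m + y 0 m.
Let st t := yt crho t ^+ 2 + yt cz t ^+ 2.
Let ds := 2 * (p * e crho + q * e cz).
Let dr := (2 * rho)^-1 * ds.

Let yt0 m : yt m 0 = y 0 m. Proof. by rewrite /yt mul0r add0r. Qed.
Let dyt m : der (yt m) 0 (e m). Proof. exact: der_affine. Qed.

Let dst : der st 0 ds.
Proof.
have d m : der (fun t => yt m t ^+ 2) 0 (2 * (y 0 m * e m)).
  by apply: der_eq (derM _ _ _ _ _ (dyt m) (dyt m)) _; rewrite yt0; ring.
by apply: der_eq (derD _ _ _ _ _ (d crho) (d cz)) _; rewrite /ds mulrDr.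
Qed.

Let st0 : st 0 = s. Proof. by rewrite /st !yt0. Qed.

Let drt : der (fun t => Num.sqrt (st t)) 0 dr.
Proof. by apply: der_eq (der_sqrt st 0 _ _ dst) _; rewrite ?st0. Qed.

Let dC (F F1 F2 : R -> R -> R) : C1 F F1 F2 ->
  der (fun t => F (Num.sqrt (st t)) (yt cphi t)) 0 (F1 rho z * dr + F2 rho z * e cphi).
Proof.
move=> [_ _ _ dF]; apply: der_eq (dF _ _ _ _ _ drt (dyt cphi)) _.
by rewrite yt0 st0.
Qed.

Let dA := A1 rho z * dr + A2 rho z * e cphi.
Let dB := B1 rho z * dr + B2 rho z * e cphi.
Let c := (B rho z - A rho z) / s.
Let dc := (dB - dA) / s + (B rho z - A rho z) * - (s ^- 2 * ds).

Let At t := A (Num.sqrt (st t)) (yt cphi t).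
Let Bt t := B (Num.sqrt (st t)) (yt cphi t).

Let dct : der (fun t => (Bt t - At t) / st t) 0 dc.
Proof.
have n0 : st 0 != 0 by rewrite st0 gt_eqF.
apply: der_eq (derM _ _ _ _ _ (derB _ _ _ _ _ (dC _ _ _ CB) (dC _ _ _ CA)) (der_inv st 0 _ n0 dst)) _.
by rewrite /Bt /At yt0 st0.
Qed.

Let pdE i j (h : R -> R) l : (forall t, 0 < st t ->
    planar (At t) (Bt t) (st t) (yt crho t) (yt cz t) i j = h t) -> der h 0 l ->
  pd k (fun y => metric g y i j) y = l.
Proof.
move=> hE dh; apply: pd_line; apply: der_near dh.
near=> t; rewrite metric_planar !lineE -/(yt _ _) -?/(st t) -?hE //.
- near: t; apply: (cvgr_gt (st 0)); last by rewrite st0.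
  exact: der_continuous dst.
- near: t; apply: (cvgr_gt (st 0)); last by rewrite st0.
  exact: der_continuous dst.
Unshelve. all: by end_near. Qed.

Let dquad m n : der (fun t => (Bt t - At t) / st t * (yt m t * yt n t)) 0
  (dc * (y 0 m * y 0 n) + c * (e m * y 0 n + y 0 m * e n)).
Proof.
apply: der_eq (derM _ _ _ _ _ dct (derM _ _ _ _ _ (dyt m) (dyt n))) _.
by rewrite !yt0 /Bt /At yt0 st0.
Qed.

Lemma pd_metric_entries :
  [/\ pd k (fun y => metric g y crho crho) y = dA + (dc * (p * p) + c * (e crho * p + p * e crho)),
      pd k (fun y => metric g y cz cz) y = dA + (dc * (q * q) + c * (e cz * q + q * e cz)),
      pd k (fun y => metric g y crho cz) y = dc * (p * q) + c * (e crho * q + p * e cz) /\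
      pd k (fun y => metric g y cz crho) y = dc * (p * q) + c * (e crho * q + p * e cz),
      pd k (fun y => metric g y cphi cphi) y = dB
    & (pd k (fun y => metric g y crho cphi) y = 0 /\ pd k (fun y => metric g y cz cphi) y = 0) /\
      (pd k (fun y => metric g y cphi crho) y = 0 /\ pd k (fun y => metric g y cphi cz) y = 0)].
Proof.
split.
- apply: (pdE _ _ (fun t => At t + (Bt t - At t) / st t * (yt crho t * yt crho t))).
    by move=> t _; rewrite mxE.
  by apply: derD; [exact: dC CA|exact: dquad].
- apply: (pdE _ _ (fun t => At t + (Bt t - At t) / st t * (yt cz t * yt cz t))).
    by move=> t _; rewrite mxE.
  by apply: derD; [exact: dC CA|exact: dquad].
- split; apply: (pdE _ _ (fun t => (Bt t - At t) / st t * (yt crho t * yt cz t))).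
  + by move=> t _; rewrite mxE.
  + exact: dquad.
  + by move=> t _; rewrite mxE.
  + exact: dquad.
- apply: (pdE _ _ Bt); first by move=> t _; rewrite mxE.
  exact: dC CB.
- by split; split; apply: (pdE _ _ (fun=> 0)); try exact: der_cst; move=> t _; rewrite mxE.
Qed.

End PointDerivatives.

(* With [a = exp (-2 u)] and [b = exp (2 al - 2 u)], the ADM integrand is the
   normal component of [- grad (a + b) + ((b - a) / rho) e_rho]; the factor
   [rho] comes from the area element. *)
Definition adm1 (v a : @C2fun R) (x z : R) : R :=
  expR (2 * val0 a x z + -2 * val0 v x z) - expR (-2 * val0 v x z)
  - x * (expR (-2 * val0 v x z) * (-2 * val1 v x z)
         + expR (2 * val0 a x z + -2 * val0 v x z) * (2 * val1 a x z + -2 * val1 v x z)).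
Definition adm2 (v a : @C2fun R) (x z : R) : R :=
  - x * (expR (-2 * val0 v x z) * (-2 * val2 v x z)
         + expR (2 * val0 a x z + -2 * val0 v x z) * (2 * val2 a x z + -2 * val2 v x z)).

(** The poles are treated apart, the polar form of the metric being singular on the axis; there the
    area element and the half flux both vanish. *)
Lemma adm_integrand (r theta phi : R) x : 0 < r -> 0 <= theta <= pi ->
  x = cart_of_sph r theta phi ->
  (\sum_i \sum_j
     (pd j (fun y => metric g y i j) x - pd i (fun y => metric g y j j) x)
     * (x 0 i / r)) * (r ^+ 2 * sin theta) = half_flux (adm1 u al) (adm2 u al) r theta.
Proof.
move=> r0 th xE.
have sth : 0 <= sin theta by exact: sin_ge0_pi.
have [s0|sth0] := eqVneq (sin theta) 0.
  rewrite s0 !mulr0 /half_flux /adm1 /adm2 s0 !mulr0 al_axis.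
  by rewrite oppr0 !mul0r addr0 mul0r.
have {sth sth0}sth : 0 < sin theta by rewrite lt_def sth0.
have [x0 x1 x2] : [/\ x 0 crho = r * sin theta * cos phi, x 0 cz = r * sin theta * sin phi
   & x 0 cphi = r * cos theta] by rewrite xE; exact: vec3E.
have cs := cos2Dsin2 phi.
have rs0 : 0 < r * sin theta by rewrite mulr_gt0.
have sE : x 0 crho ^+ 2 + x 0 cz ^+ 2 = (r * sin theta) ^+ 2.
  by rewrite x0 x1 !exprMn -mulrDr cs mulr1.
have s0 : 0 < x 0 crho ^+ 2 + x 0 cz ^+ 2 by rewrite sE exprn_gt0.
have rE : Num.sqrt (x 0 crho ^+ 2 + x 0 cz ^+ 2) = r * sin theta.
  by rewrite sE sqrtr_sqr gtr0_norm.
rewrite !sum3.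
have [a1 a2 [a3 a4] a5 [[a6 a7] [a8 a9]]] := pd_metric_entries x s0 crho.
have [b1 b2 [b3 b4] b5 [[b6 b7] [b8 b9]]] := pd_metric_entries x s0 cz.
have [c1 c2 [c3 c4] c5 [[c6 c7] [c8 c9]]] := pd_metric_entries x s0 cphi.
rewrite a1 a2 a4 a5 a8 b1 b2 b3 b5 b9 c1 c2 c5 c6 c7 /= !rE sE x0 x1 x2 !(eqxx, mulr0, mulr1).
rewrite /half_flux /adm1 /adm2 /A1 /A2 /B1 /B2 /A /B.
move: (expR (-2 * _)) (expR (2 * _ + _)) => EA EB.
move: (val1 u _ _) (val2 u _ _) (val1 al _ _) (val2 al _ _) => u1 u2 l1 l2.
have n1 : r != 0 by rewrite gt_eqF.
have n2 : sin theta != 0 by rewrite gt_eqF.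
set lhs := (X in X = _); set rhs := (X in _ = X).
(* [field] treats the cosine and the sine of [phi] as independent, so the two sides are compared up
   to an explicit multiple of the relation between them. *)
have -> : lhs = rhs + (cos phi ^+ 2 + sin phi ^+ 2 - 1) *
    ((sin theta * ((EB - EA) / (r * sin theta) - (EA * (-2 * u1) + EB * (2 * l1 + -2 * u1)))
      - cos theta * (EB * (2 * l2 + -2 * u2) - EA * (-2 * u2))) * (r ^+ 2 * sin theta)).
  by rewrite /lhs /rhs; field; rewrite n1 n2.
by rewrite cs subrr mul0r addr0.
Qed.

(** The integrand does not depend on [phi], so the outer integral contributes [2 pi], and
    [2 pi / (16 pi) = 1 / 8]. *)
Lemma adm_fluxE (r : R) : 0 < r ->
  adm_flux (metric g) r = 8^-1 * I1 0 pi (half_flux (adm1 u al) (adm2 u al) r).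
Proof.
move=> r0; rewrite /adm_flux.
set h := I1 0 pi _.
rewrite [X in _ * X](_ : _ = I1 0 (2 * pi) (fun=> h)); last first.
  apply: eq_I1 => phi _; apply: eq_I1 => theta th.
  exact: adm_integrand.
have p0 : 0 < pi :> R := pi_gt0 R.
rewrite I1_cst ?mulr_ge0 ?(ltW p0) // subr0.
have pn : pi != 0 :> R by rewrite gt_eqF.
move: h pn => h; move: (pi : R) => c c0.
by field.
Qed.

(** * From the ADM flux at infinity to the integral of the mass density *)

Section Asymptotics.
Variables (C R0 : R).
Hypothesis dec : forall x y r, 0 < x -> 0 < r -> R0 <= r -> r ^+ 2 = x ^+ 2 + y ^+ 2 ->
    [/\ `|val0 u x y| <= C / r, `|val0 al x y| <= C / r,
        `|val1 u x y| <= C / r ^+ 2 /\ `|val2 u x y| <= C / r ^+ 2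
      & `|val1 al x y| <= C / r ^+ 2 /\ `|val2 al x y| <= C / r ^+ 2].

(* The linearisation of [(adm1, adm2)] at [u = al = 0]; its divergence is
   [mass_density]. *)
Definition mass1 (v a : @C2fun R) (x z : R) : R :=
  4 * (x * val1 v x z) + -2 * (x * val1 a x z) + 2 * val0 a x z.
Definition mass2 (v a : @C2fun R) (x z : R) : R :=
  4 * (x * val2 v x z) + -2 * (x * val2 a x z).

(* The two fluxes differ by terms quadratic in the potentials. *)
Lemma flux_quadratic (c x a b d1 d2 l1 l2 r : R) : 0 < r -> 0 <= x -> x <= r ->
  `|a| <= c / r -> `|b| <= c / r -> 8 * c <= r ->
  `|d1| <= c / r ^+ 2 -> `|l1| <= c / r ^+ 2 ->
  `|d2| <= c / r ^+ 2 -> `|l2| <= c / r ^+ 2 ->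
  `|4 * (x * d1) + -2 * (x * l1) + 2 * b -
    (expR (2 * b + -2 * a) - expR (-2 * a)
     - x * (expR (-2 * a) * (-2 * d1) + expR (2 * b + -2 * a) * (2 * l1 + -2 * d1)))|
    <= 100 * c ^+ 2 / r ^+ 2 /\
  `|4 * (x * d2) + -2 * (x * l2) -
    (- x * (expR (-2 * a) * (-2 * d2) + expR (2 * b + -2 * a) * (2 * l2 + -2 * d2)))|
    <= 100 * c ^+ 2 / r ^+ 2.
Proof.
move=> r0 x0 xr ha hb cr.
have c0 : 0 <= c / r := le_trans (normr_ge0 _) ha.
have cr8 : 8 * (c / r) <= 1 by rewrite mulrA ler_pdivrMr // mul1r.
have na : `|-2 * a| <= 2 * (c / r) by rewrite normrM normrN (ger0_norm (ler0n R 2)) ler_pM2l.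
have nb : `|2 * b + -2 * a| <= 4 * (c / r).
  by apply: le_trans (ler_normD _ _) _; rewrite !normrM normrN (ger0_norm (ler0n R 2)); lra.
have /andP[a1 a2] := expR_quad _ (ltac:(lra) : `|-2 * a| <= 2^-1).
have /andP[b1 b2] := expR_quad _ (ltac:(lra) : `|2 * b + -2 * a| <= 2^-1).
have a3 := expR_lip _ (ltac:(lra) : `|-2 * a| <= 2^-1).
have b3 := expR_lip _ (ltac:(lra) : `|2 * b + -2 * a| <= 2^-1).
have sq (t m : R) : `|t| <= m -> t ^+ 2 <= m ^+ 2.
  by move=> h; rewrite -(real_normK (num_real t)) lerXn2r ?nnegrE // (le_trans (normr_ge0 t)).
have a4 := sq _ _ na; have b4 := sq _ _ nb.
move: (expR (-2 * a)) (expR (2 * b + -2 * a)) a1 a2 b1 b2 a3 b3 => EA EB a1 a2 b1 b2 a3 b3.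
have key (d l : R) : `|d| <= c / r ^+ 2 -> `|l| <= c / r ^+ 2 ->
    `|x * (2 * d * (1 - EA) + 2 * d * (1 - EB) - 2 * l * (1 - EB))| <= 40 * (c / r) ^+ 2.
  move=> hd hl.
  have xc : x * (c / r ^+ 2) <= c / r.
    have -> : x * (c / r ^+ 2) = (c / r) * (x / r) by field; rewrite gt_eqF.
    by rewrite ler_piMr // ler_pdivrMr // mul1r.
  have t (e E m : R) : `|e| <= c / r ^+ 2 -> `|E - 1| <= m -> `|x * (2 * e * (1 - E))| <= 2 * (c / r) * m.
    move=> he hE; rewrite !normrM (ger0_norm x0) (ger0_norm (ler0n R 2)) distrC.
    rewrite (_ : x * (2 * `|e| * `|E - 1|) = (2 * (x * `|e|)) * `|E - 1|); last by ring.
    apply: ler_pM => //; rewrite ?mulr_ge0 // ler_pM2l //.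
    by apply: le_trans xc; rewrite ler_wpM2l.
  have mA : `|EA - 1| <= 4 * (c / r) by lra.
  have mB : `|EB - 1| <= 8 * (c / r) by lra.
  have t1 := t d EA _ hd mA; have t2 := t d EB _ hd mB; have t3 := t l EB _ hl mB.
  rewrite (_ : x * _ = x * (2 * d * (1 - EA)) + x * (2 * d * (1 - EB)) - x * (2 * l * (1 - EB))); last by ring.
  apply: le_trans (ler_normB _ _) _; apply: le_trans (lerD (ler_normD _ _) (lexx _)) _.
  by rewrite expr2; lra.
have cE : 100 * c ^+ 2 / r ^+ 2 = 100 * (c / r) ^+ 2 by field; rewrite gt_eqF.
move=> hd1 hl1 hd2 hl2; split; rewrite cE.
- have k := key d1 l1 hd1 hl1.
  (* The linear parts of the exponentials cancel [2 * b]; what remains of them is the second-order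
     remainder of [expR_quad]. *)
  rewrite (_ : _ - _ = x * (2 * d1 * (1 - EA) + 2 * d1 * (1 - EB) - 2 * l1 * (1 - EB))
    + ((EA - 1 - -2 * a) - (EB - 1 - (2 * b + -2 * a)))); last by ring.
  apply: le_trans (ler_normD _ _) _.
  have : `|EA - 1 - -2 * a - (EB - 1 - (2 * b + -2 * a))| <= 40 * (c / r) ^+ 2.
    by rewrite ler_norml; move: a4 b4; rewrite !exprMn; lra.
  by have := sqr_ge0 (c / r); lra.
- have k := key d2 l2 hd2 hl2.
  rewrite (_ : _ - _ = x * (2 * d2 * (1 - EA) + 2 * d2 * (1 - EB) - 2 * l2 * (1 - EB))); last by ring.
  by have := sqr_ge0 (c / r); lra.
Qed.

(** Each of the two components errs by at most [100 C^2 / r^2], and the length element contributes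
    [r]; the error tends to 0 at infinity. *)
Lemma flux_diff (r t : R) : 0 < r -> R0 <= r -> 8 * C <= r -> 0 <= t <= pi ->
  half_flux (mass1 u al) (mass2 u al) r t <=
  half_flux (adm1 u al) (adm2 u al) r t + 200 * C ^+ 2 / r.
Proof.
move=> r0 Rr Cr tpi.
have st : 0 <= sin t by exact: sin_ge0_pi.
have K0 : 0 <= 200 * C ^+ 2 / r by apply: divr_ge0; [apply: mulr_ge0; [exact: ler0n|exact: sqr_ge0]|exact: ltW].
have [s0|sn] := eqVneq (sin t) 0.
  rewrite [leLHS](_ : _ = 0); last by rewrite /half_flux /mass1 /mass2 s0 !mulr0; ring.
  rewrite [X in X + _](_ : _ = 0) ?add0r //.
  by rewrite /half_flux /adm1 /adm2 s0 !mulr0; ring.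
have {sn}sp : 0 < sin t by rewrite lt_def sn.
have x0 : 0 < r * sin t by rewrite mulr_gt0.
have r2 : r ^+ 2 = (r * sin t) ^+ 2 + (r * cos t) ^+ 2.
  by rewrite !exprMn -mulrDr addrC cos2Dsin2 mulr1.
have [h1 h2 [h3 h4] [h5 h6]] := dec _ _ _ x0 r0 Rr r2.
have s1 : sin t <= 1 by exact: sin_le1.
have xr : r * sin t <= r by rewrite ler_piMr // ltW.
have [f1 f2] := flux_quadratic C _ _ _ _ _ _ _ r r0 (ltW x0) xr h1 h2 Cr h3 h5 h4 h6.
move: f1 f2; rewrite -/(mass1 u al (r * sin t) (r * cos t)) -/(mass2 u al (r * sin t) (r * cos t))
  -/(adm1 u al (r * sin t) (r * cos t)) -/(adm2 u al (r * sin t) (r * cos t)) /half_flux.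
move: (mass1 _ _ _ _) (mass2 _ _ _ _) (adm1 _ _ _ _) (adm2 _ _ _ _) => a b c d f1 f2.
have c1 : `|cos t| <= 1 by rewrite ler_norml cos_geN1 cos_le1.
rewrite -lerBlDl -mulrBl.
have -> : 200 * C ^+ 2 / r = (200 * C ^+ 2 / r ^+ 2) * r by field; rewrite gt_eqF.
rewrite ler_pM2r //.
rewrite (_ : _ - _ = (a - c) * sin t + (b - d) * cos t); last by ring.
have e1 : (a - c) * sin t <= `|a - c|.
  by apply: le_trans (ler_norm _) _; rewrite normrM (ger0_norm st) ler_piMr.
have e2 : (b - d) * cos t <= `|b - d|.
  by apply: le_trans (ler_norm _) _; rewrite normrM ler_piMr.
lra.
Qed.

Hypothesis dens : forall x y, 0 < x ->
    2 * x * (val1 u x y ^+ 2 + val2 u x y ^+ 2) <= mass_density u al x y.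

(** The density is the divergence of the field with components [mass1] and [mass2], which is tangent
    to the axis. Its integral over the box is at most the flux through a large half circle, which
    exceeds 8 times the ADM flux by at most a term of order [1 / r]; let [r] tend to infinity. *)
Lemma mass_bound (m rho0 L : R) : 0 < rho0 -> rho0 <= L -> adm_mass_is (metric g) m ->
  I2 rho0 L (- L) L (mass_density u al) <= 8 * m.
Proof.
move=> rho00 rL adm; have L0 : 0 < L := lt_le_trans rho00 rL.
have Cx1 (F F1 F2 : R -> R -> R) : C1 F F1 F2 -> C1 (fun x z => x * F x z)
    (fun x z => 1 * F x z + x * F1 x z) (fun x z => 0 * F x z + x * F2 x z).
  by move=> CF; apply: C1M => //; exact: C1_fst.
have CX1 := C1D _ _ _ _ _ _ (C1D _ _ _ _ _ _ (C1Z 4 _ _ _ (Cx1 _ _ _ (val1_C1 u)))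
  (C1Z (-2) _ _ _ (Cx1 _ _ _ (val1_C1 al)))) (C1Z 2 _ _ _ (val0_C1 al)).
have CX2 := C1D _ _ _ _ _ _ (C1Z 4 _ _ _ (Cx1 _ _ _ (val2_C1 u)))
  (C1Z (-2) _ _ _ (Cx1 _ _ _ (val2_C1 al))).
have X0 y : mass1 u al 0 y = 0 by rewrite /mass1 !mul0r !mulr0 al_axis !add0r mulr0.
have cf := cont2_density u al.
have f0 x y : 0 <= x -> 0 <= mass_density u al x y.
  rewrite le_eqVlt => /predU1P[<-|x0].
    apply: (continuous_ge0_at0 (fun x => mass_density u al x y)); first exact: (cont2_l (mass_density u al)).
    move=> {}x x0; apply: le_trans (dens x y x0).
    by rewrite !mulr_ge0 ?addr_ge0 ?sqr_ge0 // ltW.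
  by apply: le_trans (dens x y x0); rewrite !mulr_ge0 ?addr_ge0 ?sqr_ge0 // ltW.
apply: (@le_trans _ _ (I2 0 L (- L) L (mass_density u al))).
  apply: le_I2_sub; [exact: cf|by move=> x y /andP[? _] _; exact: f0|exact: ltW|exact: lexx|exact: lexx|exact: lexx].
have p0 : 0 < pi :> R := pi_gt0 R.
have key (r : R) : 0 < r -> R0 <= r -> 8 * C <= r -> 2 * L <= r ->
    I2 0 L (- L) L (mass_density u al) <= 8 * adm_flux (metric g) r + 200 * C ^+ 2 * pi / r.
  move=> r0 Rr Cr Lr.
  have := box_le_flux (mass1 u al) (mass2 u al) _ _ _ _ CX1 CX2 X0 r L L0 Lr.
  rewrite (_ : I2 _ _ _ _ _ = I2 0 L (- L) L (mass_density u al)); last first.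
    by apply: eq_I2 => x y _ _; rewrite /mass_density; ring.
  move=> bx; apply: le_trans (bx _) _.
    by move=> x y x0; apply: le_trans (f0 x y x0) _; apply: eq_ler; rewrite /mass_density; ring.
  have [cu cu1 cu2 _ _] := C2_cont u; have [ca ca1 ca2 _ _] := C2_cont al.
  have cm : continuous (half_flux (mass1 u al) (mass2 u al) r).
    by apply: continuous_half_flux; rewrite /mass1 /mass2; solve_cont2.
  have ca' : continuous (half_flux (adm1 u al) (adm2 u al) r).
    by apply: continuous_half_flux; rewrite /adm1 /adm2; solve_cont2.
  rewrite adm_fluxE // mulrA divff ?mul1r //.
  apply: (@le_trans _ _ (I1 0 pi (fun t => half_flux (adm1 u al) (adm2 u al) r t + 200 * C ^+ 2 / r))).
    apply: le_I1 => //; last by move=> t tp; exact: flux_diff.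
    by move=> t; apply: continuousD; [exact: ca'|exact: cvg_cst].
  rewrite I1D //; last exact: cont_cst.
  by rewrite lerD2l I1_cst ?(ltW p0) // subr0; apply: eq_ler; ring.
rewrite leNgt; apply/negP; set J := I2 _ _ _ _ _ in key * => gt.
(* For [r > T] the ADM flux costs less than [8 * e] and the quadratic error at most [e], less than
   the assumed excess [16 * e]. *)
pose e : R := (J - 8 * m) / 16.
have e0 : 0 < e by rewrite divr_gt0 // subr_gt0.
have eE : 16 * e = J - 8 * m by rewrite /e; field.
pose T : R := `|R0| + 8 * `|C| + 2 * L + 200 * C ^+ 2 * pi / e.
have K0 : 0 <= 200 * C ^+ 2 * pi.
  by apply: mulr_ge0; [apply: mulr_ge0; [exact: ler0n|exact: sqr_ge0]|exact: ltW].
have Ke0 : 0 <= 200 * C ^+ 2 * pi / e by rewrite divr_ge0 // ltW.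
have : \forall r \near +oo, `|m - adm_flux (metric g) r| < e /\ T < r.
  near=> r; split.
    by near: r; move/cvgrPdist_lt: adm; apply.
  by near: r; apply: nbhs_pinfty_gt; exact: num_real.
move=> /filter_ex[r [h1 h2]].
have nR := normr_ge0 R0; have nC := normr_ge0 C; have lR := ler_norm R0; have lC := ler_norm C.
have r0 : 0 < r by rewrite /T in h2; lra.
have := key r r0 _ _ _; move=> /(_ (ltac:(rewrite /T in h2; lra)) (ltac:(rewrite /T in h2; lra)) (ltac:(rewrite /T in h2; lra))).
have : 200 * C ^+ 2 * pi / r <= e.
  have : 200 * C ^+ 2 * pi / e < r by rewrite /T in h2; lra.
  by rewrite ltr_pdivrMr // => h3; rewrite ler_pdivrMr // [e * r]mulrC ltW.
move: h1; rewrite ltr_norml => /andP[h1 h1'].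
lra.
Unshelve. all: by end_near. Qed.

End Asymptotics.

End AdmFlux.

(** * Sobolev norms of the defect *)

Lemma sum2 (V : nmodType) (F : 'I_2 -> V) : \sum_i F i = F hrho + F hz.
Proof.
by rewrite !big_ord_recl big_ord0 addr0; congr (F _ + F _); exact: val_inj.
Qed.

Section Norms.
Context {R : realType}.

(** The comparison goes through the supremum over simple functions below the integrand, so it
    applies directly to the Sobolev density, with no measurability to establish for it. *)
Lemma ge0_integral_le_sup d (T : measurableType d) (mu : {measure set T -> \bar R}) (D E : set T)
    (f k : T -> \bar R) : (forall x, D x -> (0 <= f x)%E) -> (forall x, E x -> (0 <= k x)%E) ->
  D `<=` E -> (forall x, D x -> (f x <= k x)%E) ->
  (\int[mu]_(x in D) f x <= \int[mu]_(x in E) k x)%E.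
Proof.
move=> f0 k0 DE fk; rewrite !ge0_integralE //.
apply: ge_ereal_sup => _ [h hf <-]; apply: ereal_sup_ubound; exists h => // x.
apply: le_trans (hf x) _; rewrite !patchE; case: ifPn => [|_].
  rewrite inE => Dx; rewrite mem_set; [exact: fk|exact: DE].
by case: ifPn => // /[!inE] Ex; exact: k0.
Qed.

Lemma integral_cylinder d1 d2 (T1 : measurableType d1) (T2 : measurableType d2)
    (m1 : {sigma_finite_measure set T1 -> \bar R}) (m2 : {sigma_finite_measure set T2 -> \bar R})
    (A : set T1) (B : set T2) (h : T1 -> R) : measurable A -> measurable B ->
  measurable_fun A h -> (forall x, A x -> 0 <= h x) ->
  (\int[m1 \x m2]_(z in A `*` B) (h z.1)%:E = (\int[m1]_(x in A) (h x)%:E) * m2 B)%E.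
Proof.
move=> mA mB mh h0.
have mh' : measurable_fun setT ((EFin \o h) \_ A).
  by apply/(measurable_restrictT _ _).1 => //; exact/measurable_EFinP.
have h0' x : A x -> (0 <= (h x)%:E)%E by move=> Ax; rewrite lee_fin; exact: h0.
have -> : (\int[m1 \x m2]_(z in A `*` B) (h z.1)%:E =
    \int[m1 \x m2]_z (((EFin \o h) \_ A) z.1 * (\1_B z.2)%:E))%E.
  rewrite integral_mkcond; apply: eq_integral => -[x y] _ /=.
  rewrite !patchE in_setX indicE /=.
  by case: (x \in A); case: (y \in B); rewrite /= ?mule1 ?mule0 ?mul0e.
rewrite fubini_tonelli1.
- rewrite [X in (X * _)%E]integral_mkcond -ge0_integralZr //; last first.
    by move=> x _; exact: erestrict_ge0.
  apply: eq_integral => x _; rewrite /fubini_F /=.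
  rewrite ge0_integralZl //; last first.
  + exact: erestrict_ge0.
  + by apply/measurable_EFinP; exact: measurable_indic.
  by rewrite integral_indic // setIT.
- apply: emeasurable_funM.
    exact: (measurableT_comp mh' measurable_fst).
  apply/measurable_EFinP.
  exact: (measurableT_comp (measurable_indic mB) measurable_snd).
- by move=> z; apply: mule_ge0 => //; exact: erestrict_ge0.
Qed.

Lemma integral_cylinder2 da db dc (Ta : measurableType da) (Tb : measurableType db)
    (Tc : measurableType dc) (ma : {sigma_finite_measure set Ta -> \bar R})
    (mb : {sigma_finite_measure set Tb -> \bar R}) (mc : {sigma_finite_measure set Tc -> \bar R})
    (A : set (Ta * Tb)) (B : set Tc) (h : Ta * Tb -> R) : measurable A -> measurable B ->
  measurable_fun A h -> (forall x, A x -> 0 <= h x) ->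
  (\int[(ma \x mb) \x mc]_(z in A `*` B) (h z.1)%:E =
    (\int[ma \x mb]_(x in A) (h x)%:E) * mc B)%E.
Proof.
(* The product carries a canonical sigma-finite structure only when both factors
   are finite, so it is rebuilt here. *)
pose mab : {sigma_finite_measure set (Ta * Tb)%type -> \bar R} := HB.pack (ma \x mb)%E
  (lebesgue_integral_fubini.measure_function_Measure_isSigmaFinite__to__measure_function_isSFinite ma mb)
  (lebesgue_integral_fubini.measure_function_Measure_isSigmaFinite__to__measure_function_isSigmaFinite ma mb).
move=> mA mB mh h0; exact: (integral_cylinder _ _ _ _ mab mc A B h mA mB mh h0).
Qed.

Lemma integral_box3 (a b c d : R) (h : R -> R -> R) : cont2 h ->
  (forall x y, a <= x <= b -> c <= y <= d -> 0 <= h x y) ->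
  (\int[@leb3 R]_(z in (`[a, b]%classic `*` `[c, d]%classic) `*` `[0%R, (2 * pi)%R[%classic)
     (h z.1.1 z.1.2)%:E)%E = (2 * pi * I2 a b c d h)%:E.
Proof.
move=> ch h0.
have p0 : 0 < pi :> R := pi_gt0 R.
have pE : @lebesgue_measure R `[0%R, (2 * pi)%R[%classic = (2 * pi)%:E.
  by rewrite lebesgue_measure_itv /= lte_fin mulr_gt0 // oppr0 adde0.
rewrite [RHS](_ : _ = (I2 a b c d h)%:E * (2 * pi)%:E)%E; last by rewrite -EFinM mulrC.
rewrite -integral_box // -pE.
have k := integral_cylinder2 _ _ _ _ _ _ (@lebesgue_measure R) (@lebesgue_measure R) (@lebesgue_measure R)
  (`[a, b]%classic `*` `[c, d]%classic) `[0%R, (2 * pi)%R[%classic (fun z => h z.1 z.2).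
apply: k.
- by apply: measurableX; exact: measurable_itv.
- exact: measurable_itv.
- by apply: measurable_funTS; exact: cont2_measurable.
- by move=> [x y] [/=]; rewrite !in_itv /=; exact: h0.
Qed.

Lemma poweR_lt_fin (I : \bar R) (K eps p : R) : (0 <= I)%E -> (I <= K%:E)%E -> 0 < p -> 0 < eps ->
  K < eps `^ p -> (I `^ p^-1 < eps%:E)%E.
Proof.
move=> I0 IK p0 e0 Ke; have K0 : 0 <= K by rewrite -lee_fin (le_trans I0).
have ip : 0 < p^-1 by rewrite invr_gt0.
apply: (@le_lt_trans _ _ (K%:E `^ p^-1)%E).
  by apply: (gt0_ler_poweR (ltW ip)) => //; rewrite in_itv /= ?leey ?andbT // (le_trans I0).
rewrite poweR_EFin lte_fin.
rewrite -[ltRHS](_ : (eps `^ p) `^ p^-1 = eps); last first.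
  by rewrite -powRrM divff ?gt_eqF // powRr1 // ltW.
by apply: (gt0_ltr_powR ip) => //; rewrite nnegrE // powR_ge0.
Qed.

Lemma sum_diag n (t : 'I_n -> 'I_n -> R) : (forall i j, i != j -> t i j = 0) ->
  \sum_i \sum_j t i j = \sum_i t i i.
Proof.
move=> off; apply: eq_bigr => i _; rewrite (bigD1 i) //= big1 ?addr0 // => j ji.
by rewrite off // eq_sym.
Qed.

Definition pd_seq (h1 h2 : R -> R -> R) (n : 'I_3) (x y : R) : R := [:: h1 x y; h2 x y; 0]`_n.

Lemma D3_C1 (h h1 h2 : R -> R -> R) : C1 h h1 h2 -> D3 h (pd_seq h1 h2).
Proof.
move=> Ch x y _; split=> //.
- exact: (C1_der1 _ _ _ x y Ch).
- exact: (C1_der2 _ _ _ x y Ch).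
Qed.

Lemma entry_density3 (p : R) (F : 'rV[R]_3 -> R) (h h1 h2 : R -> R -> R) x : 0 < p ->
  (forall y, off_axis y -> F y = h (y 0 crho) (y 0 cz)) -> C1 h h1 h2 -> off_axis x ->
  `|F x| `^ p + \sum_k `|pd k F x| `^ p =
  `|h (x 0 crho) (x 0 cz)| `^ p + (`|h1 (x 0 crho) (x 0 cz)| `^ p + `|h2 (x 0 crho) (x 0 cz)| `^ p).
Proof.
move=> p0 Fh Ch ox; rewrite sum3 !(pd_off _ _ _ _ _ Fh (D3_C1 _ _ _ Ch) ox) Fh //.
by rewrite /pd_seq /= normr0 powR0 ?gt_eqF // addr0.
Qed.

Lemma entry_density2 (p : R) (F : 'rV[R]_2 -> R) (h h1 h2 : R -> R -> R) x y : C1 h h1 h2 ->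
  (forall x y, 0 < x -> F (vec2 x y) = h x y) -> 0 < x ->
  `|F (vec2 x y)| `^ p + \sum_k `|pd k F (vec2 x y)| `^ p =
  `|h x y| `^ p + (`|h1 x y| `^ p + `|h2 x y| `^ p).
Proof.
by move=> Ch Fh x0; rewrite sum2 Fh //; have [-> ->] := pd_half F h h1 h2 x y Ch Fh x0.
Qed.

End Norms.

(** * Sobolev densities of the metric and orbit defects in terms of the potentials *)

Section Comparison.
Context {R : realType}.
Variable g : axisym_metric R.
Hypothesis AB : forall h, half_plane h -> coef_A g h = 0 /\ coef_B g h = 0.
Variables (u al : @C2fun R).
Hypothesis uE : forall x y, 0 < x -> val0 u x y = coef_u g (vec2 x y).
Hypothesis alE : forall x y, 0 < x -> val0 al x y = coef_alpha g (vec2 x y).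

Definition sqr_ang (x y : R) : R := x ^+ 2 * ang u x y.
Definition sqr_ang1 (x y : R) : R := 2 * x * ang u x y + x ^+ 2 * ang1 u x y.
Definition sqr_ang2 (x y : R) : R := x ^+ 2 * ang2 u x y.

Lemma sqr_ang_C1 : C1 sqr_ang sqr_ang1 sqr_ang2.
Proof.
have := C1M _ _ _ _ _ _ (C1M _ _ _ _ _ _ C1_fst C1_fst) (ang_C1 u).
congr C1; apply/funext => x; apply/funext => y; rewrite /sqr_ang1 /sqr_ang2; ring.
Qed.

Lemma cyl_defect (y : 'rV[R]_3) i j : off_axis y -> (cyl_metric g y - euclid_cyl y) i j =
  (if i == j then if i == cphi then sqr_ang (y 0 crho) (y 0 cz) else conf u al (y 0 crho) (y 0 cz)
   else 0).
Proof.
move=> oy; rewrite (cyl_metric_off _ AB _ _ uE alE) // /euclid_cyl /diag3 !mxE.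
have [_|_] := eqVneq i j; last by rewrite !mulr0n subrr.
rewrite !mulr1n; move: i; apply: ord3P; rewrite /= /sqr_ang /conf /ang.
- by congr (expR _ + _); ring.
- by congr (expR _ + _); ring.
- by ring.
Qed.

(** The factor 9 counts three diagonal entries, each with its value and its two nonzero derivatives;
    the other terms are powers of 0, and vanish since [0 < p]. *)
Lemma density_cyl (p : R) (x : 'rV[R]_3) (G : R) : 0 < p -> off_axis x ->
  `|conf u al (x 0 crho) (x 0 cz)| `^ p <= G ->
  `|conf1 u al (x 0 crho) (x 0 cz)| `^ p <= G -> `|conf2 u al (x 0 crho) (x 0 cz)| `^ p <= G ->
  `|sqr_ang (x 0 crho) (x 0 cz)| `^ p <= G ->
  `|sqr_ang1 (x 0 crho) (x 0 cz)| `^ p <= G -> `|sqr_ang2 (x 0 crho) (x 0 cz)| `^ p <= G ->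
  sobolev_density p (fun y => cyl_metric g y - euclid_cyl y) x <= 9 * G.
Proof.
move=> p0 ox c0 c1 c2 a0 a1 a2; rewrite /sobolev_density.
have off i j : i != j -> `|(cyl_metric g x - euclid_cyl x) i j| `^ p +
    \sum_k `|pd k (fun y => (cyl_metric g y - euclid_cyl y) i j) x| `^ p = 0.
  move=> ij; rewrite (entry_density3 p (fun y => (cyl_metric g y - euclid_cyl y) i j)
    (fun _ _ => 0) (fun _ _ => 0) (fun _ _ => 0)) //.
  - by rewrite normr0 powR0 ?gt_eqF // !addr0.
  - by move=> y oy; rewrite cyl_defect // (negbTE ij).
  - exact: C1_cst.
have dia i : i != cphi -> `|(cyl_metric g x - euclid_cyl x) i i| `^ p +
    \sum_k `|pd k (fun y => (cyl_metric g y - euclid_cyl y) i i) x| `^ p <= 3 * G.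
  move=> ni; rewrite (entry_density3 p (fun y => (cyl_metric g y - euclid_cyl y) i i) _ _ _ _ _ _ (conf_C1 u al)) //.
    by lra.
  by move=> y oy; rewrite cyl_defect // eqxx (negbTE ni).
have phi : `|(cyl_metric g x - euclid_cyl x) cphi cphi| `^ p +
    \sum_k `|pd k (fun y => (cyl_metric g y - euclid_cyl y) cphi cphi) x| `^ p <= 3 * G.
  rewrite (entry_density3 p (fun y => (cyl_metric g y - euclid_cyl y) cphi cphi) _ _ _ _ _ _ sqr_ang_C1) //.
    by lra.
  by move=> y oy; rewrite cyl_defect // !eqxx.
have d0 := dia crho isT; have d1 := dia cz isT.
rewrite (sum_diag _ _ off) sum3; apply: le_trans (lerD (lerD d0 d1) phi) _; apply: eq_ler; ring.
Qed.

Lemma orbit_defect (x y : R) i j : 0 < x ->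
  (orbit_metric g (vec2 x y) - 1%:M) i j = if i == j then conf u al x y else 0.
Proof.
move=> x0; have [e0 e1] := vec2E x y.
have subE (A : 'M[R]_2) : (A - 1%:M) i j = A i j - (i == j)%:R by rewrite !mxE.
rewrite subE /orbit_metric mxE e0 e1.
set X := vec3 x y 0.
have [f0 f1 _] := vec3E x y 0; rewrite -/X in f0 f1.
have oX : off_axis X by rewrite /off_axis /= f0.
have inE (k l : 'I_3) : inner (cyl_metric g) X (delta_mx 0 k) (delta_mx 0 l) = cyl_metric g X k l.
  by rewrite /inner -rowE trmx_delta -colE !mxE.
rewrite /killing !inE.
have dE k l : cyl_metric g X k l = (if k == l then if k == cphi then sqr_ang x y else conf u al x y else 0)
    + euclid_cyl X k l.
  by have := cyl_defect X k l oX; rewrite f0 f1 => <-; rewrite !mxE subrK.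
have ne (k : 'I_2) : (widen_ord (leqnSn 2) k == cphi) = false by case: k => -[|[|]].
have zE (k : 'I_2) : cyl_metric g X (widen_ord (leqnSn 2) k) cphi = 0.
  by rewrite dE ne add0r /euclid_cyl mxE ne mulr0n.
rewrite !zE !mul0r subr0 dE ne.
have -> : (widen_ord (leqnSn 2) i == widen_ord (leqnSn 2) j) = (i == j) by [].
have [<-|ij] := eqVneq i j; last first.
  rewrite mulr0n subr0 add0r /euclid_cyl mxE.
  have -> : (widen_ord (leqnSn 2) i == widen_ord (leqnSn 2) j) = false by exact: negbTE.
  by rewrite mulr0n.
rewrite /euclid_cyl mxE eqxx !mulr1n mxE.
by case: (i) => -[|[|]] //= _; rewrite addrK.
Qed.

Lemma density_orbit (p : R) (x y : R) (G : R) : 0 < p -> 0 < x ->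
  `|conf u al x y| `^ p <= G ->
  `|conf1 u al x y| `^ p <= G -> `|conf2 u al x y| `^ p <= G ->
  sobolev_density p (fun y => orbit_metric g y - 1%:M) (vec2 x y) <= 6 * G.
Proof.
move=> p0 x0 c0 c1 c2; rewrite /sobolev_density.
have off i j : i != j -> `|(orbit_metric g (vec2 x y) - 1%:M) i j| `^ p +
    \sum_k `|pd k (fun y => (orbit_metric g y - 1%:M) i j) (vec2 x y)| `^ p = 0.
  move=> ij; rewrite (entry_density2 p (fun y => (orbit_metric g y - 1%:M) i j)
    (fun _ _ => 0) (fun _ _ => 0) (fun _ _ => 0)) //.
  - by rewrite normr0 powR0 ?gt_eqF // !addr0.
  - exact: C1_cst.
  - by move=> a b a0; rewrite orbit_defect // (negbTE ij).
have dia i : `|(orbit_metric g (vec2 x y) - 1%:M) i i| `^ p +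
    \sum_k `|pd k (fun y => (orbit_metric g y - 1%:M) i i) (vec2 x y)| `^ p <= 3 * G.
  rewrite (entry_density2 p (fun y => (orbit_metric g y - 1%:M) i i) _ _ _ _ _ (conf_C1 u al)) //.
    by lra.
  by move=> a b a0; rewrite orbit_defect // eqxx.
have d0 := dia hrho; have d1 := dia hz.
rewrite (_ : 6 * G = 3 * G + 3 * G); last by ring.
rewrite (sum_diag _ _ off).
rewrite sum2.
exact: lerD d0 d1.
Qed.

(** [18 * pi * rho1] is the 9 of [density_cyl] times the length [2 * pi] of the angle interval and
    the bound [rho1] for the volume density; 6 is the factor of [density_orbit]. Their sum covers
    both norms. *)
Lemma norms_small (rho0 rho1 sigma p eps : R) (G : R -> R -> R) :
  0 < rho0 -> rho0 < rho1 -> 0 < sigma -> 1 <= p -> 0 < eps -> cont2 G ->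
  (forall x y, rho0 <= x <= rho1 -> - (rho1 / 2) <= y <= rho1 / 2 ->
    [/\ `|conf u al x y| `^ p <= G x y,
      `|conf1 u al x y| `^ p <= G x y /\ `|conf2 u al x y| `^ p <= G x y,
      `|sqr_ang x y| `^ p <= G x y, `|sqr_ang1 x y| `^ p <= G x y
    & `|sqr_ang2 x y| `^ p <= G x y]) ->
  (18 * pi * rho1 + 6) * I2 rho0 rho1 (- (rho1 / 2)) (rho1 / 2) G < eps `^ p ->
  (W1p_norm3 p (region3 rho0 rho1 sigma) (fun x => cyl_metric g x - euclid_cyl x)%R < eps%:E)%E /\
  (W1p_norm2 p (region2 rho0 rho1 sigma) (fun y => orbit_metric g y - 1%:M)%R < eps%:E)%E.
Proof.
move=> r0 r01 s0 p1 e0 cG GE small.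
have p0 : 0 < p by lra.
have pi0 : 0 < pi :> R := pi_gt0 R.
have r1 : 0 < rho1 := lt_trans r0 r01.
have G0 x y : rho0 <= x <= rho1 -> - (rho1 / 2) <= y <= rho1 / 2 -> 0 <= G x y.
  by move=> hx hy; have [h _ _ _ _] := GE x y hx hy; apply: le_trans h; exact: powR_ge0.
have J0 : 0 <= I2 rho0 rho1 (- (rho1 / 2)) (rho1 / 2) G by exact: I2_ge0.
have JE c : I2 rho0 rho1 (- (rho1 / 2)) (rho1 / 2) (fun x y => c * G x y) =
    c * I2 rho0 rho1 (- (rho1 / 2)) (rho1 / 2) G by exact: I2Z.
have cG' c : cont2 (fun x y => c * G x y) by solve_cont2.
have reg (z : R * R) : region2 rho0 rho1 sigma z ->
    [/\ rho0 <= z.1 <= rho1, - (rho1 / 2) <= z.2 <= rho1 / 2 & 0 < z.1].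
  move=> [/andP[h1 h2]]; rewrite ler_norml => h3; split=> //; last by lra.
  by apply/andP; split=> //; lra.
have pd0 n (h : 'rV[R]_n.+1 -> 'M[R]_n.+1) x : 0 <= sobolev_density p h x.
  by do 2!apply: sumr_ge0 => ? _; rewrite addr_ge0 ?powR_ge0 //; apply: sumr_ge0 => ? _; exact: powR_ge0.
have sub2 : region2 rho0 rho1 sigma `<=` `[rho0, rho1]%classic `*` `[- (rho1 / 2), rho1 / 2]%classic.
  by move=> z /reg[h1 h2 _]; split; rewrite /= in_itv.
have J6 : 0 <= 6 * I2 rho0 rho1 (- (rho1 / 2)) (rho1 / 2) G by exact: mulr_ge0.
have Jp : 0 <= 18 * pi * rho1 * I2 rho0 rho1 (- (rho1 / 2)) (rho1 / 2) G.
  by rewrite !mulr_ge0 // ltW.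
rewrite mulrDl in small.
split.
- apply: (poweR_lt_fin _ (18 * pi * rho1 * I2 rho0 rho1 (- (rho1 / 2)) (rho1 / 2) G)) => //.
  + apply: integral_ge0 => z [/reg[_ _ z0] _]; rewrite lee_fin mulr_ge0 ?pd0 ?(ltW z0) //.
  + have -> : 18 * pi * rho1 * I2 rho0 rho1 (- (rho1 / 2)) (rho1 / 2) G =
      2 * pi * I2 rho0 rho1 (- (rho1 / 2)) (rho1 / 2) (fun x y => 9 * rho1 * G x y) by rewrite JE; ring.
    rewrite -integral_box3; last 2 first.
    * exact: cG'.
    * by move=> x y hx hy; rewrite !mulr_ge0 ?(ltW r1) //; exact: G0.
    apply: ge0_integral_le_sup.
    * by move=> z [/reg[_ _ z0] _]; rewrite lee_fin mulr_ge0 ?pd0 ?(ltW z0) //.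
    * move=> z [[/=]]; rewrite !in_itv /= => hx hy _.
      by rewrite lee_fin !mulr_ge0 ?(ltW r1) //; exact: G0.
    * by move=> z [z1 z2]; split=> //; exact: sub2.
    * move=> z [/reg[h1 h2 z0] _]; rewrite lee_fin.
      have [x0 x1 _] := vec3E z.1.1 z.1.2 z.2.
      have [k1 [k2 k3] k4 k5 k6] := GE _ _ h1 h2.
      have oz : off_axis (vec3 z.1.1 z.1.2 z.2) by rewrite /off_axis /= x0.
      have := density_cyl p _ (G z.1.1 z.1.2) p0 oz; rewrite x0 x1 => /(_ k1 k2 k3 k4 k5 k6) k.
      rewrite mulrAC; apply: ler_pM; [exact: pd0|exact: ltW|exact: k|by case/andP: h1].
  + by apply: le_lt_trans small; apply: ler_wpDr.
- apply: (poweR_lt_fin _ (6 * I2 rho0 rho1 (- (rho1 / 2)) (rho1 / 2) G)) => //.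
  + by apply: integral_ge0 => z _; rewrite lee_fin; exact: pd0.
  + rewrite -JE -integral_box; last exact: cG'.
    apply: ge0_integral_le_sup.
    * by move=> z _; rewrite lee_fin; exact: pd0.
    * move=> z [/=]; rewrite !in_itv /= => hx hy.
      by rewrite lee_fin mulr_ge0 //; exact: G0.
    * exact: sub2.
    * move=> z /reg[h1 h2 z0]; rewrite lee_fin.
      have [k1 [k2 k3] k4 k5 k6] := GE _ _ h1 h2.
      exact: density_orbit.
  + by apply: le_lt_trans small; apply: ler_wpDl.
Qed.

End Comparison.

Theorem theorem1p4 (R : realType) (M : set (axisym_metric R)) (R0 rho0 : R)
  (scal_ge0 : forall g, M g -> nonneg_scalar_curvature g)
  (flatM : uniformly_flat M R0)
  (rho0_gt0 : 0 < rho0)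
  (monoM : radially_monotone M rho0)
  (AB0 : forall g, M g -> forall x, half_plane x -> coef_A g x = 0 /\ coef_B g x = 0) :
  forall rho1 eps sigma p : R,
    Num.max rho0 R0 < rho1 -> 0 < eps -> 0 < sigma -> 1 <= p -> p < 2 ->
  exists2 delta : R, 0 < delta &
    forall g, M g -> forall m : R, adm_mass_is (metric g) m -> m < delta ->
      (W1p_norm3 p (region3 rho0 rho1 sigma)
         (fun x => cyl_metric g x - euclid_cyl x)%R < eps%:E)%E /\
      (W1p_norm2 p (region2 rho0 rho1 sigma)
         (fun y => orbit_metric g y - 1%:M)%R < eps%:E)%E.
Proof.
move=> rho1 eps sigma p; rewrite gt_max => /andP[r01 _] e0 s0 p1 p2.
have [C flat] := flatM.
have pi0 : 0 < pi :> R := pi_gt0 R.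
have r1 : 0 < rho1 := lt_trans rho0_gt0 r01.
have K0 : 0 < 18 * pi * rho1 + 6 by rewrite addr_gt0 // !mulr_gt0.
have ep0 : 0 < eps `^ p by exact: powR_gt0.
(* The tolerance is half of what [norms_small] allows, since a strict inequality is required
   there. *)
have [delta d0 core] := core_estimate C R0 rho0 rho1 p
  (eps `^ p / (2 * (18 * pi * rho1 + 6))) rho0_gt0 (ltW r01) p1 p2
  (divr_gt0 ep0 (mulr_gt0 (ltr0n R 2) K0)).
exists delta => // g Mg m adm md.
have AB := AB0 g Mg.
have [u [al [uE alE al_axis]]] := potentials_exist g AB.
have dens x y (x0 : 0 < x) := density_scalar g AB u al uE alE x y (scal_ge0 g Mg) x0.
have dec x y r := decay_potentials g u al uE alE C R0 x y r (flat g Mg).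
have D : axi_data rho0 R0 C m u al.
  split=> //.
  - by move=> y; apply: (mono_potentials g AB) => //; exact: monoM.
  - by move=> L rL; exact: (mass_bound g AB u al uE alE al_axis C R0 dec dens m rho0 L).
have [G [cG GI GE]] := core m u al D md.
apply: (norms_small g AB u al uE alE rho0 rho1 sigma p eps G) => //.
apply: (@le_lt_trans _ _ (eps `^ p / 2)); last by rewrite gtr_pMr // invf_lt1 ?ltr1n.
by move: GI; rewrite ler_pdivlMr ?mulr_gt0 // ler_pdivlMr // => h; lra.
Qed.
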